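(* Let $f\in IV\cup III\cup II_a\cup II_b\cup II_c$ be either a contraction with real coefficients or an element of the subclass $II'_c$, and let $H_f=W/\langle f\rangle$. Let $\sigma:H_f\to H_f$ be an even Real structure on $H_f$. Then there exists a holomorphic automorphism $g\in\mathrm{Aut}_h(H_f)$ such that $\sigma=g\circ s_f\circ g^{-1}$, where $s_f$ is the standard Real structure on $H_f$.
   Context: $W=\mathbb{C}^2\setminus\{0\}$. For a contraction $f:W\to W$ below, $\langle f\rangle$ is the cyclic group generated by $f$, $H_f=W/\langle f\rangle$ is a primary Hopf surface, and $\mathrm{Aut}_h(\cdot)$ denotes the group of biholomorphisms. Classes of contractions of $W$: - $IV$: $f(z,w)=(\alpha z,\alpha w)$, $0<|\alpha|<1$; - $III$: $f(z,w)=(\delta^r z,\delta w)$, $r\in\mathbb{N}$, $r\ge 2$, $0<|\delta|<1$; - $II_a$: $f(z,w)=(\delta^r z+w^r,\delta w)$, $r\in\mathbb{N}$, $r\ge2$, $0<|\delta|<1$; - $II_b$: $f(z,w)=(\alpha z+w,\alpha w)$, $0<|\alpha|<1$; - $II_c$: $f(z,w)=(\alpha z,\delta w)$, $0<|\alpha|<1$, $0<|\delta|<1$, $\alpha\ne\delta^r$ for all $r\in\mathbb{N}$; - $II'_c\subset II_c$: $f(z,w)=(\alpha z,\bar\alpha w)$, $0<|\alpha|<1$, $\alpha\notin\mathbb{R}$. A Real structure on a complex manifold is an anti-holomorphic involution of it. A Real structure $\sigma$ on $H_f$ always lifts to an anti-holomorphic automorphism $\hat\sigma$ of $W$, and $\hat\sigma^2=f^n$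 for some $n\in\mathbb{Z}$ whose parity depends only on $\sigma$; $\sigma$ is called even if there is a lift $\hat\sigma$ with $\hat\sigma^2=\mathrm{id}_W$ (equivalently $n$ is even). The standard Real structure $s_f$ on $H_f$ is the one induced by the conjugation $c(z,w)=(\bar z,\bar w)$ if $f$ has real coefficients, and the one induced by $c'(z,w)=(\bar w,\bar z)$ if $f\in II'_c$. *)

(* Defs.v *)
From Stdlib Require Import Reals List ClassicalEpsilon.
From Coquelicot Require Import Coquelicot.
Import ListNotations.
Open Scope C_scope.

Notation C2 := (C * C)%type.

Definition W (p : C2) : Prop := p <> (RtoC 0, RtoC 0).

(** Complex conjugation on C^2, and conjugation composed with the swap. *)
Definition conj2 (p : C2) : C2 := (Cconj (fst p), Cconj (snd p)).
Definition conj_swap (p : C2) : C2 := (Cconj (snd p), Cconj (fst p)).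

Definition holomorphic_at (F : C2 -> C2) (p : C2) : Prop :=
  ex_filterdiff (K := C_AbsRing) F (locally p).
Definition antiholomorphic_at (F : C2 -> C2) (p : C2) : Prop :=
  holomorphic_at (fun q => conj2 (F q)) p.

(** Maps of W are represented by functions on C^2 whose value at the origin is
    irrelevant. *)
Definition antiholomorphic_self_map_W (F : C2 -> C2) : Prop :=
  forall p, W p -> W (F p) /\ antiholomorphic_at F p.

Definition antiholomorphic_automorphism_W (F : C2 -> C2) : Prop :=
  antiholomorphic_self_map_W F /\
  exists G, antiholomorphic_self_map_W G /\
    forall p, W p -> G (F p) = p /\ F (G p) = p.

(** * Contractions *)

Inductive contraction : Type :=
| IV (alpha : C)
| III (r : nat) (delta : C)
| IIa (r : nat) (delta : C)
| IIb (alpha : C)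
| IIc (alpha delta : C).

Definition contraction_map (k : contraction) (p : C2) : C2 :=
  let (z, w) := p in
  match k with
  | IV alpha => (alpha * z, alpha * w)
  | III r delta => (delta ^ r * z, delta * w)
  | IIa r delta => (delta ^ r * z + w ^ r, delta * w)
  | IIb alpha => (alpha * z + w, alpha * w)
  | IIc alpha delta => (alpha * z, delta * w)
  end.

Definition in_punctured_disc (a : C) : Prop := (0 < Cmod a < 1)%R.

(** In class [IIc], the exponent [r = 0] excludes nothing, as |alpha| < 1. *)
Definition is_contraction (k : contraction) : Prop :=
  match k with
  | IV alpha => in_punctured_disc alpha
  | III r delta => (2 <= r)%nat /\ in_punctured_disc delta
  | IIa r delta => (2 <= r)%nat /\ in_punctured_disc delta
  | IIb alpha => in_punctured_disc alpha
  | IIc alpha delta =>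
      in_punctured_disc alpha /\ in_punctured_disc delta /\
      forall r : nat, alpha <> delta ^ r
  end.

Definition is_real (a : C) : Prop := Im a = 0%R.

(** The coefficients of the monomials occurring in [contraction_map]. *)
Definition coefficients (k : contraction) : list C :=
  match k with
  | IV alpha => [alpha; alpha]
  | III r delta => [delta ^ r; delta]
  | IIa r delta => [delta ^ r; RtoC 1; delta]
  | IIb alpha => [alpha; RtoC 1; alpha]
  | IIc alpha delta => [alpha; delta]
  end.

Definition real_coefficients (k : contraction) : Prop :=
  List.Forall is_real (coefficients k).

Definition in_IIc' (k : contraction) : Prop :=
  exists alpha, k = IIc alpha (Cconj alpha) /\
    in_punctured_disc alpha /\ ~ is_real alpha.

(** * The quotient of W by the cyclic group generated by f *)

(** For injective f with f(W) = W, these are the points q = f^n(p), n in Z. *)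
Definition orbit (f : C2 -> C2) (p q : C2) : Prop :=
  W q /\ exists n : nat, q = Nat.iter n f p \/ p = Nat.iter n f q.

Definition quotient (f : C2 -> C2) : Type :=
  { A : C2 -> Prop | exists p, W p /\ A = orbit f p }.

(** With pi : W -> W/<f> the projection, [over A p] says that pi(p) = A. *)
Definition over {f : C2 -> C2} (A : quotient f) (p : C2) : Prop :=
  proj1_sig A p.

(** Quotient topology: O is open when pi^-1(O) is open. *)
Definition quotient_open {f : C2 -> C2} (O : quotient f -> Prop) : Prop :=
  open (fun p : C2 => exists A, O A /\ over A p).

Definition quotient_continuous {f : C2 -> C2} (h : quotient f -> quotient f)
  : Prop :=
  forall O, quotient_open O -> quotient_open (fun A => O (h A)).

(** Open subsets of W on which pi is injective; the charts of W/<f> are the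
    inverses of the restrictions of pi to such subsets. *)
Definition slice (f : C2 -> C2) (U : C2 -> Prop) : Prop :=
  open U /\ (forall p, U p -> W p) /\
  forall p q, U p -> U q -> orbit f p q -> p = q.

(** F extends (pi|V)^-1 o h o pi|U, which is defined on the points p of U such
    that h(pi(p)) lies in pi(V). *)
Definition chart_expression {f : C2 -> C2} (h : quotient f -> quotient f)
  (U V : C2 -> Prop) (F : C2 -> C2) : Prop :=
  forall A p q, U p -> over A p -> V q -> over (h A) q -> F p = q.

(** h is continuous and its expressions in charts satisfy the local property P
    at every point of their domain. *)
Definition in_charts (P : (C2 -> C2) -> C2 -> Prop) {f : C2 -> C2}
  (h : quotient f -> quotient f) : Prop :=
  quotient_continuous h /\
  forall U V F, slice f U -> slice f V -> chart_expression h U V F ->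
    forall A p q, U p -> over A p -> V q -> over (h A) q -> P F p.

Definition holomorphic {f : C2 -> C2} (h : quotient f -> quotient f) : Prop :=
  in_charts holomorphic_at h.
Definition antiholomorphic {f : C2 -> C2} (h : quotient f -> quotient f)
  : Prop :=
  in_charts antiholomorphic_at h.

(** g is a biholomorphism with inverse g'. *)
Definition biholomorphic_pair {f : C2 -> C2} (g g' : quotient f -> quotient f)
  : Prop :=
  holomorphic g /\ holomorphic g' /\
  (forall A, g' (g A) = A) /\ (forall A, g (g' A) = A).

(** * Real structures *)

Definition real_structure {f : C2 -> C2} (s : quotient f -> quotient f)
  : Prop :=
  antiholomorphic s /\ forall A, s (s A) = A.

Definition is_lift {f : C2 -> C2} (s : quotient f -> quotient f)
  (F : C2 -> C2) : Prop :=
  forall A p, over A p -> over (s A) (F p).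

Definition even_structure {f : C2 -> C2} (s : quotient f -> quotient f) : Prop :=
  exists F, antiholomorphic_automorphism_W F /\ is_lift s F /\
    forall p, W p -> F (F p) = p.

Definition hopf_surface (k : contraction) : Type :=
  quotient (contraction_map k).

(** The map of the quotient induced by F, when F descends. *)
Definition induced {f : C2 -> C2} (F : C2 -> C2) (A : quotient f)
  : quotient f :=
  epsilon (inhabits A) (fun B => forall p, over A p -> over B (F p)).

Definition standard_lift (k : contraction) : C2 -> C2 :=
  if excluded_middle_informative (in_IIc' k) then conj_swap else conj2.

Definition standard_structure (k : contraction)
  : hopf_surface k -> hopf_surface k :=
  induced (standard_lift k).

Lemma induced_is_lift (f F : C2 -> C2) :
  (forall p, W p -> W (F p)) -> (forall p, F (f p) = f (F p)) ->
  is_lift (induced (f := f) F) F.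
Proof.
  intros HW Hc A.
  unfold induced.
  apply (epsilon_spec (inhabits A)
           (fun B : quotient f => forall p, over A p -> over B (F p))).
  destruct A as [A [a [Wa EA]]].
  exists (exist _ (orbit f (F a)) (ex_intro _ (F a) (conj (HW a Wa) eq_refl))).
  intros p; unfold over; simpl; rewrite EA; intros [Wp [n Hn]].
  assert (Hi : forall m q, F (Nat.iter m f q) = Nat.iter m f (F q)).
  { intros m q; induction m as [|m IH]; simpl; [reflexivity|].
    now rewrite Hc, IH. }
  split; [now apply HW|].
  exists n; rewrite <- !Hi; destruct Hn as [Hn|Hn]; [left|right]; now rewrite <- Hn.
Qed.

Lemma in_IIc'_not_real (k : contraction) :
  in_IIc' k -> ~ real_coefficients k.
Proof.
  intros [a [-> [_ Ha]]] H; inversion H; contradiction.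
Qed.

Lemma standard_structure_is_lift (k : contraction) :
  real_coefficients k \/ in_IIc' k ->
  is_lift (standard_structure k) (standard_lift k).
Proof.
  intros Hk.
  assert (C0 : forall a, Cconj a = 0 -> a = 0).
  { intros a Ha; rewrite <- (Cconj_conj a), Ha.
    unfold Cconj; apply injective_projections; simpl; ring. }
  assert (Cr : forall a, is_real a -> Cconj a = a).
  { intros [x y] Ha; unfold is_real in Ha; simpl in Ha; subst.
    unfold Cconj; apply injective_projections; simpl; ring. }
  unfold standard_structure, standard_lift.
  destruct (excluded_middle_informative (in_IIc' k)) as [H|H];
    apply induced_is_lift.
  - intros [z w] Hp E; apply Hp; injection E as E1 E2 E3 E4.
    apply injective_projections; simpl; apply C0;
      now apply injective_projections.
  - destruct H as [a [-> _]]; intros [z w]; unfold conj_swap; simpl.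
    now rewrite !Cmult_conj, Cconj_conj.
  - intros [z w] Hp E; apply Hp; injection E as E1 E2 E3 E4.
    apply injective_projections; simpl; apply C0;
      now apply injective_projections.
  - destruct Hk as [Hk|Hk]; [|contradiction].
    intros [z w]; unfold conj2, real_coefficients in *.
    destruct k; simpl in *;
      repeat match goal with
      | h : List.Forall _ (_ :: _) |- _ => inversion h; clear h; subst
      end;
      repeat match goal with
      | h : is_real _ |- _ => apply Cr in h
      end;
      rewrite ?Cplus_conj, ?Cmult_conj, ?Cpow_conj in *; congruence.
Qed.

(* Main.v *)
(** Let [F] be an antiholomorphic involution of [W] lifting [sigma].  The
    conjugate [F f F] equals [f^n] for a constant [n], whence [n^2 = 1]; the
    value [n = -1] would make [F] exchange the two ends of [W], which a
    Liouville argument excludes, so [F] commutes with [f].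

    Composing [F] with the standard conjugation gives a holomorphic
    automorphism of [W] commuting with [f].  Its components [psi] satisfy
    [psi o f = mu psi] (up to a correction in class [IIa]), so on a line
    [w = w0 <> 0], which avoids the origin, they are entire with at most
    linear growth, hence affine; the coefficients are functions of [w] scaled
    by [w |-> delta w], hence monomials.  No Hartogs extension is needed.

    It remains to solve [F = G o s o G^-1] with [G] commuting with [f], an
    explicit instance of Hilbert's theorem 90 for linear or triangular maps.

    The only analytic input is that the mean of a holomorphic function over a
    circle does not depend on its radius, which follows from Goursat's
    theorem in logarithmic polar coordinates. *)

Require Import Defs.
From Stdlib Require Import Reals Lra Lia List ClassicalEpsilon.
From Stdlib Require Import FunctionalExtensionality PropExtensionality ProofIrrelevance.
From Coquelicot Require Import Coquelicot.

(** * Goursat's theorem for real differential forms *)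

Local Open Scope R_scope.

(** All five classes are instances of one triangular map [tri a e d r] with explicit iterates, so a
    single analysis of semi-invariants serves them all; the classes differ only in the resonances
    that survive. The obstacle is to deduce linearity from growth with circle means alone, without
    power series. The device is a divided difference: if [k] is holomorphic off [0], small on small
    circles and o(r^2) on large ones, its second divided difference at two nodes is continuous off
    [0] and holomorphic off the nodes. At the nodes differentiability is not established, and so the
    invariance of circle means is proved with finitely many exceptional radii allowed. Growth is
    known only on sequences of circles, whose radii are powers of [|a|] or [|d|], since these are
    the circles that iteration carries to the unit circle; hence growth hypotheses ask for some
    radius, never for all. A semi-invariant of weight [mu] has at most linear growth in the first
    variable when [|a| <= |mu|]; where the eigenvalues come in the wrong order, the coordinates are
    exchanged. *)

Definition closed_form_at (P Q : R -> R -> R) (x y : R) : Prop :=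
  exists px m qy, differentiable_pt_lim P x y px m /\ differentiable_pt_lim Q x y m qy.

Definition closed_form_on (P Q : R -> R -> R) (x y h k : R) : Prop :=
  forall t s, x <= t <= x + h -> y <= s <= y + k -> closed_form_at P Q t s.

(** The counterclockwise boundary integral of [P dx + Q dy], with opposite edges paired under one
    integral sign. The form is only differentiable at each point, with equal mixed partials and no
    continuity of the derivatives; hence Goursat's bisection rather than Green's formula. *)
Definition circulation (P Q : R -> R -> R) (x y h k : R) : R :=
  RInt (fun t => P t y - P t (y + k)) x (x + h) +
  RInt (fun s => Q (x + h) s - Q x s) y (y + k).

Lemma differentiable_continuous_1 (P : R -> R -> R) (x y px py : R) :
  differentiable_pt_lim P x y px py -> continuous (fun t => P t y) x.
Proof.
  intros H.
  assert (D : is_derive (fun t => P t y) x (px * 1 + py * 0)).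
  { apply is_derive_Reals.
    apply (derivable_pt_lim_comp_2d P (fun t => t) (fun _ => y)); auto.
    apply derivable_pt_lim_id. apply derivable_pt_lim_const. }
  apply (ex_derive_continuous (fun t => P t y)). eexists; exact D.
Qed.

Lemma differentiable_continuous_2 (P : R -> R -> R) (x y px py : R) :
  differentiable_pt_lim P x y px py -> continuous (fun s => P x s) y.
Proof.
  intros H.
  assert (D : is_derive (fun s => P x s) y (px * 0 + py * 1)).
  { apply is_derive_Reals.
    apply (derivable_pt_lim_comp_2d P (fun _ => x) (fun t => t)); auto.
    apply derivable_pt_lim_const. apply derivable_pt_lim_id. }
  apply (ex_derive_continuous (fun t => P x t)). eexists; exact D.
Qed.

Lemma closed_form_RInt_1 (P Q : R -> R -> R) (x y h k s t1 t2 : R) :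
  closed_form_on P Q x y h k -> y <= s <= y + k ->
  x <= t1 -> t1 <= t2 -> t2 <= x + h -> ex_RInt (fun t => P t s) t1 t2.
Proof.
  intros H Hs H1 H2 H3. apply (ex_RInt_continuous (fun t => P t s)).
  intros t. rewrite Rmin_left, Rmax_right by lra. intros Ht.
  destruct (H t s) as (px & m & qy & D & _); try lra.
  eapply differentiable_continuous_1; eauto.
Qed.

Lemma closed_form_RInt_2 (P Q : R -> R -> R) (x y h k t s1 s2 : R) :
  closed_form_on P Q x y h k -> x <= t <= x + h ->
  y <= s1 -> s1 <= s2 -> s2 <= y + k -> ex_RInt (fun s => Q t s) s1 s2.
Proof.
  intros H Hs H1 H2 H3. apply (ex_RInt_continuous (fun s => Q t s)).
  intros s. rewrite Rmin_left, Rmax_right by lra. intros Ht.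
  destruct (H t s) as (px & m & qy & _ & D); try lra.
  eapply differentiable_continuous_2; eauto.
Qed.

Lemma closed_form_on_sub (P Q : R -> R -> R) (x y h k x' y' h' k' : R) :
  closed_form_on P Q x y h k ->
  x <= x' -> y <= y' -> x' + h' <= x + h -> y' + k' <= y + k ->
  closed_form_on P Q x' y' h' k'.
Proof. intros H ? ? ? ? t s ? ?. apply H; lra. Qed.

(** Each inner edge borders two quarters and is traversed in opposite directions, so only the outer
    boundary survives in the sum. *)
Lemma circulation_split (P Q : R -> R -> R) (x y h k : R) :
  0 < h -> 0 < k -> closed_form_on P Q x y h k ->
  let a := h / 2 in let b := k / 2 in
  circulation P Q x y h k =
    circulation P Q x y a b + circulation P Q (x + a) y a b +
    circulation P Q x (y + b) a b + circulation P Q (x + a) (y + b) a b.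
Proof.
  intros Hh Hk H a b. unfold circulation.
  assert (Ea : x + a + a = x + h) by (unfold a; lra).
  assert (Eb : y + b + b = y + k) by (unfold b; lra).
  rewrite Ea, Eb.
  assert (Ha : 0 < a) by (unfold a; lra). assert (Hb : 0 < b) by (unfold b; lra).
  assert (I1 : forall s t1 t2, y <= s <= y + k -> x <= t1 -> t1 <= t2 -> t2 <= x + h ->
            ex_RInt (fun t => P t s) t1 t2).
  { intros; eapply closed_form_RInt_1; eauto. }
  assert (I2 : forall t s1 s2, x <= t <= x + h -> y <= s1 -> s1 <= s2 -> s2 <= y + k ->
            ex_RInt (fun s => Q t s) s1 s2).
  { intros; eapply closed_form_RInt_2; eauto. }
  assert (M1 : forall s s' t1 t2, y <= s <= y + k -> y <= s' <= y + k ->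
            x <= t1 -> t1 <= t2 -> t2 <= x + h ->
            RInt (fun t => P t s - P t s') t1 t2 =
            RInt (fun t => P t s) t1 t2 - RInt (fun t => P t s') t1 t2).
  { intros. apply (RInt_minus (fun t => P t s) (fun t => P t s')); apply I1; lra. }
  assert (M2 : forall s s' t1 t2, x <= s <= x + h -> x <= s' <= x + h ->
            y <= t1 -> t1 <= t2 -> t2 <= y + k ->
            RInt (fun t => Q s t - Q s' t) t1 t2 =
            RInt (fun t => Q s t) t1 t2 - RInt (fun t => Q s' t) t1 t2).
  { intros. apply (RInt_minus (fun t => Q s t) (fun t => Q s' t)); apply I2; lra. }
  rewrite !M1, !M2 by lra.
  assert (C1 : forall s, y <= s <= y + k -> RInt (fun t => P t s) x (x + h) =
     RInt (fun t => P t s) x (x + a) + RInt (fun t => P t s) (x + a) (x + h)).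
  { intros; symmetry; apply (RInt_Chasles (fun t => P t s)); apply I1; lra. }
  assert (C2 : forall s, x <= s <= x + h -> RInt (fun t => Q s t) y (y + k) =
     RInt (fun t => Q s t) y (y + b) + RInt (fun t => Q s t) (y + b) (y + k)).
  { intros; symmetry; apply (RInt_Chasles (fun t => Q s t)); apply I2; lra. }
  rewrite !C1, !C2 by lra. lra.
Qed.

Lemma RInt_near_const (g : R -> R) (a l c M : R) :
  0 <= l -> ex_RInt g a (a + l) ->
  (forall t, a <= t <= a + l -> Rabs (g t - c) <= M) ->
  Rabs (RInt g a (a + l) - c * l) <= M * l.
Proof.
  intros Hl I H.
  assert (E : RInt (fun t => g t - c) a (a + l) = RInt g a (a + l) - c * l).
  { rewrite (RInt_minus g (fun _ => c)); auto.
    - rewrite RInt_const. unfold minus, plus, opp, scal; simpl. unfold mult; simpl. ring.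
    - apply ex_RInt_const. }
  rewrite <- E.
  replace (M * l) with ((a + l - a) * M) by ring.
  apply abs_RInt_le_const; auto. lra.
  apply (ex_RInt_minus g (fun _ => c)); auto. apply ex_RInt_const.
Qed.

(** In the affine approximation at [(X, Y)] everything cancels between opposite edges except the
    mixed partial, which contributes [- qx * k * h] from [P] and [qx * h * k] from [Q]: this is
    where closedness enters. The remainders are at most [eps * (h + k)] on each edge. *)
Lemma circulation_small (P Q : R -> R -> R) (X Y : R) :
  closed_form_at P Q X Y ->
  forall eps, 0 < eps -> exists d, 0 < d /\
    forall x y h k, 0 <= h < d -> 0 <= k < d ->
      x <= X <= x + h -> y <= Y <= y + k ->
      closed_form_on P Q x y h k ->
      Rabs (circulation P Q x y h k) <= 4 * eps * (h + k) * (h + k).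
Proof.
  intros (px & qx & qy & DP & DQ) eps Heps.
  destruct (DP (mkposreal eps Heps)) as [d1 H1].
  destruct (DQ (mkposreal eps Heps)) as [d2 H2]. simpl in *.
  exists (Rmin d1 d2). split; [apply Rmin_pos; apply cond_pos|].
  intros x y h k Hh Hk HX HY Hc.
  assert (L1 := Rmin_l d1 d2). assert (L2 := Rmin_r d1 d2).
  assert (B1 : forall t s, x <= t <= x + h -> y <= s <= y + k ->
     Rabs (P t s - P X Y - (px * (t - X) + qx * (s - Y))) <= eps * (h + k)).
  { intros t s Ht Hs. eapply Rle_trans; [apply H1; apply Rabs_def1; lra|].
    apply Rmult_le_compat_l; [lra|]. apply Rmax_lub; apply Rabs_le; lra. }
  assert (B2 : forall t s, x <= t <= x + h -> y <= s <= y + k ->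
     Rabs (Q t s - Q X Y - (qx * (t - X) + qy * (s - Y))) <= eps * (h + k)).
  { intros t s Ht Hs. eapply Rle_trans; [apply H2; apply Rabs_def1; lra|].
    apply Rmult_le_compat_l; [lra|]. apply Rmax_lub; apply Rabs_le; lra. }
  unfold circulation.
  assert (A1 : Rabs (RInt (fun t => P t y - P t (y + k)) x (x + h) - (- qx * k) * h)
            <= (2 * eps * (h + k)) * h).
  { apply RInt_near_const; [lra| |].
    - apply (ex_RInt_minus (fun t => P t y) (fun t => P t (y + k)));
        eapply closed_form_RInt_1; eauto; lra.
    - intros t Ht. assert (U := B1 t y Ht ltac:(lra)). assert (V := B1 t (y + k) Ht ltac:(lra)).
      apply Rabs_le_between in U, V. apply Rabs_le_between. nra. }
  assert (A2 : Rabs (RInt (fun s => Q (x + h) s - Q x s) y (y + k) - (qx * h) * k)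
            <= (2 * eps * (h + k)) * k).
  { apply RInt_near_const; [lra| |].
    - apply (ex_RInt_minus (fun s => Q (x + h) s) (fun s => Q x s));
        eapply closed_form_RInt_2; eauto; lra.
    - intros s Hs. assert (U := B2 (x + h) s ltac:(lra) Hs). assert (V := B2 x s ltac:(lra) Hs).
      apply Rabs_le_between in U, V. apply Rabs_le_between. nra. }
  apply Rabs_le_between in A1, A2. apply Rabs_le_between.
  assert (0 <= eps * (h + k) * (h + k)) by (repeat apply Rmult_le_pos; lra).
  nra.
Qed.

(* Goursat's bisection: some quarter of a rectangle carries at least a quarter
   of its circulation, and the nested quarters shrink to a point at which
   [circulation_small] applies. *)
Lemma circulation_quarter (P Q : R -> R -> R) (eta x y h k : R) :
  0 < h -> 0 < k -> closed_form_on P Q x y h k ->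
  eta <= Rabs (circulation P Q x y h k) ->
  exists x' y', (x' = x \/ x' = x + h / 2) /\ (y' = y \/ y' = y + k / 2) /\
    eta / 4 <= Rabs (circulation P Q x' y' (h / 2) (k / 2)).
Proof.
  intros Hh Hk H He. rewrite circulation_split in He; auto.
  set (a := circulation P Q x y (h / 2) (k / 2)) in *.
  set (b := circulation P Q (x + h / 2) y (h / 2) (k / 2)) in *.
  set (c := circulation P Q x (y + k / 2) (h / 2) (k / 2)) in *.
  set (d := circulation P Q (x + h / 2) (y + k / 2) (h / 2) (k / 2)) in *.
  assert (T : Rabs (a + b + c + d) <= Rabs a + Rabs b + Rabs c + Rabs d).
  { eapply Rle_trans; [apply Rabs_triang|]. apply Rplus_le_compat_r.
    eapply Rle_trans; [apply Rabs_triang|]. apply Rplus_le_compat_r. apply Rabs_triang. }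
  destruct (Rle_dec (eta / 4) (Rabs a)); [exists x, y; auto|].
  destruct (Rle_dec (eta / 4) (Rabs b)); [exists (x + h / 2), y; auto|].
  destruct (Rle_dec (eta / 4) (Rabs c)); [exists x; exists (y + k / 2); auto|].
  exists (x + h / 2); exists (y + k / 2). repeat split; auto. unfold d in *; lra.
Qed.

(** The supremum of the left ends works, because every right end bounds every left end ([B]). *)
Lemma nested_intervals (u : nat -> R) (h : R) :
  0 < h -> (forall n, u n <= u (S n)) ->
  (forall n, u (S n) + h / 2 ^ S n <= u n + h / 2 ^ n) ->
  exists X, forall n, u n <= X <= u n + h / 2 ^ n.
Proof.
  intros Hh H1 H2.
  assert (P2 : forall n, 0 < h / 2 ^ n).
  { intros n. apply Rdiv_lt_0_compat; auto. apply pow_lt; lra. }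
  assert (I : forall n m, u n <= u (n + m)%nat /\
              u (n + m)%nat + h / 2 ^ (n + m) <= u n + h / 2 ^ n).
  { intros n m. induction m as [|m IH].
    - rewrite Nat.add_0_r; lra.
    - rewrite Nat.add_succ_r. specialize (H1 (n + m)%nat). specialize (H2 (n + m)%nat). lra. }
  assert (B : forall n m, u n <= u m + h / 2 ^ m).
  { intros n m. destruct (Nat.le_ge_cases n m) as [L|L].
    - replace m with (n + (m - n))%nat by lia. destruct (I n (m - n)%nat).
      specialize (P2 (n + (m - n))%nat). lra.
    - replace n with (m + (n - m))%nat by lia. destruct (I m (n - m)%nat).
      specialize (P2 (m + (n - m))%nat). lra. }
  destruct (completeness (fun z => exists n, z = u n)) as [X [UX LX]].
  - exists (u 0%nat + h / 2 ^ 0). intros z [n ->]. apply B.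
  - exists (u 0%nat); eauto.
  - exists X. intros n. split; [apply UX; eauto|].
    apply LX. intros z [m ->]. apply B.
Qed.

Lemma goursat (P Q : R -> R -> R) (x y h k : R) :
  0 < h -> 0 < k -> closed_form_on P Q x y h k ->
  circulation P Q x y h k = 0.
Proof.
  intros Hh Hk H.
  destruct (Req_dec (circulation P Q x y h k) 0) as [E|E]; auto. exfalso.
  set (eta := Rabs (circulation P Q x y h k)).
  assert (Heta : 0 < eta) by now apply Rabs_pos_lt.
  pose (good := fun (n : nat) (p : R * R) =>
     x <= fst p /\ y <= snd p /\ fst p + h / 2 ^ n <= x + h /\ snd p + k / 2 ^ n <= y + k /\
     eta / 4 ^ n <= Rabs (circulation P Q (fst p) (snd p) (h / 2 ^ n) (k / 2 ^ n))).
  pose (next := fun (n : nat) (p q : R * R) =>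
     (fst q = fst p \/ fst q = fst p + h / 2 ^ S n) /\
     (snd q = snd p \/ snd q = snd p + k / 2 ^ S n)).
  assert (P2 : forall n, 0 < 2 ^ n) by (intros; apply pow_lt; lra).
  assert (P4 : forall n, 0 < 4 ^ n) by (intros; apply pow_lt; lra).
  assert (Half : forall z n, z / 2 ^ n / 2 = z / 2 ^ S n).
  { intros z n. simpl. specialize (P2 n). field. lra. }
  (* Posed as an implication so that a successor exists for every [p], good or not; choice then
     yields a total function [nx]. *)
  assert (Step : forall n p, exists q, good n p -> good (S n) q /\ next n p q).
  { intros n p. destruct (excluded_middle_informative (good n p)) as [G|G].
    2: { exists p; tauto. }
    destruct G as (G1 & G2 & G3 & G4 & G5).
    assert (0 < h / 2 ^ n) by (apply Rdiv_lt_0_compat; auto).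
    assert (0 < k / 2 ^ n) by (apply Rdiv_lt_0_compat; auto).
    destruct (circulation_quarter P Q (eta / 4 ^ n) (fst p) (snd p) (h / 2 ^ n) (k / 2 ^ n))
      as (x' & y' & Ex & Ey & L); auto.
    { eapply closed_form_on_sub; eauto. }
    rewrite !Half in *. exists (x', y'). intros _. unfold good, next; simpl fst; simpl snd.
    assert (E2 : h / 2 ^ n = 2 * (h / 2 ^ S n)) by (rewrite <- Half; lra).
    assert (E3 : k / 2 ^ n = 2 * (k / 2 ^ S n)) by (rewrite <- Half; lra).
    repeat split; auto; try (destruct Ex, Ey; lra).
    replace (eta / 4 ^ S n) with (eta / 4 ^ n / 4); auto. simpl. field. specialize (P4 n); lra. }
  set (nx := fun n p => proj1_sig (constructive_indefinite_description _ (Step n p))).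
  pose (u := fix u n := match n with O => (x, y) | S m => nx m (u m) end).
  assert (G : forall n, good n (u n)).
  { induction n as [|n IH].
    - unfold good; simpl. rewrite !Rdiv_1_r. repeat split; try lra. unfold eta; lra.
    - simpl. unfold nx. destruct (constructive_indefinite_description _ _) as [q Hq]; simpl.
      now apply Hq. }
  assert (N : forall n, next n (u n) (u (S n))).
  { intros n. simpl. unfold nx. destruct (constructive_indefinite_description _ _) as [q Hq]; simpl.
    now apply Hq. }
  assert (S2 : forall z n, 0 < z -> z / 2 ^ n = 2 * (z / 2 ^ S n) /\ 0 < z / 2 ^ S n).
  { intros z n Hz. split; [rewrite <- Half; lra|]. apply Rdiv_lt_0_compat; auto. }
  destruct (nested_intervals (fun n => fst (u n)) h) as [X HX]; auto.
  { intros n. destruct (N n) as [[A|A] _]; destruct (S2 h n Hh); lra. }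
  { intros n. destruct (N n) as [[A|A] _]; destruct (S2 h n Hh); lra. }
  destruct (nested_intervals (fun n => snd (u n)) k) as [Y HY]; auto.
  { intros n. destruct (N n) as [_ [A|A]]; destruct (S2 k n Hk); lra. }
  { intros n. destruct (N n) as [_ [A|A]]; destruct (S2 k n Hk); lra. }
  assert (C0 : closed_form_at P Q X Y).
  { specialize (HX 0%nat). specialize (HY 0%nat). simpl in *. apply H; lra. }
  (* Makes the bound of [circulation_small] on the n-th rectangle equal to [eta / 4 ^ n / 2], half
     of the lower bound kept by the bisection. *)
  set (eps := eta / (8 * (h + k) * (h + k))).
  assert (Q0 : 0 < (h + k) * (h + k)) by (apply Rmult_lt_0_compat; lra).
  assert (Heps : 0 < eps) by (apply Rdiv_lt_0_compat; lra).
  destruct (circulation_small P Q X Y C0 eps Heps) as (d & Hd & Hs).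
  assert (exists n, (h + k) / 2 ^ n < d) as [n Hn].
  { destruct (pow_lt_1_zero (1/2) ltac:(rewrite Rabs_pos_eq; lra) (d / (h + k)))
      as [n Hn]; [apply Rdiv_lt_0_compat; lra|].
    exists n. specialize (Hn n (Nat.le_refl n)). rewrite Rabs_pos_eq in Hn.
    2: apply pow_le; lra.
    replace ((1/2)^n) with (/ 2 ^ n) in Hn.
    2: { rewrite <- pow_inv. f_equal. lra. }
    apply (Rmult_lt_compat_r (h + k)) in Hn; [|lra].
    replace (d / (h + k) * (h + k)) with d in Hn by (field; lra).
    unfold Rdiv; lra. }
  destruct (G n) as (G1 & G2 & G3 & G4 & G5).
  assert (HA : 0 < h / 2 ^ n) by (apply Rdiv_lt_0_compat; auto).
  assert (HB : 0 < k / 2 ^ n) by (apply Rdiv_lt_0_compat; auto).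
  assert (HAB : (h + k) / 2 ^ n = h / 2 ^ n + k / 2 ^ n) by (field; specialize (P2 n); lra).
  assert (L := Hs (fst (u n)) (snd (u n)) (h / 2 ^ n) (k / 2 ^ n)
      ltac:(lra) ltac:(lra) (HX n) (HY n)
      ltac:(eapply closed_form_on_sub; eauto)).
  rewrite <- HAB in L.
  assert (F : 4 * eps * ((h + k) / 2 ^ n) * ((h + k) / 2 ^ n) = (eta / 4 ^ n) / 2).
  { unfold eps. replace (4 ^ n) with (2 ^ n * 2 ^ n). field. specialize (P2 n); lra.
    rewrite <- Rpow_mult_distr. f_equal; lra. }
  rewrite F in L. assert (0 < eta / 4 ^ n) by (apply Rdiv_lt_0_compat; auto). lra.
Qed.

(** * Complex differentiability *)

Local Open Scope C_scope.

(** Same notion of differentiability as in [holomorphic_at], so that the restriction of a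
    holomorphic map to a complex line falls under it by the chain rule. *)
Definition cdiff (g : C -> C) (z : C) : Prop :=
  ex_filterdiff (K := C_AbsRing) (U := C_NormedModule) (V := C_NormedModule) g (locally z).

Lemma locally_Cmod (z : C) (P : C -> Prop) :
  locally (T := C_UniformSpace) z P <->
  exists d, (0 < d)%R /\ forall w, (Cmod (w - z) < d)%R -> P w.
Proof.
  split.
  - intros [d H]. exists d. split; [apply cond_pos|].
    intros w Hw. apply H. apply C_NormedModule_mixin_compat1. exact Hw.
  - intros (d & Hd & H).
    (* The uniform balls and the modulus balls differ by a factor [sqrt 2], which halving the radius
       absorbs. *)
    assert (H2 : (0 < d / 2)%R) by lra.
    exists (mkposreal _ H2). intros w Hw. apply H.
    apply (C_NormedModule_mixin_compat2 z w (mkposreal _ H2)) in Hw. simpl in Hw.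
    eapply Rlt_le_trans; [exact Hw|].
    assert (sqrt 2 <= 2)%R. { replace 2%R with (sqrt (2 * 2)) at 2 by (rewrite sqrt_square; lra). apply sqrt_le_1; lra. }
    nra.
Qed.

(** A [C]-linear map [L] of [C] is multiplication by [L 1], which turns the filter definition into
    an epsilon-delta one with a complex number as derivative. *)
Lemma cdiff_iff (g : C -> C) (z : C) :
  cdiff g z <-> exists l, forall eps, (0 < eps)%R -> exists d, (0 < d)%R /\
    forall w, (Cmod (w - z) < d)%R ->
      (Cmod (g w - g z - l * (w - z)) <= eps * Cmod (w - z))%R.
Proof.
  split.
  - intros [L [HL H]]. exists (L (RtoC 1)). intros eps He.
    specialize (H z (fun P HP => HP) (mkposreal eps He)).
    apply (locally_Cmod z) in H. destruct H as (d & Hd & H).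
    exists d; split; auto. intros w Hw. specialize (H w Hw). simpl in H.
    change (Cmod (minus (minus (g w) (g z)) (L (minus w z))) <= eps * Cmod (w - z))%R in H.
    assert (E : L (minus w z) = L (RtoC 1) * (w - z)).
    { replace (minus w z) with (scal (w - z) (RtoC 1)).
      rewrite (linear_scal L HL). unfold scal; simpl. unfold mult; simpl. ring.
      unfold scal, minus, plus, opp; simpl. unfold mult; simpl. ring. }
    rewrite E in H. exact H.
  - intros [l H]. exists (fun w => w * l). split.
    + split.
      * intros x y. unfold plus; simpl. ring.
      * intros k x. unfold scal; simpl. unfold mult; simpl. ring.
      * exists (Cmod l + 1)%R. assert (0 <= Cmod l)%R by apply Cmod_ge_0. split; [lra|].
        intros x. change (Cmod (x * l) <= (Cmod l + 1) * Cmod x)%R. rewrite Cmod_mult.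
        assert (0 <= Cmod x)%R by apply Cmod_ge_0. nra.
    + intros x Hx. assert (x = z).
      { symmetry. apply (is_filter_lim_locally_unique (V := C_NormedModule)). exact Hx. }
      subst x. intros eps. destruct (H eps (cond_pos eps)) as (d & Hd & Hw).
      apply (locally_Cmod z). exists d; split; auto. intros w Hw'.
      specialize (Hw w Hw').
      change (Cmod (minus (minus (g w) (g z)) (Cmult (minus w z) l)) <= eps * Cmod (w - z))%R.
      replace (minus (minus (g w) (g z)) (Cmult (minus w z) l)) with (g w - g z - l * (w - z)).
      exact Hw. unfold minus, plus, opp; simpl. ring.
Qed.

Definition ccont (g : C -> C) (z : C) : Prop :=
  forall eps, (0 < eps)%R -> exists d, (0 < d)%R /\
    forall w, (Cmod (w - z) < d)%R -> (Cmod (g w - g z) < eps)%R.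

Lemma cdiff_ccont (g : C -> C) (z : C) : cdiff g z -> ccont g z.
Proof.
  intros H. apply (cdiff_iff g z) in H. destruct H as [l H].
  intros eps He. destruct (H 1%R Rlt_0_1) as (d & Hd & Hw).
  assert (0 <= Cmod l)%R by apply Cmod_ge_0.
  exists (Rmin d (eps / (2 * (Cmod l + 1)))). split.
  { apply Rmin_pos; auto. apply Rdiv_lt_0_compat; lra. }
  intros w Hw'. specialize (Hw w (Rlt_le_trans _ _ _ Hw' (Rmin_l _ _))).
  assert (Cmod (w - z) < eps / (2 * (Cmod l + 1)))%R by (eapply Rlt_le_trans; [exact Hw'|apply Rmin_r]).
  assert (Cmod (w - z) * (2 * (Cmod l + 1)) < eps)%R.
  { apply (Rmult_lt_compat_r (2 * (Cmod l + 1))) in H1; [|lra].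
    replace (eps / (2 * (Cmod l + 1)) * (2 * (Cmod l + 1)))%R with eps in H1 by (field; lra). lra. }
  replace (g w - g z) with ((g w - g z - l * (w - z)) + l * (w - z)) by ring.
  eapply Rle_lt_trans; [apply Cmod_triangle|]. rewrite Cmod_mult.
  assert (0 <= Cmod (w - z))%R by apply Cmod_ge_0. nra.
Qed.

Lemma cdiff_ext (f g : C -> C) (z : C) :
  (exists d, (0 < d)%R /\ forall w, (Cmod (w - z) < d)%R -> f w = g w) ->
  cdiff f z -> cdiff g z.
Proof.
  intros H. apply (ex_filterdiff_ext_locally (K := C_AbsRing) (U:= C_NormedModule) (V := C_NormedModule)). now apply locally_Cmod.
Qed.

Lemma cdiff_const (a z : C) : cdiff (fun _ => a) z.
Proof. apply (ex_filterdiff_const (K := C_AbsRing) (U:= C_NormedModule) (V := C_NormedModule)). Qed.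

Lemma cdiff_id (z : C) : cdiff (fun w => w) z.
Proof. apply (ex_filterdiff_id (K := C_AbsRing) (V := C_NormedModule)). Qed.

Lemma cdiff_plus (f g : C -> C) (z : C) :
  cdiff f z -> cdiff g z -> cdiff (fun w => f w + g w) z.
Proof. apply (ex_filterdiff_plus_fct (K := C_AbsRing) (U:= C_NormedModule) (V := C_NormedModule)). Qed.

Lemma cdiff_minus (f g : C -> C) (z : C) :
  cdiff f z -> cdiff g z -> cdiff (fun w => f w - g w) z.
Proof. apply (ex_filterdiff_minus_fct (K := C_AbsRing) (U:= C_NormedModule) (V := C_NormedModule)). Qed.

Lemma cdiff_mult (f g : C -> C) (z : C) :
  cdiff f z -> cdiff g z -> cdiff (fun w => f w * g w) z.
Proof.
  intros Hf Hg. assert (Cf := cdiff_ccont f z Hf).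
  apply (cdiff_iff f z) in Hf. apply (cdiff_iff g z) in Hg.
  destruct Hf as [lf Hf]. destruct Hg as [lg Hg].
  apply (cdiff_iff (fun w => f w * g w) z). exists (lf * g z + f z * lg). intros eps He.
  assert (P1 : (0 <= Cmod (f z))%R) by apply Cmod_ge_0.
  assert (P2 : (0 <= Cmod (g z))%R) by apply Cmod_ge_0.
  assert (P3 : (0 <= Cmod lg)%R) by apply Cmod_ge_0.
  set (K := (Cmod (f z) + Cmod (g z) + Cmod lg + 1)%R).
  assert (HK : (0 < K)%R) by (unfold K; lra).
  set (e := Rmin 1 (eps / K)).
  assert (e0 : (0 < e)%R). { apply Rmin_pos; [lra|]. now apply Rdiv_lt_0_compat. }
  destruct (Hf e e0) as (d1 & Hd1 & H1). destruct (Hg e e0) as (d2 & Hd2 & H2).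
  destruct (Cf e e0) as (d3 & Hd3 & H3).
  exists (Rmin d1 (Rmin d2 d3)). split; [repeat apply Rmin_pos; auto|]. intros w Hw.
  specialize (H1 w (Rlt_le_trans _ _ _ Hw (Rmin_l _ _))).
  assert (Hw2 := Rlt_le_trans _ _ _ Hw (Rmin_r _ _)).
  specialize (H2 w (Rlt_le_trans _ _ _ Hw2 (Rmin_l _ _))).
  specialize (H3 w (Rlt_le_trans _ _ _ Hw2 (Rmin_r _ _))).
  replace (f w * g w - f z * g z - (lf * g z + f z * lg) * (w - z)) with
    ((f w - f z - lf * (w - z)) * g z +
     ((f z + (f w - f z)) * (g w - g z - lg * (w - z)) + (f w - f z) * (lg * (w - z)))) by ring.
  eapply Rle_trans; [apply Cmod_triangle|].
  eapply Rle_trans; [apply Rplus_le_compat_l; apply Cmod_triangle|].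
  rewrite !Cmod_mult.
  assert (T := Cmod_triangle (f z) (f w - f z)).
  set (t := Cmod (w - z)) in *. assert (0 <= t)%R by apply Cmod_ge_0.
  assert (0 <= Cmod (f w - f z))%R by apply Cmod_ge_0.
  assert (0 <= Cmod (f z + (f w - f z)))%R by apply Cmod_ge_0.
  assert (0 <= Cmod (g w - g z - lg * (w - z)))%R by apply Cmod_ge_0.
  assert (0 <= Cmod (f w - f z - lf * (w - z)))%R by apply Cmod_ge_0.
  assert (E1 : (e <= 1)%R) by apply Rmin_l.
  assert (E2 : (e * K <= eps)%R). { apply Rle_div_r; [lra|]. apply Rmin_r. }
  assert (U1 : (Cmod (f w - f z - lf * (w - z)) * Cmod (g z) <= e * t * Cmod (g z))%R) by nra.
  assert (U2 : (Cmod (f z + (f w - f z)) * Cmod (g w - g z - lg * (w - z)) <= (Cmod (f z) + 1) * (e * t))%R).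
  { apply Rmult_le_compat; lra. }
  assert (U3 : (Cmod (f w - f z) * (Cmod lg * t) <= e * (Cmod lg * t))%R).
  { apply Rmult_le_compat_r; [nra|lra]. }
  assert (e * K * t <= eps * t)%R by nra. unfold K in *. nra.
Qed.

Lemma cdiff_comp (f g : C -> C) (z : C) :
  cdiff f z -> cdiff g (f z) -> cdiff (fun w => g (f w)) z.
Proof. apply (ex_filterdiff_comp' (K := C_AbsRing) (U:= C_NormedModule) (V := C_NormedModule) (W := C_NormedModule)). Qed.

Lemma Cmod_minus_rev (a b : C) : Cmod (a - b) = Cmod (b - a).
Proof. rewrite <- Cmod_opp. f_equal. ring. Qed.

Lemma Cmod_triangle_minus (a b : C) : (Cmod a - Cmod b <= Cmod (a - b))%R.
Proof.
  assert (H := Cmod_triangle (a - b) b). replace (a - b + b) with a in H by ring. lra.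
Qed.

Lemma cdiff_inv (z : C) : z <> 0 -> cdiff Cinv z.
Proof.
  intros Hz. assert (P : (0 < Cmod z)%R) by now apply Cmod_gt_0.
  apply (cdiff_iff Cinv z). exists (- / (z * z)). intros eps He.
  exists (Rmin (Cmod z / 2) (eps * Cmod z * Cmod z * Cmod z / 2)). split.
  { apply Rmin_pos; [lra|]. assert (0 < eps * Cmod z * Cmod z * Cmod z)%R by (repeat apply Rmult_lt_0_compat; lra). lra. }
  intros w Hw.
  assert (H1 := Rlt_le_trans _ _ _ Hw (Rmin_l _ _)).
  assert (H2 := Rlt_le_trans _ _ _ Hw (Rmin_r _ _)).
  assert (H3 : (Cmod z / 2 < Cmod w)%R).
  { assert (T := Cmod_triangle_minus z w). rewrite Cmod_minus_rev in T. lra. }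
  assert (Hw0 : w <> 0) by (apply Cmod_gt_0; lra).
  replace (/ w - / z - - / (z * z) * (w - z)) with ((w - z) * (w - z) / (w * z * z)) by (field; auto).
  assert (w * z * z <> 0) by (repeat apply Cmult_neq_0; auto).
  rewrite Cmod_div, !Cmod_mult by auto.
  set (t := Cmod (w - z)) in *. assert (0 <= t)%R by apply Cmod_ge_0.
  apply Rle_div_l. { repeat apply Rmult_lt_0_compat; lra. }
  replace (eps * t * (Cmod w * Cmod z * Cmod z))%R with (t * (eps * Cmod z * Cmod z * Cmod w))%R by ring.
  apply Rmult_le_compat_l; auto.
  assert (0 < eps * Cmod z * Cmod z)%R by (repeat apply Rmult_lt_0_compat; lra). nra.
Qed.

Lemma cdiff_div (f g : C -> C) (z : C) :
  cdiff f z -> cdiff g z -> g z <> 0 -> cdiff (fun w => f w / g w) z.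
Proof.
  intros Hf Hg H0. apply cdiff_mult; auto. apply (cdiff_comp g Cinv); auto. now apply cdiff_inv.
Qed.

Lemma cdiff_pow (n : nat) (z : C) : cdiff (fun w => w ^ n) z.
Proof.
  induction n as [|n IH].
  - apply (cdiff_ext (fun _ => 1)); [|apply cdiff_const].
    exists 1%R; split; [lra|]; intros; simpl; auto.
  - apply (cdiff_ext (fun w => w * w ^ n)); [|apply cdiff_mult; auto; apply cdiff_id].
    exists 1%R; split; [lra|]; intros; now rewrite Cpow_S.
Qed.

Lemma ccont_plus (f g : C -> C) (z : C) :
  ccont f z -> ccont g z -> ccont (fun w => f w + g w) z.
Proof.
  intros Hf Hg eps He.
  destruct (Hf (eps / 2)%R ltac:(lra)) as (d & Hd & H).
  destruct (Hg (eps / 2)%R ltac:(lra)) as (e & He' & H').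
  exists (Rmin d e). split; [now apply Rmin_pos|]. intros w Hw.
  specialize (H w (Rlt_le_trans _ _ _ Hw (Rmin_l _ _))).
  specialize (H' w (Rlt_le_trans _ _ _ Hw (Rmin_r _ _))).
  replace (f w + g w - (f z + g z)) with ((f w - f z) + (g w - g z)) by ring.
  eapply Rle_lt_trans; [apply Cmod_triangle|]. lra.
Qed.

Lemma ccont_mult (f g : C -> C) (z : C) :
  ccont f z -> ccont g z -> ccont (fun w => f w * g w) z.
Proof.
  intros Hf Hg eps He.
  assert (Pf : (0 <= Cmod (f z))%R) by apply Cmod_ge_0.
  assert (Pg : (0 <= Cmod (g z))%R) by apply Cmod_ge_0.
  set (K := (Cmod (f z) + Cmod (g z) + 1)%R).
  set (e := (Rmin 1 (eps / (2 * K)))%R).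
  assert (HK : (0 < K)%R) by (unfold K; lra).
  assert (e0 : (0 < e)%R). { apply Rmin_pos; [lra|]. apply Rdiv_lt_0_compat; lra. }
  destruct (Hf e e0) as (d1 & Hd1 & H1). destruct (Hg e e0) as (d2 & Hd2 & H2).
  exists (Rmin d1 d2). split; [now apply Rmin_pos|]. intros w Hw.
  specialize (H1 w (Rlt_le_trans _ _ _ Hw (Rmin_l _ _))).
  specialize (H2 w (Rlt_le_trans _ _ _ Hw (Rmin_r _ _))).
  replace (f w * g w - f z * g z) with
    ((f w - f z) * (g w - g z) + ((f w - f z) * g z + f z * (g w - g z))) by ring.
  eapply Rle_lt_trans; [apply Cmod_triangle|].
  eapply Rle_lt_trans; [apply Rplus_le_compat_l; apply Cmod_triangle|].
  rewrite !Cmod_mult.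
  assert (E1 : (e <= 1)%R) by apply Rmin_l.
  assert (E2 : (e * (2 * K) <= eps)%R).
  { apply Rle_div_r; [lra|]. apply Rmin_r. }
  assert (0 <= Cmod (f w - f z))%R by apply Cmod_ge_0.
  assert (0 <= Cmod (g w - g z))%R by apply Cmod_ge_0.
  unfold K in *. nra.
Qed.

Lemma ccont_ext (f g : C -> C) (z : C) :
  (exists d, (0 < d)%R /\ forall w, (Cmod (w - z) < d)%R -> f w = g w) ->
  ccont f z -> ccont g z.
Proof.
  intros (d & Hd & E) H eps He. destruct (H eps He) as (d' & Hd' & H').
  exists (Rmin d d'). split; [now apply Rmin_pos|]. intros w Hw.
  rewrite <- !E. apply H'. eapply Rlt_le_trans; [exact Hw|apply Rmin_r].
  replace (z - z) with (RtoC 0) by ring. rewrite Cmod_0; lra.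
  eapply Rlt_le_trans; [exact Hw|apply Rmin_l].
Qed.

(** * Circle means *)

Local Open Scope R_scope.

Lemma Cmod_le_2Rmax (z : C) : Cmod z <= 2 * Rmax (Rabs (fst z)) (Rabs (snd z)).
Proof.
  eapply Rle_trans; [apply Cmod_2Rmax|]. apply Rmult_le_compat_r.
  - eapply Rle_trans; [apply Rabs_pos|apply Rmax_l].
  - replace 2 with (sqrt (2 * 2)) at 2 by (rewrite sqrt_square; lra). apply sqrt_le_1; lra.
Qed.

Lemma im_le_Cmod (c : C) : Rabs (Im c) <= Cmod c.
Proof. eapply Rle_trans; [apply Rmax_r|apply Rmax_Cmod]. Qed.

Lemma cauchy_riemann (g : C -> C) (x y : R) :
  cdiff g (x, y) -> exists p q,
    differentiable_pt_lim (fun u v => Re (g (u, v))) x y p (- q) /\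
    differentiable_pt_lim (fun u v => Im (g (u, v))) x y q p.
Proof.
  intros H. apply (cdiff_iff g (x, y)) in H. destruct H as [[p q] H].
  exists p, q.
  assert (K : forall eps : posreal, locally_2d (fun u v =>
     Cmod (g (u, v) - g (x, y) - (p, q) * ((u, v) - (x, y)))%C <=
     eps * Rmax (Rabs (u - x)) (Rabs (v - y))) x y).
  { intros eps. destruct (H (eps / 2)) as (d & Hd & Hw).
    { generalize (cond_pos eps); lra. }
    assert (Hd2 : 0 < d / 2) by lra. exists (mkposreal _ Hd2). intros u v Hu Hv. simpl in *.
    assert (B := Cmod_le_2Rmax ((u, v) - (x, y))%C). simpl in B.
    fold (Rminus u x) in B. fold (Rminus v y) in B.
    eapply Rle_trans; [apply Hw|].
    - eapply Rle_lt_trans; [exact B|].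
      assert (Rmax (Rabs (u - x)) (Rabs (v - y)) < d / 2) by now apply Rmax_lub_lt. lra.
    - generalize (cond_pos eps); intros. nra. }
  split; intros eps; destruct (K eps) as [d Hd]; exists d; intros u v Hu Hv;
    (eapply Rle_trans; [|apply Hd; eauto]).
  - eapply Rle_trans; [|apply re_le_Cmod]. right. f_equal.
    destruct (g (u, v)), (g (x, y)); simpl. ring.
  - eapply Rle_trans; [|apply im_le_Cmod]. right. f_equal.
    destruct (g (u, v)), (g (x, y)); simpl. ring.
Qed.

Lemma differentiable_pt_lim_Rmult (x y : R) : differentiable_pt_lim Rmult x y y x.
Proof.
  intros eps. exists eps. intros u v Hu Hv.
  replace (u * v - x * y - (y * (u - x) + x * (v - y))) with ((u - x) * (v - y)) by ring.
  rewrite Rabs_mult. apply Rmult_le_compat; try apply Rabs_pos. lra. apply Rmax_r.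
Qed.

Lemma differentiable_pt_lim_proj2 (f : R -> R) (x y l : R) :
  derivable_pt_lim f y l -> differentiable_pt_lim (fun _ v => f v) x y 0 l.
Proof.
  intros H eps. destruct (differentiable_pt_lim_proj1_0 f y x l H eps) as [d Hd].
  exists d. intros u v Hu Hv. rewrite Rmax_comm.
  replace (0 * (u - x) + l * (v - y)) with (l * (v - y) + 0 * (u - x)) by ring. now apply Hd.
Qed.

Definition polar (u t : R) : C := (exp u * cos t, exp u * sin t).

Lemma Cmod_polar (u t : R) : Cmod (polar u t) = exp u.
Proof.
  unfold Cmod, polar; simpl.
  replace (_ + _) with (exp u * exp u).
  - apply sqrt_square. left; apply exp_pos.
  - generalize (sin2_cos2 t). unfold Rsqr. intros H.
    transitivity (exp u * exp u * (sin t * sin t + cos t * cos t)); [rewrite H|]; ring.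
Qed.

Lemma polar_neq_0 (u t : R) : polar u t <> 0%C.
Proof. apply Cmod_gt_0. rewrite Cmod_polar. apply exp_pos. Qed.

Lemma polar_differentiable (u t : R) :
  differentiable_pt_lim (fun u t => exp u * cos t) u t (exp u * cos t) (- (exp u * sin t)) /\
  differentiable_pt_lim (fun u t => exp u * sin t) u t (exp u * sin t) (exp u * cos t).
Proof.
  split.
  - replace (exp u * cos t) with (cos t * exp u + exp u * 0) by ring.
    replace (- (exp u * sin t)) with (cos t * 0 + exp u * - sin t) by ring.
    apply (differentiable_pt_lim_comp Rmult (fun u _ => exp u) (fun _ t => cos t)).
    + apply differentiable_pt_lim_Rmult.
    + apply differentiable_pt_lim_proj1_0. apply derivable_pt_lim_exp.
    + apply differentiable_pt_lim_proj2. apply derivable_pt_lim_cos.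
  - replace (exp u * sin t) with (sin t * exp u + exp u * 0) by ring.
    replace (exp u * cos t) with (sin t * 0 + exp u * cos t) by ring.
    apply (differentiable_pt_lim_comp Rmult (fun u _ => exp u) (fun _ t => sin t)).
    + apply differentiable_pt_lim_Rmult.
    + apply differentiable_pt_lim_proj1_0. apply derivable_pt_lim_exp.
    + apply differentiable_pt_lim_proj2. apply derivable_pt_lim_sin.
Qed.

(* In logarithmic polar coordinates [z = exp (u + i t)], the real part of
   [g z dz / (i z)] is the closed form [Im g du + Re g dt]. *)
Lemma polar_closed_form (g : C -> C) (u t : R) :
  cdiff g (polar u t) ->
  closed_form_at (fun u t => Im (g (polar u t))) (fun u t => Re (g (polar u t))) u t.
Proof.
  intros H. destruct (cauchy_riemann _ _ _ H) as (p & q & D1 & D2).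
  destruct (polar_differentiable u t) as [E1 E2].
  assert (F1 := differentiable_pt_lim_comp _ _ _ _ _ _ _ _ _ _ _ D1 E1 E2).
  assert (F2 := differentiable_pt_lim_comp _ _ _ _ _ _ _ _ _ _ _ D2 E1 E2).
  simpl in F1, F2. do 3 eexists. split; [exact F2|].
  match goal with |- differentiable_pt_lim _ _ _ ?m _ =>
    match type of F1 with differentiable_pt_lim _ _ _ ?m' _ => replace m with m' by ring end end.
  exact F1.
Qed.

(** The parameter [u] is the logarithm of the radius. Only the real part is integrated; the
    imaginary part is reached by applying the results to [- Ci * g]. *)
Definition circle_integral (g : C -> C) (u : R) : R :=
  RInt (fun t => Re (g (polar u t))) 0 (2 * PI).

Lemma polar_continuity_2d (u t : R) (z : C) eps :
  0 < eps -> z = polar u t ->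
  locally_2d (fun u' t' => Cmod (polar u' t' - z)%C < eps) u t.
Proof.
  intros He ->. destruct (polar_differentiable u t) as [D1 D2].
  assert (C1 := differentiable_continuity_pt _ _ _ (ex_intro _ _ (ex_intro _ _ D1))).
  assert (C2 := differentiable_continuity_pt _ _ _ (ex_intro _ _ (ex_intro _ _ D2))).
  assert (H4 : 0 < eps / 4) by lra.
  destruct (C1 (mkposreal _ H4)) as [d1 H1]. destruct (C2 (mkposreal _ H4)) as [d2 H2].
  assert (Hd : 0 < Rmin d1 d2) by (apply Rmin_pos; apply cond_pos).
  exists (mkposreal _ Hd). simpl. intros u' t' Hu Ht.
  eapply Rle_lt_trans; [apply Cmod_le_2Rmax|]. simpl.
  specialize (H1 u' t' (Rlt_le_trans _ _ _ Hu (Rmin_l _ _)) (Rlt_le_trans _ _ _ Ht (Rmin_l _ _))).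
  specialize (H2 u' t' (Rlt_le_trans _ _ _ Hu (Rmin_r _ _)) (Rlt_le_trans _ _ _ Ht (Rmin_r _ _))).
  simpl in H1, H2. unfold Rminus in H1, H2.
  assert (X := Rmax_lub_lt _ _ _ H1 H2). lra.
Qed.

Lemma Re_polar_continuity_2d (g : C -> C) (u t : R) :
  ccont g (polar u t) -> continuity_2d_pt (fun u t => Re (g (polar u t))) u t.
Proof.
  intros H eps. destruct (H eps (cond_pos eps)) as (d & Hd & Hw).
  destruct (polar_continuity_2d u t _ d Hd eq_refl) as [e He].
  exists e. intros u' t' Hu Ht. specialize (Hw _ (He _ _ Hu Ht)).
  eapply Rle_lt_trans; [|exact Hw]. eapply Rle_trans; [|apply re_le_Cmod].
  right; reflexivity.
Qed.

Lemma ex_RInt_circle (g : C -> C) (u : R) :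
  (forall z : C, z <> 0%C -> ccont g z) -> ex_RInt (fun t => Re (g (polar u t))) 0 (2 * PI).
Proof.
  intros H. apply (ex_RInt_continuous (fun t => Re (g (polar u t)))). intros t _.
  assert (C := Re_polar_continuity_2d g u t (H _ (polar_neq_0 u t))).
  apply (continuity_pt_filterlim (fun t => Re (g (polar u t)))).
  intros eps He. destruct (C (mkposreal eps He)) as [d Hd].
  exists d. split; [apply cond_pos|]. intros t' [_ Ht]. apply Hd; auto.
  replace (u - u) with 0 by ring. rewrite Rabs_R0. apply cond_pos.
Qed.

Lemma two_PI_pos : 0 < 2 * PI.
Proof. generalize PI_RGT_0; lra. Qed.

(** The annulus is the image of the rectangle [[a, b] x [0, 2 PI]]. The edges [t = 0] and [t = 2 PI]
    have the same image and cancel; the other two are the circle integrals. *)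
Lemma circle_integral_annulus (g : C -> C) (a b : R) :
  (forall z : C, z <> 0%C -> ccont g z) -> a < b ->
  (forall u t, a <= u <= b -> cdiff g (polar u t)) ->
  circle_integral g a = circle_integral g b.
Proof.
  intros Hc Hab H.
  assert (K := goursat (fun u t => Im (g (polar u t))) (fun u t => Re (g (polar u t)))
    a 0 (b - a) (2 * PI) ltac:(lra) two_PI_pos).
  unfold circulation in K.
  replace (a + (b - a)) with b in K by ring. replace (0 + 2 * PI) with (2 * PI) in K by ring.
  assert (Z : RInt (fun t => Im (g (polar t 0)) - Im (g (polar t (2 * PI)))) a b = 0).
  { rewrite (RInt_ext _ (fun _ => 0)).
    - rewrite RInt_const. unfold scal; simpl; unfold mult; simpl. ring.
    - intros x _. unfold polar. rewrite cos_2PI, sin_2PI, cos_0, sin_0. lra. }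
  rewrite Z in K.
  rewrite (RInt_minus (fun s => Re (g (polar b s))) (fun s => Re (g (polar a s)))) in K;
    try now apply ex_RInt_circle.
  unfold minus, plus, opp in K; simpl in K. unfold circle_integral.
  assert (K' := K ltac:(intros u t Hu Ht; apply polar_closed_form; apply H; lra)). lra.
Qed.

(** Serves to pass to the limit at exceptional radii, where [g] is merely known to be continuous. *)
Lemma circle_integral_continuous (g : C -> C) (u eps : R) :
  (forall z : C, z <> 0%C -> ccont g z) -> 0 < eps ->
  exists d, 0 < d /\ forall v, Rabs (v - u) < d ->
    Rabs (circle_integral g v - circle_integral g u) < eps.
Proof.
  intros Hc He. assert (P := two_PI_pos).
  assert (He2 : 0 < eps / (2 * (2 * PI))) by (apply Rdiv_lt_0_compat; lra).
  destruct (uniform_continuity_2d_1d' (fun v t => Re (g (polar v t))) 0 (2 * PI) u) with (eps := mkposreal _ He2) as [d Hd].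
  { intros t _. apply Re_polar_continuity_2d. apply Hc, polar_neq_0. }
  exists d. split; [apply cond_pos|]. intros v Hv. unfold circle_integral.
  assert (E := RInt_minus (fun t => Re (g (polar v t))) (fun t => Re (g (polar u t))) 0 (2 * PI)
     (ex_RInt_circle g v Hc) (ex_RInt_circle g u Hc)).
  unfold minus, plus, opp in E; simpl in E.
  unfold Rminus at 1. rewrite <- E.
  apply Rle_lt_trans with ((2 * PI - 0) * (eps / (2 * (2 * PI)))).
  - apply abs_RInt_le_const; [lra| |].
    + apply (ex_RInt_minus (fun t => Re (g (polar v t))) (fun t => Re (g (polar u t))));
        now apply ex_RInt_circle.
    + intros t Ht. left. apply Rabs_def2 in Hv.
      apply (Hd t u t v); try lra. replace (t - t) with 0 by ring. rewrite Rabs_R0; apply cond_pos.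
  - replace ((2 * PI - 0) * (eps / (2 * (2 * PI)))) with (eps / 2) by (field; lra). lra.
Qed.

(** [L] lists the logarithmic radii of the circles on which differentiability may fail. Induction on
    [L] cuts the interval at these radii; on each open piece the integral is constant, and
    continuity carries the equality to the ends. *)
Lemma circle_integral_constant (g : C -> C) (L : list R) :
  (forall z : C, z <> 0%C -> ccont g z) ->
  forall a b, a < b ->
  (forall u t, a < u < b -> ~ In u L -> cdiff g (polar u t)) ->
  circle_integral g a = circle_integral g b.
Proof.
  intros Hc. induction L as [|s L IH]; intros a b Hab H.
  - destruct (Req_dec (circle_integral g a) (circle_integral g b)) as [E|E]; auto. exfalso.
    assert (P := Rabs_pos_lt _ (Rminus_eq_contra _ _ E)).
    set (e := Rabs (circle_integral g a - circle_integral g b)) in *.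
    destruct (circle_integral_continuous g a (e / 2) Hc ltac:(lra)) as (d1 & Hd1 & H1).
    destruct (circle_integral_continuous g b (e / 2) Hc ltac:(lra)) as (d2 & Hd2 & H2).
    (* A third, so that [a + d < b - d] while both points stay within the continuity radii of [a]
       and [b]. *)
    set (d := Rmin (Rmin d1 d2) (b - a) / 3).
    assert (0 < Rmin (Rmin d1 d2) (b - a)) by (repeat apply Rmin_pos; lra).
    assert (X1 := Rmin_l (Rmin d1 d2) (b - a)). assert (X2 := Rmin_r (Rmin d1 d2) (b - a)).
    assert (X3 := Rmin_l d1 d2). assert (X4 := Rmin_r d1 d2).
    assert (E' : circle_integral g (a + d) = circle_integral g (b - d)).
    { apply circle_integral_annulus; auto. unfold d; lra.
      intros u t Hu. apply H; [unfold d in Hu; lra|auto]. }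
    specialize (H1 (a + d) ltac:(apply Rabs_def1; unfold d; lra)).
    specialize (H2 (b - d) ltac:(apply Rabs_def1; unfold d; lra)).
    rewrite E' in H1. unfold e in *. clear - H1 H2.
    apply Rabs_def2 in H1, H2. revert H1 H2.
    unfold Rabs at 1 2 3 4; destruct (Rcase_abs _); lra.
  - destruct (Rlt_dec a s) as [A|A]; [destruct (Rlt_dec s b) as [B|B]|].
    + transitivity (circle_integral g s); apply IH; auto; intros u t Hu Hn; apply H; try lra;
        (intros [W|W]; [lra|now apply Hn]).
    + apply IH; auto. intros u t Hu Hn. apply H; auto. intros [W|W]; [lra|now apply Hn].
    + apply IH; auto. intros u t Hu Hn. apply H; auto. intros [W|W]; [lra|now apply Hn].
Qed.

Lemma circle_integral_near (g : C -> C) (u eps : R) (l : C) :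
  (forall z : C, z <> 0%C -> ccont g z) ->
  (forall z, Cmod z = exp u -> Cmod (g z - l)%C <= eps) ->
  Rabs (circle_integral g u - 2 * PI * Re l) <= 2 * PI * eps.
Proof.
  intros Hc H. assert (P := two_PI_pos).
  assert (K := RInt_near_const (fun t => Re (g (polar u t))) 0 (2 * PI) (Re l) eps).
  replace (0 + 2 * PI) with (2 * PI) in K by ring. unfold circle_integral.
  rewrite (Rmult_comm (2 * PI) (Re l)), (Rmult_comm (2 * PI) eps). apply K; [lra|now apply ex_RInt_circle|].
  intros t _. eapply Rle_trans; [|apply (H (polar u t)); apply Cmod_polar].
  eapply Rle_trans; [|apply re_le_Cmod]. right; reflexivity.
Qed.

(* The circle mean of [g] does not depend on the radius, so its limits at
   [0] and at infinity agree. *)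
Lemma small_circle_limit_zero (g : C -> C) (L : list C) (l : C) :
  (forall z : C, z <> 0%C -> ccont g z) ->
  (forall z : C, z <> 0%C -> ~ In z L -> cdiff g z) ->
  (forall eps, 0 < eps -> exists r, 0 < r /\ forall z, Cmod z = r -> Cmod (g z - l)%C <= eps) ->
  (forall eps, 0 < eps -> exists r, 0 < r /\ forall z, Cmod z = r -> Cmod (g z) <= eps) ->
  l = 0%C.
Proof.
  assert (Real : forall (g : C -> C) (l : C), (forall z : C, z <> 0%C -> ccont g z) ->
  (forall z : C, z <> 0%C -> ~ In z L -> cdiff g z) ->
  (forall eps, 0 < eps -> exists r, 0 < r /\ forall z, Cmod z = r -> Cmod (g z - l)%C <= eps) ->
  (forall eps, 0 < eps -> exists r, 0 < r /\ forall z, Cmod z = r -> Cmod (g z) <= eps) ->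
   Re l = 0).
  { clear g l. intros g l Hc Hd H0 H1. assert (P := two_PI_pos).
    destruct (Req_dec (Re l) 0) as [E|E]; auto. exfalso.
    assert (Q := Rabs_pos_lt _ E).
    destruct (H0 (Rabs (Re l) / 4)) as (r & Hr & A); [lra|].
    destruct (H1 (Rabs (Re l) / 4)) as (r' & Hr' & B); [lra|].
    assert (I0 := circle_integral_near g (ln r) (Rabs (Re l) / 4) l Hc
       ltac:(intros z; rewrite exp_ln; auto)).
    assert (I1 := circle_integral_near g (ln r') (Rabs (Re l) / 4) 0%C Hc
       ltac:(intros z; rewrite exp_ln by auto; intros Hz; replace (g z - 0)%C with (g z) by ring; auto)).
    (* A single bad point makes its whole circle exceptional. *)
    assert (J : forall a b, a < b -> circle_integral g a = circle_integral g b).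
    { intros a b Hab. apply (circle_integral_constant g (map (fun c => ln (Cmod c)) L)); auto.
      intros u t _ Hn. apply Hd; [apply polar_neq_0|]. intros Hi. apply Hn.
      apply in_map_iff. exists (polar u t). split; auto. rewrite Cmod_polar. apply ln_exp. }
    assert (E2 : circle_integral g (ln r) = circle_integral g (ln r')).
    { destruct (Rtotal_order (ln r) (ln r')) as [W|[W|W]]; [now apply J|now rewrite W|symmetry; now apply J]. }
    rewrite E2 in I0. simpl (Re 0%C) in I1.
    set (c := circle_integral g (ln r')) in *.
    apply Rabs_le_between in I0, I1.
    revert I0 I1 Q. unfold Rabs. destruct (Rcase_abs (Re l)); intros; nra. }
  intros Hc Hd H0 H1. apply injective_projections; simpl.
  - change (Re l = 0). now apply (Real g l).
  - change (Im l = 0).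
    assert (M : forall w, Cmod (- Ci * w)%C = Cmod w).
    { intros w. rewrite Cmod_mult, Cmod_opp, Cmod_Ci. ring. }
    replace (Im l) with (Re (- Ci * l)%C) by (destruct l; simpl; ring).
    apply (Real (fun z => - Ci * g z)%C).
    + intros z Hz. apply ccont_mult; auto. apply cdiff_ccont, cdiff_const.
    + intros z Hz Hn. apply cdiff_mult; auto. apply cdiff_const.
    + intros eps He. destruct (H0 eps He) as (r & Hr & A). exists r. split; auto.
      intros z Hz. replace (- Ci * g z - - Ci * l)%C with (- Ci * (g z - l))%C by ring.
      rewrite M; auto.
    + intros eps He. destruct (H1 eps He) as (r & Hr & A). exists r. split; auto.
      intros z Hz. rewrite M; auto.
Qed.

(** * Functions scaled by a contraction of the plane *)

(** The quotient is completed at [c] by the derivative of [g], which gives continuity there. No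
    removability of the singularity is claimed: circle means tolerate finitely many points of mere
    continuity. *)
Lemma divided_difference (g : C -> C) (c : C) :
  c <> 0%C -> (forall z : C, z <> 0%C -> ccont g z) -> cdiff g c ->
  exists q : C -> C, (forall z : C, z <> 0%C -> ccont q z) /\
    (forall z, z <> c -> cdiff g z -> cdiff q z) /\
    (forall z, z <> c -> q z = ((g z - g c) / (z - c))%C).
Proof.
  intros Hc0 Hc Hd. apply (cdiff_iff g c) in Hd. destruct Hd as [l Hl].
  set (q := fun z => if excluded_middle_informative (z = c) then l else ((g z - g c) / (z - c))%C).
  assert (E : forall z, z <> c -> q z = ((g z - g c) / (z - c))%C).
  { intros z Hz. unfold q. destruct (excluded_middle_informative _); tauto. }
  assert (N : forall z, z <> c -> exists d, 0 < d /\
     forall w, Cmod (w - z) < d -> ((g w - g c) / (w - c))%C = q w).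
  { intros z Hz. exists (Cmod (z - c)). split.
    - apply Cmod_gt_0. intros Q. apply Hz. replace z with (z - c + c)%C by ring. rewrite Q; ring.
    - intros w Hw. symmetry. apply E. intros ->. rewrite Cmod_minus_rev in Hw. lra. }
  assert (Nz : forall z, z <> c -> (z - c)%C <> 0%C).
  { intros z Hz Q. apply Hz. replace z with (z - c + c)%C by ring. rewrite Q; ring. }
  exists q. split; [|split; auto].
  - intros z Hz. destruct (excluded_middle_informative (z = c)) as [->|W].
    + intros eps He. destruct (Hl (eps / 2)) as (d & Hd & H); [lra|].
      exists d. split; auto. intros w Hw.
      destruct (excluded_middle_informative (w = c)) as [->|V].
      { replace (q c - q c)%C with (RtoC 0) by ring. rewrite Cmod_0; lra. }
      specialize (H w Hw). rewrite E by auto.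
      unfold q. destruct (excluded_middle_informative (c = c)); [|tauto].
      replace ((g w - g c) / (w - c) - l)%C with ((g w - g c - l * (w - c)) / (w - c))%C by (field; auto).
      rewrite Cmod_div by auto.
      assert (0 < Cmod (w - c)) by (apply Cmod_gt_0; auto).
      apply Rlt_div_l; auto. nra.
    + apply (ccont_ext _ _ _ (N z W)). apply ccont_mult.
      * apply ccont_plus; auto. apply cdiff_ccont, cdiff_const.
      * apply cdiff_ccont. apply (cdiff_comp (fun w => w - c)%C Cinv).
        apply cdiff_minus; [apply cdiff_id|apply cdiff_const]. apply cdiff_inv; auto.
  - intros z W Hg. apply (cdiff_ext _ _ _ (N z W)). apply cdiff_div; auto.
    + apply cdiff_minus; auto. apply cdiff_const.
    + apply cdiff_minus; [apply cdiff_id|apply cdiff_const].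
Qed.

(* The second divided difference of [k] at [c1, c2] tends to [0] along large
   circles, so its limit at [0] vanishes too, which says
   [k c1 / c1 = k c2 / c2]. *)
Lemma linear_of_growth (k : C -> C) :
  (forall z : C, z <> 0%C -> cdiff k z) ->
  (forall eps, 0 < eps -> exists r, 0 < r < eps /\ forall z, Cmod z = r -> Cmod (k z) <= eps) ->
  (forall eps, 0 < eps -> exists r, 1 < eps * r /\ forall z, Cmod z = r -> Cmod (k z) <= eps * (r * r)) ->
  exists a, forall z : C, z <> 0%C -> k z = (a * z)%C.
Proof.
  intros Hd H0 H1.
  assert (Main : forall c1 c2 : C, c1 <> 0%C -> c2 <> 0%C -> c1 <> c2 -> (k c1 * c2 = c1 * k c2)%C).
  { intros c1 c2 Hc1 Hc2 H12.
    destruct (divided_difference k c1) as (q & Q1 & Q2 & Q3); auto.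
    { intros; apply cdiff_ccont; auto. }
    destruct (divided_difference q c2) as (p & P1 & P2 & P3); auto.
    (* [B] is the slope of the chord, and [N0] is the limit of the numerator
       [k z - k c1 - B * (z - c1)] of [p] along small circles, where [k] tends to [0]. *)
    set (B := ((k c2 - k c1) / (c2 - c1))%C).
    set (N0 := (B * c1 - k c1)%C).
    assert (Nz : forall a b : C, a <> b -> (a - b)%C <> 0%C).
    { intros a b Hz Q. apply Hz. replace a with (a - b + b)%C by ring. rewrite Q; ring. }
    assert (E : forall z, z <> c1 -> z <> c2 ->
       p z = ((k z - k c1 - B * (z - c1)) / ((z - c1) * (z - c2)))%C).
    { intros z Z1 Z2. rewrite P3, !Q3 by auto. unfold B. field. auto. }
    assert (M1 : 0 < Cmod c1) by now apply Cmod_gt_0.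
    assert (M2 : 0 < Cmod c2) by now apply Cmod_gt_0.
    assert (MB : 0 <= Cmod B) by apply Cmod_ge_0.
    assert (MN : 0 <= Cmod N0) by apply Cmod_ge_0.
    assert (MK : 0 <= Cmod (k c1)) by apply Cmod_ge_0.
    assert (Z : (N0 / (c1 * c2))%C = 0%C).
    { apply (small_circle_limit_zero p (c1 :: c2 :: nil)); auto.
      - intros z Hz Hn. simpl in Hn. apply P2; [intros ->; tauto|]. apply Q2; [intros ->; tauto|auto].
      - intros eps He.
        set (D0 := Cmod c1 * Cmod c2).
        assert (HD0 : 0 < D0) by (apply Rmult_lt_0_compat; auto).
        set (M := (1 + Cmod B) * D0 + Cmod N0 * (1 + Cmod c1 + Cmod c2)).
        assert (HM : 0 < M) by (unfold M; nra).
        (* The second bound beats the numerator, which is at most [e * M]; the last two keep [z] at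
           distance at least [|c1| / 2] and [|c2| / 2] from the nodes. *)
        set (e := Rmin (Rmin 1 (eps * (D0 * D0) / (4 * M))) (Rmin (Cmod c1 / 2) (Cmod c2 / 2))).
        assert (e0 : 0 < e).
        { repeat apply Rmin_pos; try lra. apply Rdiv_lt_0_compat; [|lra]. repeat apply Rmult_lt_0_compat; auto. }
        assert (e1 : e <= 1) by (unfold e; eapply Rle_trans; [apply Rmin_l|apply Rmin_l]).
        assert (e2 : e <= eps * (D0 * D0) / (4 * M)) by (unfold e; eapply Rle_trans; [apply Rmin_l|apply Rmin_r]).
        assert (e3 : e <= Cmod c1 / 2) by (unfold e; eapply Rle_trans; [apply Rmin_r|apply Rmin_l]).
        assert (e4 : e <= Cmod c2 / 2) by (unfold e; eapply Rle_trans; [apply Rmin_r|apply Rmin_r]).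
        destruct (H0 e e0) as (r & Hr & A). exists r; split; [lra|]. intros z Hz. specialize (A z Hz).
        assert (T1 := Cmod_triangle_minus c1 z). assert (T2 := Cmod_triangle_minus c2 z).
        rewrite Cmod_minus_rev in T1, T2.
        assert (Z1 : z <> c1) by (intros ->; lra). assert (Z2 : z <> c2) by (intros ->; lra).
        rewrite E by auto.
        replace ((k z - k c1 - B * (z - c1)) / ((z - c1) * (z - c2)) - N0 / (c1 * c2))%C with
          (((k z - B * z) * (c1 * c2) - N0 * (z * (z - c1 - c2))) / ((z - c1) * (z - c2) * (c1 * c2)))%C
          by (unfold N0; field; repeat split; auto).
        rewrite Cmod_div by (repeat apply Cmult_neq_0; auto).
        assert (U : Cmod ((k z - B * z) * (c1 * c2) - N0 * (z * (z - c1 - c2)))%C <= e * M).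
        { eapply Rle_trans; [apply Cmod_triangle|]. rewrite Cmod_opp, !Cmod_mult.
          assert (V1 : Cmod (k z - B * z) <= e * (1 + Cmod B)).
          { eapply Rle_trans; [apply Cmod_triangle|]. rewrite Cmod_opp, Cmod_mult. nra. }
          assert (V2 : Cmod (z - c1 - c2) <= 1 + Cmod c1 + Cmod c2).
          { eapply Rle_trans; [apply Cmod_triangle|]. rewrite Cmod_opp. apply Rplus_le_compat_r.
            eapply Rle_trans; [apply Cmod_triangle|]. rewrite Cmod_opp. lra. }
          assert (V3 : Cmod z * Cmod (z - c1 - c2) <= e * (1 + Cmod c1 + Cmod c2)).
          { apply Rmult_le_compat; try apply Cmod_ge_0; lra. }
          fold D0. unfold M.
          assert (Cmod (k z - B * z) * D0 <= e * (1 + Cmod B) * D0) by (apply Rmult_le_compat_r; lra).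
          assert (Cmod N0 * (Cmod z * Cmod (z - c1 - c2)) <= Cmod N0 * (e * (1 + Cmod c1 + Cmod c2)))
            by (apply Rmult_le_compat_l; lra). lra. }
        rewrite !Cmod_mult. fold D0.
        assert (V : D0 / 4 <= Cmod (z - c1) * Cmod (z - c2)).
        { replace (D0 / 4) with ((Cmod c1 / 2) * (Cmod c2 / 2)) by (unfold D0; field).
          apply Rmult_le_compat; lra. }
        assert (V0 : D0 / 4 * D0 <= Cmod (z - c1) * Cmod (z - c2) * D0) by (apply Rmult_le_compat_r; lra).
        apply Rle_div_l; [nra|].
        apply Rle_trans with (e * M); auto.
        apply Rle_trans with (eps * (D0 / 4 * D0)).
        + apply Rle_div_r in e2; [|lra]. nra.
        + apply Rmult_le_compat_l; lra.
      - intros eps He.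
        set (M := 1 + Cmod (k c1) + Cmod B * Cmod c1 + Cmod B).
        assert (HM : 1 <= M) by (unfold M; nra).
        set (e := Rmin (Rmin 1 (eps / (4 * M))) (Rmin (/ (2 * Cmod c1)) (/ (2 * Cmod c2)))).
        assert (e0 : 0 < e).
        { repeat apply Rmin_pos; try lra; try (apply Rinv_0_lt_compat; lra). apply Rdiv_lt_0_compat; lra. }
        assert (e1 : e <= 1) by (unfold e; eapply Rle_trans; [apply Rmin_l|apply Rmin_l]).
        assert (e2 : e <= eps / (4 * M)) by (unfold e; eapply Rle_trans; [apply Rmin_l|apply Rmin_r]).
        assert (e3 : e <= / (2 * Cmod c1)) by (unfold e; eapply Rle_trans; [apply Rmin_r|apply Rmin_l]).
        assert (e4 : e <= / (2 * Cmod c2)) by (unfold e; eapply Rle_trans; [apply Rmin_r|apply Rmin_r]).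
        destruct (H1 e e0) as (r & Hr & A).
        assert (r1 : 1 < r) by nra.
        assert (B1 : 2 * Cmod c1 < r).
        { apply (Rmult_le_compat_r (2 * Cmod c1)) in e3; [|lra]. rewrite Rinv_l in e3 by lra. nra. }
        assert (B2 : 2 * Cmod c2 < r).
        { apply (Rmult_le_compat_r (2 * Cmod c2)) in e4; [|lra]. rewrite Rinv_l in e4 by lra. nra. }
        exists r. split; [lra|]. intros z Hz. specialize (A z Hz).
        assert (T1 := Cmod_triangle_minus z c1). assert (T2 := Cmod_triangle_minus z c2).
        assert (Z1 : z <> c1) by (intros ->; lra). assert (Z2 : z <> c2) by (intros ->; lra).
        rewrite E by auto. rewrite Cmod_div by (apply Cmult_neq_0; auto). rewrite Cmod_mult.
        assert (U : Cmod (k z - k c1 - B * (z - c1))%C <= e * (r * r) * M).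
        { eapply Rle_trans; [apply Cmod_triangle|]. rewrite Cmod_opp, Cmod_mult.
          assert (V1 : Cmod (k z - k c1) <= e * (r * r) + Cmod (k c1)).
          { eapply Rle_trans; [apply Cmod_triangle|]. rewrite Cmod_opp. lra. }
          assert (V2 : Cmod (z - c1) <= r + Cmod c1).
          { eapply Rle_trans; [apply Cmod_triangle|]. rewrite Cmod_opp. lra. }
          assert (V3 : Cmod B * Cmod (z - c1) <= Cmod B * (r + Cmod c1)) by (apply Rmult_le_compat_l; lra).
          assert (W : r <= e * (r * r)) by nra.
          assert (W1 : 1 <= e * (r * r)) by lra.
          assert (Cmod (k c1) <= Cmod (k c1) * (e * (r * r))) by nra.
          assert (Cmod B * r <= Cmod B * (e * (r * r))) by nra.
          assert (0 <= Cmod B * Cmod c1) by nra.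
          assert (Cmod B * Cmod c1 <= Cmod B * Cmod c1 * (e * (r * r))) by nra.
          unfold M. lra. }
        assert (V : r * r / 4 <= Cmod (z - c1) * Cmod (z - c2)).
        { replace (r * r / 4) with ((r / 2) * (r / 2)) by field.
          apply Rmult_le_compat; lra. }
        apply Rle_div_l; [nra|].
        eapply Rle_trans; [exact U|]. apply Rle_trans with (eps * (r * r / 4)).
        + apply Rle_div_r in e2; [|lra]. nra.
        + apply Rmult_le_compat_l; lra. }
    assert (N0z : N0 = 0%C).
    { replace N0 with (N0 / (c1 * c2) * (c1 * c2))%C by (field; auto). rewrite Z; ring. }
    assert (Q : (N0 * (c2 - c1) = c1 * k c2 - k c1 * c2)%C).
    { unfold N0, B. field. auto. }
    rewrite N0z in Q.
    replace (k c1 * c2)%C with (c1 * k c2 - (c1 * k c2 - k c1 * c2))%C by ring. rewrite <- Q. ring. }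
  exists (k 1%C). intros z Hz.
  destruct (excluded_middle_informative (z = 1%C)) as [->|W]; [ring|].
  assert (H := Main z 1%C Hz ltac:(apply Cmod_gt_0; rewrite Cmod_1; lra) W).
  rewrite Cmult_1_r in H. rewrite H. ring.
Qed.

Lemma polar_surjective (u : C) : Cmod u = 1 -> exists t, - PI <= t <= PI /\ u = polar 0 t.
Proof.
  intros H. destruct u as [x y].
  assert (S : x * x + y * y = 1).
  { unfold Cmod in H; simpl in H. rewrite <- (sqrt_sqrt (x * x + y * y)) by nra.
    replace (x * x + y * y) with (x * (x * 1) + y * (y * 1)) by ring. rewrite H; ring. }
  assert (X : -1 <= x <= 1) by nra.
  assert (B := acos_bound x).
  assert (SQ : sqrt (1 - Rsqr x) = Rabs y).
  { replace (1 - Rsqr x) with (Rsqr y) by (unfold Rsqr; lra). apply sqrt_Rsqr_abs. }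
  unfold polar. rewrite exp_0.
  destruct (Rle_dec 0 y) as [Y|Y].
  - exists (acos x). split; [lra|]. rewrite cos_acos, sin_acos by lra.
    rewrite SQ, Rabs_pos_eq by lra. f_equal; ring.
  - exists (- acos x). split; [lra|]. rewrite cos_neg, sin_neg, cos_acos, sin_acos by lra.
    rewrite SQ, Rabs_left by lra. f_equal; ring.
Qed.

Definition c2cont (psi : C2 -> C) (p : C2) : Prop :=
  forall eps, 0 < eps -> exists d, 0 < d /\ forall q : C2,
    Cmod (fst q - fst p) < d -> Cmod (snd q - snd p) < d -> Cmod (psi q - psi p) < eps.

(** Compactness of the unit circle of the axis [w = 0]. The bound has to hold on a full
    neighbourhood of it, because iterates of the contraction bring points close to this axis without
    putting them on it. *)
Lemma circle_tube (psi : C2 -> C) :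
  (forall u, Cmod u = 1 -> c2cont psi (u, RtoC 0)) ->
  exists d M, 0 < d /\ forall u p, Cmod u = 1 -> Cmod (fst p - u) < d -> Cmod (snd p) < d ->
    Cmod (psi p) <= M.
Proof.
  intros H.
  (* One number [d] is both the size of the neighbourhood and, through [/ d], the bound, so that a
     single gauge on [[- PI, PI]] controls the two. *)
  assert (Loc : forall t, exists d : posreal, forall t' p, Rabs (t' - t) < d ->
     Cmod (fst p - polar 0 t') < d -> Cmod (snd p) < d -> Cmod (psi p) <= / d).
  { intros t. assert (U : Cmod (polar 0 t) = 1) by (rewrite Cmod_polar; apply exp_0).
    destruct (H _ U 1 Rlt_0_1) as (d & Hd & B).
    destruct (polar_continuity_2d 0 t _ (d / 2) ltac:(lra) eq_refl) as [e He].
    set (M := Cmod (psi (polar 0 t, RtoC 0)) + 1).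
    assert (HM : 0 < M) by (unfold M; generalize (Cmod_ge_0 (psi (polar 0 t, RtoC 0))); lra).
    set (r := Rmin (Rmin e (d / 2)) (/ M)).
    assert (Hr : 0 < r).
    { repeat apply Rmin_pos; try lra. apply cond_pos. now apply Rinv_0_lt_compat. }
    assert (r1 : r <= e) by (unfold r; eapply Rle_trans; [apply Rmin_l|apply Rmin_l]).
    assert (r2 : r <= d / 2) by (unfold r; eapply Rle_trans; [apply Rmin_l|apply Rmin_r]).
    assert (r3 : r <= / M) by apply Rmin_r.
    exists (mkposreal r Hr). simpl. intros t' p Ht H1 H2.
    assert (P := He 0 t' ltac:(rewrite Rminus_diag, Rabs_R0; apply cond_pos) ltac:(lra)).
    simpl in B. specialize (B p).
    assert (K : Cmod (psi p - psi (polar 0 t, RtoC 0)) < 1).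
    { apply B.
      - replace (fst p - polar 0 t)%C with ((fst p - polar 0 t') + (polar 0 t' - polar 0 t))%C by ring.
        eapply Rle_lt_trans; [apply Cmod_triangle|]. lra.
      - replace (snd p - 0)%C with (snd p) by ring. lra. }
    assert (T := Cmod_triangle_minus (psi p) (psi (polar 0 t, RtoC 0))).
    apply Rle_trans with M; [unfold M; lra|].
    rewrite <- (Rinv_inv M). apply Rinv_le_contravar; auto. }
  set (delta := fun t => proj1_sig (constructive_indefinite_description _ (Loc t))).
  destruct (compactness_value_1d (- PI) PI delta) as [d Hd].
  exists d, (/ d). split; [apply cond_pos|]. intros u p Hu H1 H2.
  destruct (polar_surjective u Hu) as (t & Ht & ->).
  (* The compactness statement delivers its covering point under a double negation, which a proof by
     contradiction absorbs. *)
  apply Rnot_lt_le. intros Hlt. apply (Hd t Ht). intros (s & Hs & Hts & Hds).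
  unfold delta in *. destruct (constructive_indefinite_description _ (Loc s)) as [e He]; simpl in *.
  assert (X := He t p Hts ltac:(lra) ltac:(lra)).
  assert (/ e <= / d). { apply Rinv_le_contravar; auto. apply cond_pos. } lra.
Qed.

Lemma circle_bounded (k : C -> C) :
  (forall u, Cmod u = 1 -> ccont k u) -> exists M, forall u, Cmod u = 1 -> Cmod (k u) <= M.
Proof.
  intros H. destruct (circle_tube (fun p => k (fst p))) as (d & M & Hd & B).
  - intros u Hu eps He. destruct (H u Hu eps He) as (d & Hd & E). exists d; split; auto.
  - exists M. intros u Hu. apply (B u (u, RtoC 0)); auto; simpl.
    replace (u - u)%C with (RtoC 0) by ring. now rewrite Cmod_0. now rewrite Cmod_0.
Qed.

(** With [s = sqrt x], one factor [s ^ n] absorbs [INR n] by Bernoulli's inequality, and the other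
    tends to [0]. *)
Lemma geometric_beats_linear (x A B eps : R) :
  0 < x < 1 -> 0 <= A -> 0 <= B -> 0 < eps ->
  exists N, forall n, (N <= n)%nat -> x ^ n * (A + INR n * B) < eps.
Proof.
  intros Hx HA HB He. set (s := sqrt x).
  assert (S2 : s * s = x) by (apply sqrt_sqrt; lra).
  assert (S0 : 0 < s) by (apply sqrt_lt_R0; lra).
  assert (S1 : s < 1) by nra.
  set (h := / s - 1).
  assert (Hh : 0 < h). { unfold h. assert (1 < / s). { rewrite <- Rinv_1 at 1. apply Rinv_lt_contravar; lra. } lra. }
  assert (Bd : forall n, s ^ n * (A + INR n * B) <= A + B / h).
  { intros n. assert (P : 0 < s ^ n) by now apply pow_lt.
    assert (Q : s ^ n <= 1). { rewrite <- (pow1 n). apply pow_incr; lra. }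
    assert (E : s ^ n * (1 + h) ^ n = 1).
    { rewrite <- Rpow_mult_distr. replace (s * (1 + h)) with 1 by (unfold h; field; lra). apply pow1. }
    assert (Ber := poly n h Hh).
    assert (K : s ^ n * INR n <= / h).
    { assert (0 <= INR n) by apply pos_INR. apply (Rmult_le_reg_r h); auto. rewrite Rinv_l by lra. nra. }
    unfold Rdiv. assert (s ^ n * INR n * B <= / h * B) by (apply Rmult_le_compat_r; auto). nra. }
  set (K := A + B / h + 1).
  assert (HK : 0 < K). { unfold K. assert (0 <= B / h) by (apply Rle_div_r; lra). lra. }
  destruct (pow_lt_1_zero s ltac:(rewrite Rabs_pos_eq; lra) (eps / K)) as [N HN].
  { now apply Rdiv_lt_0_compat. }
  exists N. intros n Hn. specialize (HN n Hn). rewrite Rabs_pos_eq in HN by (apply pow_le; lra).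
  rewrite <- S2, Rpow_mult_distr, Rmult_assoc.
  assert (P : 0 < s ^ n) by now apply pow_lt.
  assert (s ^ n * K < eps). { apply Rlt_div_r in HN; auto. }
  specialize (Bd n). unfold K in *. nra.
Qed.

Lemma RtoC_S (n : nat) : RtoC (INR (S n)) = (RtoC (INR n) + 1)%C.
Proof. now rewrite S_INR, RtoC_plus. Qed.

(** Iteration transports the bound on the unit circle to the circles of radius [|delta|^n] and
    [|delta|^-n]. By [|nu| < 1] the function is small on the former; by [|delta| <= |nu|] it is O(r
    log r) on the latter, so [linear_of_growth] applies. A linear solution leaves no room for the
    resonant term [b * z], which would call for a logarithm. *)
Lemma scaling_linear (k : C -> C) (delta nu b : C) :
  in_punctured_disc delta -> Cmod delta <= Cmod nu < 1 -> b = 0%C \/ nu = delta ->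
  (forall z : C, z <> 0%C -> cdiff k z) ->
  (forall z : C, z <> 0%C -> k (delta * z)%C = (nu * k z + b * z)%C) ->
  b = 0%C /\ exists a : C, (a = 0%C \/ nu = delta) /\ forall z : C, z <> 0%C -> k z = (a * z)%C.
Proof.
  intros Hd Hnu Hb Hk Eq. unfold in_punctured_disc in Hd.
  assert (D0 : delta <> 0%C) by (apply Cmod_gt_0; lra).
  assert (N0 : nu <> 0%C) by (apply Cmod_gt_0; lra).
  assert (It : forall n (z : C), z <> 0%C ->
    k (delta ^ n * z)%C = (nu ^ n * (k z + RtoC (INR n) * (b / nu) * z))%C).
  { induction n as [|n IH]; intros z Hz.
    - simpl. replace (1 * z)%C with z by ring. ring.
    - rewrite Cpow_S, <- Cmult_assoc, Eq, IH, RtoC_S; auto.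
      2: { apply Cmult_neq_0; auto. now apply Cpow_nz. }
      destruct Hb as [->|<-].
      + rewrite Cpow_S. field; auto.
      + rewrite Cpow_S. field; auto. }
  destruct (circle_bounded k) as [M HM].
  { intros u Hu. apply cdiff_ccont, Hk. apply Cmod_gt_0; lra. }
  assert (HM0 : 0 <= M). { eapply Rle_trans; [apply Cmod_ge_0|apply (HM 1%C)]. apply Cmod_1. }
  set (b' := Cmod (b / nu)). assert (Hb' : 0 <= b') by apply Cmod_ge_0.
  assert (Bd : forall n u, Cmod u = 1 -> Cmod (k u + RtoC (INR n) * (b / nu) * u)%C <= M + INR n * b').
  { intros n u Hu. eapply Rle_trans; [apply Cmod_triangle|]. rewrite !Cmod_mult, Hu, Cmod_R.
    rewrite Rabs_pos_eq by apply pos_INR. fold b'. specialize (HM u Hu). lra. }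
  destruct (linear_of_growth k) as [a Ha]; auto.
  - intros eps He.
    destruct (geometric_beats_linear (Cmod nu) M b' eps) as [n1 H1]; try lra.
    destruct (geometric_beats_linear (Cmod delta) 1 0 eps) as [n2 H2]; try lra.
    set (n := (n1 + n2)%nat). specialize (H1 n ltac:(unfold n; lia)). specialize (H2 n ltac:(unfold n; lia)).
    assert (Pn : 0 < Cmod delta ^ n) by (apply pow_lt; lra).
    exists (Cmod delta ^ n). split; [nra|].
    intros z Hz. set (u := (z / delta ^ n)%C).
    assert (Hp : (delta ^ n)%C <> 0%C) by now apply Cpow_nz.
    assert (Hu : Cmod u = 1).
    { unfold u. rewrite Cmod_div, Hz, Cmod_pow by auto. field. lra. }
    replace z with (delta ^ n * u)%C by (unfold u; field; auto).
    rewrite It by (apply Cmod_gt_0; lra). rewrite Cmod_mult, Cmod_pow.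
    left. eapply Rle_lt_trans; [|exact H1]. apply Rmult_le_compat_l; auto. apply pow_le; lra.
  - intros eps He.
    destruct (geometric_beats_linear (Cmod delta) M (2 * b') eps) as [n1 H1]; try lra.
    destruct (geometric_beats_linear (Cmod delta) 1 0 eps) as [n2 H2]; try lra.
    set (n := (n1 + n2)%nat). specialize (H1 n ltac:(unfold n; lia)). specialize (H2 n ltac:(unfold n; lia)).
    assert (Pn : 0 < Cmod delta ^ n) by (apply pow_lt; lra).
    set (r := / Cmod delta ^ n).
    assert (Er : Cmod delta ^ n * r = 1) by (unfold r; field; lra).
    assert (Pr : 0 < r) by (unfold r; now apply Rinv_0_lt_compat).
    exists r. split; [nra|].
    intros z Hz.
    assert (z0 : z <> 0%C) by (apply Cmod_gt_0; lra).
    assert (Hp : (delta ^ n)%C <> 0%C) by now apply Cpow_nz.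
    assert (Hq : (nu ^ n)%C <> 0%C) by now apply Cpow_nz.
    set (u := (delta ^ n * z)%C).
    assert (Hu : Cmod u = 1) by (unfold u; rewrite Cmod_mult, Cmod_pow, Hz; auto).
    assert (I := It n z z0). fold u in I.
    assert (Ez : k z = (k u / nu ^ n - RtoC (INR n) * (b / nu) * z)%C) by (rewrite I; field; auto).
    rewrite Ez. eapply Rle_trans; [apply Cmod_triangle|].
    rewrite Cmod_opp, !Cmod_mult, Cmod_div, Cmod_pow, Hz, Cmod_R by auto.
    rewrite Rabs_pos_eq by apply pos_INR. fold b'.
    assert (V : Cmod (k u) / Cmod nu ^ n <= M * r).
    { unfold Rdiv. apply Rmult_le_compat; auto. apply Cmod_ge_0.
      left; apply Rinv_0_lt_compat, pow_lt; lra.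
      unfold r. apply Rinv_le_contravar; auto. apply pow_incr; lra. }
    assert (W : M + INR n * (2 * b') <= eps * r).
    { apply (Rmult_le_reg_l (Cmod delta ^ n)); auto.
      replace (Cmod delta ^ n * (eps * r)) with (eps * (Cmod delta ^ n * r)) by ring. rewrite Er. lra. }
    assert (0 <= INR n * b') by (apply Rmult_le_pos; auto; apply pos_INR).
    assert ((M + INR n * (2 * b')) * r <= eps * r * r) by (apply Rmult_le_compat_r; lra).
    nra.
  - assert (O1 : (1 : C) <> 0%C) by (apply Cmod_gt_0; rewrite Cmod_1; lra).
    assert (E := Eq 1%C O1). rewrite !Ha in E; auto. 2: now rewrite Cmult_1_r.
    assert (b0 : b = 0%C).
    { destruct Hb as [|Hb]; auto. subst nu.
      replace b with (delta * (a * 1) + b * 1 - a * (delta * 1))%C by ring. rewrite <- E. ring. }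
    split; auto. exists a. split; auto. subst b.
    destruct (excluded_middle_informative (a = 0%C)) as [|W]; auto. right.
    replace nu with ((nu * (a * 1) + 0 * 1) / a)%C by (field; auto). rewrite <- E. field; auto.
Qed.

(** Division by [z ^ j] replaces [mu] by [mu / delta ^ j], and [j] is chosen to bring its modulus
    into [[|delta|, 1)], the range of [scaling_linear]. The exponent found is [j + 1], hence
    positive. *)
Lemma scaling_monomial (A : C -> C) (delta mu b : C) (r : nat) :
  in_punctured_disc delta -> in_punctured_disc mu -> (1 <= r)%nat ->
  b = 0%C \/ mu = (delta ^ r)%C ->
  (forall z : C, z <> 0%C -> cdiff A z) ->
  (forall z : C, z <> 0%C -> A (delta * z)%C = (mu * A z + b * z ^ r)%C) ->
  b = 0%C /\ exists (a : C) (m : nat), (1 <= m)%nat /\ (a = 0%C \/ mu = (delta ^ m)%C) /\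
    forall z : C, z <> 0%C -> A z = (a * z ^ m)%C.
Proof.
  intros Hd Hmu Hr Hb HA Eq. unfold in_punctured_disc in *.
  assert (D0 : delta <> 0%C) by (apply Cmod_gt_0; lra).
  (* If [b <> 0], the resonance [mu = delta ^ r] makes [j = r - 1] the right choice, and the
     inhomogeneous term becomes linear after division. *)
  assert (Hj : exists j, Cmod delta ^ S j <= Cmod mu < Cmod delta ^ j /\ (b = 0%C \/ r = S j)).
  { destruct (excluded_middle_informative (b = 0%C)) as [b0|b0].
    - assert (Ex : exists n, Cmod delta ^ n <= Cmod mu).
      { destruct (geometric_beats_linear (Cmod delta) 1 0 (Cmod mu)) as [n Hn]; try lra.
        exists n. specialize (Hn n (Nat.le_refl n)). lra. }
      destruct Ex as [n Hn]. induction n as [|n IH].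
      + simpl in Hn; lra.
      + destruct (Rle_dec (Cmod delta ^ n) (Cmod mu)); auto. exists n. split; auto. lra.
    - destruct Hb as [|Hb]; [tauto|]. destruct r as [|j]; [lia|]. exists j. split; auto.
      rewrite Hb, Cmod_pow. simpl. assert (0 < Cmod delta ^ j) by (apply pow_lt; lra). nra. }
  destruct Hj as (j & Hj1 & Hj2).
  assert (Pj : (delta ^ j)%C <> 0%C) by now apply Cpow_nz.
  assert (Qj : 0 < Cmod delta ^ j) by (apply pow_lt; lra).
  destruct (scaling_linear (fun z => A z / z ^ j)%C delta (mu / delta ^ j)%C (b / delta ^ j)%C)
    as [B (a & Ha & E)]; auto.
  - rewrite Cmod_div, Cmod_pow by auto. simpl in Hj1.
    split; [apply Rle_div_r; lra|apply Rlt_div_l; lra].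
  - destruct Hb as [->|Hb]; [left; field; auto|]. destruct Hj2 as [->|Hj2]; [left; field; auto|].
    right. rewrite Hb, Hj2, Cpow_S. field; auto.
  - intros z Hz. apply cdiff_div; auto. apply cdiff_pow. now apply Cpow_nz.
  - intros z Hz. rewrite Eq by auto. rewrite Cpow_mult_l.
    assert (Pz : (z ^ j)%C <> 0%C) by now apply Cpow_nz.
    destruct Hj2 as [->| ->]; [|rewrite Cpow_S]; field; auto.
  - assert (b0 : b = 0%C).
    { replace b with (b / delta ^ j * delta ^ j)%C by (field; auto). rewrite B; ring. }
    split; auto. exists a, (S j). split; [lia|]. split.
    + destruct Ha as [|Ha]; auto. right. rewrite Cpow_S. rewrite <- Ha at 1. field; auto.
    + intros z Hz. assert (Pz : (z ^ j)%C <> 0%C) by now apply Cpow_nz.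
      replace (A z) with (A z / z ^ j * z ^ j)%C by (field; auto). rewrite E by auto.
      rewrite Cpow_S; ring.
Qed.

(** * Semi-invariant functions of two variables *)

Local Open Scope C_scope.

Definition C2_NormedModule := prod_NormedModule C_AbsRing C_NormedModule C_NormedModule.

Definition hol (psi : C2 -> C) (p : C2) : Prop :=
  ex_filterdiff (K := C_AbsRing) (U := C2_NormedModule) (V := C_NormedModule) psi (locally p).

Lemma hol_comp_fst (F : C2 -> C2) (p : C2) : holomorphic_at F p -> hol (fun q => fst (F q)) p.
Proof.
  intros H. apply (ex_filterdiff_comp' (K := C_AbsRing) (U := C2_NormedModule)
    (V := C2_NormedModule) (W := C_NormedModule) F fst p H).
  apply (ex_filterdiff_linear (K := C_AbsRing) (U := C2_NormedModule) (V := C_NormedModule)).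
  apply (is_linear_fst (K := C_AbsRing) (U := C_NormedModule) (V := C_NormedModule)).
Qed.

Lemma hol_comp_snd (F : C2 -> C2) (p : C2) : holomorphic_at F p -> hol (fun q => snd (F q)) p.
Proof.
  intros H. apply (ex_filterdiff_comp' (K := C_AbsRing) (U := C2_NormedModule)
    (V := C2_NormedModule) (W := C_NormedModule) F snd p H).
  apply (ex_filterdiff_linear (K := C_AbsRing) (U := C2_NormedModule) (V := C_NormedModule)).
  apply (is_linear_snd (K := C_AbsRing) (U := C_NormedModule) (V := C_NormedModule)).
Qed.

Lemma hol_fst (p : C2) : hol fst p.
Proof.
  apply (ex_filterdiff_linear (K := C_AbsRing) (U := C2_NormedModule) (V := C_NormedModule)).
  apply (is_linear_fst (K := C_AbsRing) (U := C_NormedModule) (V := C_NormedModule)).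
Qed.

Lemma hol_snd (p : C2) : hol snd p.
Proof.
  apply (ex_filterdiff_linear (K := C_AbsRing) (U := C2_NormedModule) (V := C_NormedModule)).
  apply (is_linear_snd (K := C_AbsRing) (U := C_NormedModule) (V := C_NormedModule)).
Qed.

Lemma hol_plus (f g : C2 -> C) (p : C2) : hol f p -> hol g p -> hol (fun q => f q + g q) p.
Proof. apply (ex_filterdiff_plus_fct (K := C_AbsRing) (U := C2_NormedModule) (V := C_NormedModule)). Qed.

Lemma hol_cdiff_comp (f : C2 -> C) (g : C -> C) (p : C2) :
  hol f p -> cdiff g (f p) -> hol (fun q => g (f q)) p.
Proof.
  apply (ex_filterdiff_comp' (K := C_AbsRing) (U := C2_NormedModule) (V := C_NormedModule) (W := C_NormedModule)).
Qed.

Lemma hol_scal (f : C2 -> C) (a : C) (p : C2) : hol f p -> hol (fun q => a * f q) p.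
Proof.
  intros H. apply (hol_cdiff_comp f (fun z => a * z)); auto.
  apply cdiff_mult; [apply cdiff_const|apply cdiff_id].
Qed.

Lemma holomorphic_pair (f g : C2 -> C) (p : C2) :
  hol f p -> hol g p -> holomorphic_at (fun q => (f q, g q)) p.
Proof.
  intros Hf Hg.
  apply (ex_filterdiff_comp'_2 (K := C_AbsRing) (T := C2_NormedModule) (U := C_NormedModule)
    (V := C_NormedModule) (W := C2_NormedModule) f g (fun a b => (a, b)) p Hf Hg).
  apply (ex_filterdiff_ext (K := C_AbsRing) (U := C2_NormedModule) (V := C2_NormedModule) (fun q => q)).
  - now intros [x y].
  - apply (ex_filterdiff_id (K := C_AbsRing) (V := C2_NormedModule)).
Qed.

Lemma holomorphic_comp (F G : C2 -> C2) (p : C2) :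
  holomorphic_at F p -> holomorphic_at G (F p) -> holomorphic_at (fun q => G (F q)) p.
Proof.
  apply (ex_filterdiff_comp' (K := C_AbsRing) (U := C2_NormedModule)
    (V := C2_NormedModule) (W := C2_NormedModule)).
Qed.

Lemma holomorphic_ext (F G : C2 -> C2) (p : C2) :
  locally p (fun q => F q = G q) -> holomorphic_at F p -> holomorphic_at G p.
Proof.
  apply (ex_filterdiff_ext_locally (K := C_AbsRing) (U := C2_NormedModule) (V := C2_NormedModule)).
Qed.

Lemma hol_slice_1 (psi : C2 -> C) (z w : C) : hol psi (z, w) -> cdiff (fun t => psi (t, w)) z.
Proof.
  apply (ex_filterdiff_comp' (K := C_AbsRing) (U := C_NormedModule) (V := C2_NormedModule)
    (W := C_NormedModule) (fun t => (t, w)) psi z).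
  apply (ex_filterdiff_comp'_2 (K := C_AbsRing) (T := C_NormedModule) (U := C_NormedModule)
    (V := C_NormedModule) (W := C2_NormedModule) (fun t => t) (fun _ => w) (fun a b => (a, b)) z).
  - apply cdiff_id.
  - apply cdiff_const.
  - apply (ex_filterdiff_ext (K := C_AbsRing) (U := C2_NormedModule) (V := C2_NormedModule) (fun q => q)).
    now intros [x y]. apply (ex_filterdiff_id (K := C_AbsRing) (V := C2_NormedModule)).
Qed.

Lemma hol_slice_2 (psi : C2 -> C) (z w : C) : hol psi (z, w) -> cdiff (fun t => psi (z, t)) w.
Proof.
  apply (ex_filterdiff_comp' (K := C_AbsRing) (U := C_NormedModule) (V := C2_NormedModule)
    (W := C_NormedModule) (fun t => (z, t)) psi w).
  apply (ex_filterdiff_comp'_2 (K := C_AbsRing) (T := C_NormedModule) (U := C_NormedModule)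
    (V := C_NormedModule) (W := C2_NormedModule) (fun _ => z) (fun t => t) (fun a b => (a, b)) w).
  - apply cdiff_const.
  - apply cdiff_id.
  - apply (ex_filterdiff_ext (K := C_AbsRing) (U := C2_NormedModule) (V := C2_NormedModule) (fun q => q)).
    now intros [x y]. apply (ex_filterdiff_id (K := C_AbsRing) (V := C2_NormedModule)).
Qed.

Lemma locally_C2 (p : C2) (P : C2 -> Prop) :
  locally (T := prod_UniformSpace C_UniformSpace C_UniformSpace) p P <->
  exists d, (0 < d)%R /\ forall q : C2, (Cmod (fst q - fst p) < d)%R ->
    (Cmod (snd q - snd p) < d)%R -> P q.
Proof.
  split.
  - intros [d H]. exists d. split; [apply cond_pos|]. intros q H1 H2. apply H.
    split; apply C_NormedModule_mixin_compat1; assumption.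
  - intros (d & Hd & H). assert (H2 : (0 < d / 2)%R) by lra.
    exists (mkposreal _ H2). intros q [B1 B2].
    assert (S2 : (sqrt 2 <= 2)%R).
    { replace 2%R with (sqrt (2 * 2)) at 2 by (rewrite sqrt_square; lra). apply sqrt_le_1; lra. }
    apply (C_NormedModule_mixin_compat2 _ _ (mkposreal _ H2)) in B1.
    apply (C_NormedModule_mixin_compat2 _ _ (mkposreal _ H2)) in B2. simpl in B1, B2.
    apply H; (eapply Rlt_le_trans; [eassumption|nra]).
Qed.

Lemma hol_c2cont (psi : C2 -> C) (p : C2) : hol psi p -> c2cont psi p.
Proof.
  intros H. apply (filterdiff_continuous (K := C_AbsRing) (U := C2_NormedModule) (V := C_NormedModule)) in H.
  intros eps He.
  assert (L : locally (T := C_UniformSpace) (psi p) (fun z => (Cmod (z - psi p) < eps)%R)).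
  { apply (locally_Cmod (psi p)). exists eps. auto. }
  apply H in L. now apply (locally_C2 p) in L.
Qed.

(* Every contraction has this form, with [e = 0] or [a = d ^ r]. *)
Definition tri (a e d : C) (r : nat) (p : C2) : C2 := (a * fst p + e * snd p ^ r, d * snd p).

(** A Jordan block: if [a = d ^ r], then [z] and [w ^ r] are scaled by the same factor, and the
    coupling [e] accumulates linearly in [n]. *)
Lemma tri_iter (a e d : C) (r n : nat) (z w : C) :
  a <> 0 -> e = 0 \/ a = d ^ r ->
  Nat.iter n (tri a e d r) (z, w) =
    (a ^ n * (z + RtoC (INR n) * (e / a) * w ^ r), d ^ n * w).
Proof.
  intros Ha He. induction n as [|n IH].
  - simpl. f_equal; ring.
  - simpl Nat.iter. rewrite IH. unfold tri; simpl fst; simpl snd.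
    rewrite RtoC_S, !Cpow_S, Cpow_mult_l. f_equal; [|ring].
    rewrite <- Cpow_mult_r, Nat.mul_comm, Cpow_mult_r.
    destruct He as [->| <-]; field; auto.
Qed.

(** The deviation from [(a ^ n * z, 0)] does not involve [z], so [N] precedes [z]. One iterate thus
    carries the whole circle [|z| = |a|^-n] at height [w] into a tube about the unit circle of the
    axis. *)
Lemma tri_reaches_tube (a e d : C) (r : nat) (w : C) (eta : R) :
  in_punctured_disc a -> in_punctured_disc d -> e = 0 \/ a = d ^ r -> (0 < eta)%R ->
  exists N, forall n, (N <= n)%nat -> forall z,
    (Cmod (fst (Nat.iter n (tri a e d r) (z, w)) - a ^ n * z) < eta)%R /\
    (Cmod (snd (Nat.iter n (tri a e d r) (z, w))) < eta)%R.
Proof.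
  intros Ha Hd He Heta. unfold in_punctured_disc in *.
  assert (a0 : a <> 0) by (apply Cmod_gt_0; lra).
  destruct (geometric_beats_linear (Cmod a) 0 (Cmod (e / a * w ^ r)) eta) as [n1 H1]; try lra; try apply Cmod_ge_0.
  destruct (geometric_beats_linear (Cmod d) (Cmod w) 0 eta) as [n2 H2]; try lra; try apply Cmod_ge_0.
  exists (n1 + n2)%nat. intros n Hn z. specialize (H1 n ltac:(lia)). specialize (H2 n ltac:(lia)).
  rewrite tri_iter by auto. simpl fst; simpl snd. split.
  - replace (a ^ n * (z + RtoC (INR n) * (e / a) * w ^ r) - a ^ n * z)
      with (a ^ n * (RtoC (INR n) * (e / a * w ^ r))) by ring.
    rewrite Cmod_mult, Cmod_pow, Cmod_mult, Cmod_R, Rabs_pos_eq by apply pos_INR. lra.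
  - rewrite Cmod_mult, Cmod_pow. lra.
Qed.

Lemma ccont_agree (f g : C -> C) (z : C) :
  ccont f z -> ccont g z -> (forall w, w <> z -> f w = g w) -> f z = g z.
Proof.
  intros Hf Hg E.
  destruct (excluded_middle_informative (f z = g z)) as [|H]; auto. exfalso.
  assert (P : (0 < Cmod (f z - g z))%R).
  { apply Cmod_gt_0. intros Q. apply H. replace (f z) with (f z - g z + g z) by ring. rewrite Q; ring. }
  set (e := Cmod (f z - g z)) in *.
  destruct (Hf (e / 2)%R ltac:(lra)) as (d1 & Hd1 & H1).
  destruct (Hg (e / 2)%R ltac:(lra)) as (d2 & Hd2 & H2).
  set (t := (Rmin d1 d2 / 2)%R). assert (0 < Rmin d1 d2)%R by now apply Rmin_pos.
  assert (L1 := Rmin_l d1 d2). assert (L2 := Rmin_r d1 d2).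
  assert (M : Cmod (z + RtoC t - z) = t).
  { replace (z + RtoC t - z) with (RtoC t) by ring. rewrite Cmod_R. apply Rabs_pos_eq. unfold t; lra. }
  specialize (H1 (z + RtoC t) ltac:(rewrite M; unfold t; lra)).
  specialize (H2 (z + RtoC t) ltac:(rewrite M; unfold t; lra)).
  rewrite E in H1.
  2: { intros Q. rewrite Q in M. replace (z - z) with (RtoC 0) in M by ring. rewrite Cmod_0 in M. unfold t in M; lra. }
  assert (T := Cmod_triangle (f z - g (z + RtoC t)) (g (z + RtoC t) - g z)).
  replace (f z - g (z + RtoC t) + (g (z + RtoC t) - g z)) with (f z - g z) in T by ring.
  rewrite Cmod_minus_rev in H1. fold e in T. lra.
Qed.

Lemma W_1 (z w : C) : z <> 0 -> W (z, w).
Proof. intros H E. injection E. auto. Qed.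

Lemma W_2 (z w : C) : w <> 0 -> W (z, w).
Proof. intros H E. injection E. auto. Qed.

Lemma Cmult_neq_0_inv_r (a b : C) : a * b <> 0 -> b <> 0.
Proof. intros H ->. apply H. ring. Qed.

Lemma tri_W (a e d : C) (r : nat) (p : C2) :
  a <> 0 -> d <> 0 -> (1 <= r)%nat -> W p -> W (tri a e d r p).
Proof.
  intros Ha Hd Hr Wp. destruct p as [z w]. unfold tri; simpl.
  destruct (excluded_middle_informative (w = 0)) as [->|Hw].
  - apply W_1. destruct r as [|r]; [lia|]. rewrite Cpow_S.
    replace (a * z + e * (0 * 0 ^ r)) with (a * z) by ring. apply Cmult_neq_0; auto.
    intros ->. now apply Wp.
  - apply W_2. now apply Cmult_neq_0.
Qed.

Lemma iter_W (f : C2 -> C2) (n : nat) (p : C2) :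
  (forall q, W q -> W (f q)) -> W p -> W (Nat.iter n f p).
Proof. intros H Wp. induction n; simpl; auto. Qed.

(** [B (d ^ n * w) = nu ^ n * B w] tends to [B 0]. Consecutive terms differ by at least
    [|(nu - 1) * B w|] in modulus, so [B w = 0] unless [nu = 1]; in that case [B w = B 0]. *)
Lemma scaling_constant (B : C -> C) (d nu : C) :
  in_punctured_disc d -> (1 <= Cmod nu)%R -> ccont B 0 ->
  (forall w : C, w <> 0 -> B (d * w) = nu * B w) ->
  exists b : C, (b = 0 \/ nu = 1) /\ forall w : C, w <> 0 -> B w = b.
Proof.
  intros Hd Hnu HB Eq. unfold in_punctured_disc in Hd.
  assert (d0 : d <> 0) by (apply Cmod_gt_0; lra).
  assert (It : forall n (w : C), w <> 0 -> B (d ^ n * w) = nu ^ n * B w).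
  { induction n as [|n IH]; intros w Hw.
    - simpl. rewrite !Cmult_1_l. reflexivity.
    - rewrite !Cpow_S. replace (d * d ^ n * w) with (d * (d ^ n * w)) by ring.
      rewrite Eq, IH by (auto; apply Cmult_neq_0; auto; now apply Cpow_nz). ring. }
  assert (Lim : forall eps (w : C), (0 < eps)%R -> exists N, forall n, (N <= n)%nat ->
     (Cmod (B (d ^ n * w)%C - B (RtoC 0)) < eps)%R).
  { intros eps w He. destruct (HB eps He) as (e & He' & H).
    destruct (geometric_beats_linear (Cmod d) (Cmod w) 0 e) as [N HN]; try lra; try apply Cmod_ge_0.
    exists N. intros n Hn. apply H. replace (d ^ n * w - 0) with (d ^ n * w) by ring.
    rewrite Cmod_mult, Cmod_pow. specialize (HN n Hn). lra. }
  assert (Pow : forall n, (1 <= Cmod nu ^ n)%R) by (intros; now apply pow_R1_Rle).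
  destruct (excluded_middle_informative (nu = 1)) as [->|Hn].
  - exists (B 0). split; auto. intros w Hw.
    destruct (excluded_middle_informative (B w = B 0)) as [|H]; auto. exfalso.
    assert (P : (0 < Cmod (B w - B 0))%R).
    { apply Cmod_gt_0. intros Q. apply H. replace (B w) with (B w - B 0 + B 0) by ring. rewrite Q; ring. }
    destruct (Lim _ w P) as [N HN]. specialize (HN N (Nat.le_refl N)).
    rewrite It, Cpow_1_l, Cmult_1_l in HN by auto. lra.
  - exists 0. split; auto. intros w Hw.
    destruct (excluded_middle_informative (B w = 0)) as [|H]; auto. exfalso.
    assert (Q0 : (nu - 1) <> 0).
    { intros Q. apply Hn. replace nu with (nu - 1 + 1) by ring. rewrite Q; ring. }
    assert (P : (0 < Cmod ((nu - 1) * B w))%R) by (apply Cmod_gt_0; now apply Cmult_neq_0).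
    destruct (Lim (Cmod ((nu - 1) * B w) / 2)%R w ltac:(lra)) as [N HN].
    assert (H1 := HN N (Nat.le_refl N)). assert (H2 := HN (S N) (Nat.le_succ_diag_r N)).
    rewrite It in H1, H2 by auto.
    assert (T := Cmod_triangle (nu ^ S N * B w - B 0) (B 0 - nu ^ N * B w)).
    rewrite (Cmod_minus_rev (B 0)) in T.
    replace (nu ^ S N * B w - B 0 + (B 0 - nu ^ N * B w)) with (nu ^ N * ((nu - 1) * B w)) in T
      by (rewrite Cpow_S; ring).
    rewrite Cmod_mult, Cmod_pow in T. specialize (Pow N). nra.
Qed.

(** On the circle [|z| = |a|^-n] the value of [psi] is [mu^-n] times a value in the tube, hence at
    most [M * |mu|^-n <= M * |a|^-n]: linear growth along these circles. *)
Lemma semi_invariant_affine (psi : C2 -> C) (a e d mu : C) (r : nat) :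
  in_punctured_disc a -> in_punctured_disc d -> in_punctured_disc mu ->
  (Cmod a <= Cmod mu)%R -> (1 <= r)%nat -> e = 0 \/ a = d ^ r ->
  (forall p, W p -> hol psi p) ->
  (forall p, W p -> psi (tri a e d r p) = mu * psi p) ->
  forall w : C, w <> 0 -> exists b, forall z, psi (z, w) = psi (RtoC 0, w) + b * z.
Proof.
  intros Ha Hd Hmu Hle Hr He Hpsi Eq w Hw. unfold in_punctured_disc in *.
  assert (a0 : a <> 0) by (apply Cmod_gt_0; lra).
  assert (d0 : d <> 0) by (apply Cmod_gt_0; lra).
  assert (m0 : mu <> 0) by (apply Cmod_gt_0; lra).
  assert (It : forall n p, W p -> psi (Nat.iter n (tri a e d r) p) = mu ^ n * psi p).
  { induction n as [|n IH]; intros p Wp; simpl Nat.iter; [simpl; ring|].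
    rewrite Eq, IH, Cpow_S by (auto; apply iter_W; auto; intros; now apply tri_W). ring. }
  destruct (circle_tube psi) as (eta & M & Heta & HM).
  { intros u Hu. apply hol_c2cont, Hpsi, W_1. apply Cmod_gt_0; lra. }
  assert (HM0 : (0 <= M)%R).
  { eapply Rle_trans; [apply Cmod_ge_0|apply (HM (RtoC 1) (RtoC 1, RtoC 0))]; simpl.
    apply Cmod_1. replace (1 - 1) with (RtoC 0) by ring. all: rewrite Cmod_0; auto. }
  destruct (linear_of_growth (fun z => psi (z, w) - psi (RtoC 0, w))) as [b Hb].
  - intros z _. apply cdiff_minus; [|apply cdiff_const]. apply hol_slice_1, Hpsi, W_2; auto.
  - intros eps Heps.
    assert (Hc : ccont (fun z => psi (z, w)) 0) by (apply cdiff_ccont, hol_slice_1, Hpsi, W_2; auto).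
    destruct (Hc eps Heps) as (s & Hs & H).
    exists (Rmin eps s / 2)%R. assert (0 < Rmin eps s)%R by now apply Rmin_pos.
    assert (L1 := Rmin_l eps s). assert (L2 := Rmin_r eps s).
    split; [lra|]. intros z Hz. left. apply H. replace (z - 0) with z by ring. lra.
  - intros eps Heps.
    set (K := Cmod (psi (RtoC 0, w))). assert (HK : (0 <= K)%R) by apply Cmod_ge_0.
    destruct (tri_reaches_tube a e d r w eta) as [n1 H1]; auto.
    (* [M] accounts for [psi] in the tube, [K] for the subtracted value at [z = 0], and [1] for the
       requirement [1 < eps * R0]. *)
    destruct (geometric_beats_linear (Cmod a) (1 + M + K) 0 eps) as [n2 H2]; try lra.
    set (n := (n1 + n2)%nat). specialize (H1 n ltac:(unfold n; lia)). specialize (H2 n ltac:(unfold n; lia)).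
    assert (Pn : (0 < Cmod a ^ n)%R) by (apply pow_lt; lra).
    assert (Pn1 : (Cmod a ^ n <= 1)%R) by (rewrite <- (pow1 n); apply pow_incr; lra).
    set (R0 := (/ Cmod a ^ n)%R).
    assert (E : (Cmod a ^ n * R0 = 1)%R) by (unfold R0; field; lra).
    assert (PR : (1 <= R0)%R) by nra.
    assert (ER : (1 + M + K < eps * R0)%R).
    { apply (Rmult_lt_reg_l (Cmod a ^ n)); auto.
      replace (Cmod a ^ n * (eps * R0))%R with (eps * (Cmod a ^ n * R0))%R by ring. rewrite E. lra. }
    exists R0. split; [nra|]. intros z Hz.
    assert (Hu : Cmod (a ^ n * z) = 1%R) by (rewrite Cmod_mult, Cmod_pow, Hz; auto).
    destruct (H1 z) as [T1 T2]. assert (B := HM _ _ Hu T1 T2).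
    rewrite It, Cmod_mult, Cmod_pow in B by now apply W_2.
    assert (Pm : (Cmod a ^ n <= Cmod mu ^ n)%R) by (apply pow_incr; lra).
    assert (B' : (Cmod (psi (z, w)) <= M * R0)%R).
    { apply (Rmult_le_reg_l (Cmod a ^ n)); auto.
      replace (Cmod a ^ n * (M * R0))%R with (M * (Cmod a ^ n * R0))%R by ring. rewrite E.
      assert (X := Cmod_ge_0 (psi (z, w))). nra. }
    eapply Rle_trans; [apply Cmod_triangle|]. rewrite Cmod_opp. fold K.
    assert (K <= K * R0)%R by nra.
    assert ((1 + M + K) * R0 <= eps * R0 * R0)%R by (apply Rmult_le_compat_r; lra). lra.
  - exists b. intros z. destruct (excluded_middle_informative (z = 0)) as [->|Hz]; [ring|].
    rewrite <- Hb by auto. ring.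
Qed.

(** Write [psi] as [A w + B w * z] and compare coefficients of [z]. The slope is scaled by [mu / a],
    of modulus at least [1], hence constant. The intercept solves a scaling equation with
    inhomogeneous term [- (b * e) * w ^ r], whose solvability forces [b * e = 0]. *)
Lemma semi_invariant (psi : C2 -> C) (a e d mu : C) (r : nat) :
  in_punctured_disc a -> in_punctured_disc d -> in_punctured_disc mu ->
  (Cmod a <= Cmod mu)%R -> (1 <= r)%nat -> e = 0 \/ a = d ^ r ->
  (forall p, W p -> hol psi p) ->
  (forall p, W p -> psi (tri a e d r p) = mu * psi p) ->
  exists (b k : C) (m : nat), (1 <= m)%nat /\ (b = 0 \/ mu = a) /\ b * e = 0 /\
    (k = 0 \/ mu = d ^ m) /\ forall p, W p -> psi p = b * fst p + k * snd p ^ m.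
Proof.
  intros Ha Hd Hmu Hle Hr He Hpsi Eq.
  assert (Aff := semi_invariant_affine psi a e d mu r Ha Hd Hmu Hle Hr He Hpsi Eq).
  unfold in_punctured_disc in *.
  assert (a0 : a <> 0) by (apply Cmod_gt_0; lra).
  assert (d0 : d <> 0) by (apply Cmod_gt_0; lra).
  assert (m0 : mu <> 0) by (apply Cmod_gt_0; lra).
  assert (O1 : RtoC 1 <> 0) by (apply Cmod_gt_0; rewrite Cmod_1; lra).
  assert (O2 : RtoC 2 <> 0) by (apply Cmod_gt_0; rewrite Cmod_R, Rabs_pos_eq; lra).
  (* Slope and intercept are read off on the lines [z = 1] and [z = 2], which avoid the origin, so
     both are holomorphic at [w = 0] too. *)
  set (B := fun w => psi (RtoC 2, w) - psi (RtoC 1, w)).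
  set (A := fun w => psi (RtoC 1, w) - B w).
  assert (DB : forall w, cdiff B w).
  { intros w. apply cdiff_minus; apply hol_slice_2, Hpsi, W_1; auto. }
  assert (DA : forall w, cdiff A w).
  { intros w. apply cdiff_minus; [apply hol_slice_2, Hpsi, W_1; auto|apply DB]. }
  assert (EAB : forall z w : C, w <> 0 -> psi (z, w) = A w + B w * z).
  { intros z w Hw. destruct (Aff w Hw) as [b Hb]. unfold A, B.
    rewrite (Hb z), (Hb (RtoC 1)), (Hb (RtoC 2)). ring. }
  assert (F : forall z w : C, w <> 0 -> A (d * w) + B (d * w) * (a * z + e * w ^ r) = mu * (A w + B w * z)).
  { intros z w Hw. rewrite <- !EAB by (auto; apply Cmult_neq_0; auto). apply (Eq (z, w)). now apply W_2. }
  assert (FA : forall w : C, w <> 0 -> A (d * w) + B (d * w) * (e * w ^ r) = mu * A w).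
  { intros w Hw. assert (X := F 0 w Hw).
    replace (mu * A w) with (mu * (A w + B w * 0)) by ring. rewrite <- X. ring. }
  assert (FB : forall w : C, w <> 0 -> B (d * w) = (mu / a) * B w).
  { intros w Hw. assert (X := F 0 w Hw). assert (Y := F 1 w Hw).
    replace (B (d * w)) with (((A (d * w) + B (d * w) * (a * 1 + e * w ^ r)) -
       (A (d * w) + B (d * w) * (a * 0 + e * w ^ r))) / a) by (field; auto).
    rewrite X, Y. field; auto. }
  destruct (scaling_constant B d (mu / a)) as (b & Hb & HB); auto.
  { rewrite Cmod_div by auto. apply Rle_div_r; lra. }
  { apply cdiff_ccont, DB. }
  assert (Hb' : b = 0 \/ mu = a).
  { destruct Hb as [|Hb]; auto. right. replace mu with (mu / a * a) by (field; auto). rewrite Hb; ring. }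
  destruct (scaling_monomial A d mu (- (b * e)) r) as [Z (k & m & Hm & Hk & HA)]; auto.
  { destruct Hb' as [-> | ->]; [left; ring|]. destruct He as [->|He]; [left; ring|auto]. }
  { intros w Hw. rewrite <- FA by auto. rewrite HB by (apply Cmult_neq_0; auto). ring. }
  exists b, k, m. split; auto. split; auto. split.
  { replace (b * e) with (- - (b * e)) by ring. rewrite Z; ring. }
  split; auto.
  assert (G : forall z w : C, w <> 0 -> psi (z, w) = b * z + k * w ^ m).
  { intros z w Hw. rewrite EAB, HA, HB by auto. ring. }
  (* The formula is known for [w <> 0]; at a point [(z, 0)] of [W] it follows by continuity in
     [w]. *)
  intros [z w] Wp. simpl.
  destruct (excluded_middle_informative (w = 0)) as [->|Hw]; auto.
  apply (ccont_agree (fun t => psi (z, t)) (fun t => b * z + k * t ^ m)); auto.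
  - apply cdiff_ccont, hol_slice_2, Hpsi; auto.
  - apply cdiff_ccont, cdiff_plus; [apply cdiff_const|]. apply cdiff_mult; [apply cdiff_const|apply cdiff_pow].
Qed.

(** * Biholomorphisms induced on the quotient *)

(** The identities are required on all of [C2], as they hold for the polynomial maps in use; this
    frees rewriting from side conditions about the origin. *)
Definition biholomorphic_inverse (f fi : C2 -> C2) : Prop :=
  (forall p, fi (f p) = p /\ f (fi p) = p) /\
  (forall p, W p -> W (f p) /\ W (fi p)) /\
  (forall p, holomorphic_at f p /\ holomorphic_at fi p).

Lemma iter_cancel (f fi : C2 -> C2) (n : nat) (p q : C2) :
  (forall p, fi (f p) = p) -> Nat.iter n f p = Nat.iter n f q -> p = q.
Proof.
  intros H. induction n as [|n IH]; simpl; auto. intros E. apply IH.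
  now rewrite <- (H (Nat.iter n f p)), E, H.
Qed.

Lemma iter_inverse (f fi : C2 -> C2) (n : nat) (p : C2) :
  (forall p, fi (f p) = p) -> Nat.iter n fi (Nat.iter n f p) = p.
Proof.
  intros H. revert p. induction n as [|n IH]; intros p; auto.
  rewrite Nat.iter_succ_r. simpl. now rewrite H.
Qed.

Lemma iter_split (f : C2 -> C2) (m n : nat) (p : C2) :
  (m <= n)%nat -> Nat.iter n f p = Nat.iter m f (Nat.iter (n - m) f p).
Proof. intros H. rewrite <- Nat.iter_add. f_equal. lia. Qed.

Lemma orbit_trans (f fi : C2 -> C2) (p q s : C2) :
  (forall p, fi (f p) = p) -> orbit f p q -> orbit f q s -> orbit f p s.
Proof.
  intros Hf [_ [n Hn]] [Ws [m Hm]]. split; auto.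
  destruct Hn as [Hn|Hn], Hm as [Hm|Hm].
  - exists (m + n)%nat. left. now rewrite Nat.iter_add, <- Hn.
  - rewrite Hm in Hn. destruct (Nat.le_ge_cases n m) as [L|L].
    + rewrite (iter_split f n m s L) in Hn. apply (iter_cancel f fi) in Hn; eauto.
    + rewrite (iter_split f m n p L) in Hn. apply (iter_cancel f fi) in Hn; eauto.
  - destruct (Nat.le_ge_cases n m) as [L|L].
    + exists (m - n)%nat. left. rewrite Hm, Hn, <- Nat.iter_add. f_equal. lia.
    + exists (n - m)%nat. right. rewrite Hm, Hn, <- Nat.iter_add. f_equal. lia.
  - exists (n + m)%nat. right. now rewrite Nat.iter_add, <- Hm.
Qed.

Lemma orbit_sym (f : C2 -> C2) (p q : C2) : W p -> orbit f p q -> orbit f q p.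
Proof. intros Wp [_ [n [H|H]]]; split; eauto. Qed.

Lemma over_W {f : C2 -> C2} (A : quotient f) (p : C2) : over A p -> W p.
Proof. destruct A as [A [a [Wa ->]]]. unfold over; simpl. now intros [H _]. Qed.

Lemma over_exists (f : C2 -> C2) (p : C2) : W p -> exists A : quotient f, over A p.
Proof.
  intros Wp. exists (exist _ (orbit f p) (ex_intro _ p (conj Wp eq_refl))).
  unfold over; simpl. split; auto. exists O; auto.
Qed.

Lemma over_orbit {f : C2 -> C2} (fi : C2 -> C2) (A : quotient f) (p q : C2) :
  (forall p, fi (f p) = p) -> over A p -> (over A q <-> orbit f p q).
Proof.
  intros Hf. destruct A as [A [a [Wa ->]]]. unfold over; simpl. intros Hp. split; intros Hq.
  - apply (orbit_trans f fi p a q); auto. now apply orbit_sym.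
  - apply (orbit_trans f fi a p q); auto.
Qed.

Lemma over_unique {f : C2 -> C2} (fi : C2 -> C2) (A B : quotient f) (p : C2) :
  (forall p, fi (f p) = p) -> over A p -> over B p -> A = B.
Proof.
  intros Hf HA HB.
  assert (E : proj1_sig A = proj1_sig B).
  { apply functional_extensionality. intros q. apply propositional_extensionality.
    change (over A q <-> over B q).
    rewrite (over_orbit fi A p q Hf HA), (over_orbit fi B p q Hf HB). tauto. }
  destruct A as [A HA'], B as [B HB']. simpl in E. subst B. f_equal. apply proof_irrelevance.
Qed.

Lemma over_point {f : C2 -> C2} (A : quotient f) : exists p, over A p.
Proof.
  destruct A as [A [a [Wa ->]]]. exists a. unfold over; simpl. split; auto. exists O; auto.
Qed.

Lemma locally_W (p : C2) : W p -> locally p W.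
Proof.
  intros Wp. apply (locally_C2 p). destruct p as [z w].
  destruct (excluded_middle_informative (z = 0)) as [->|Hz].
  - assert (Hw : w <> 0) by (intros ->; now apply Wp).
    exists (Cmod w). split; [now apply Cmod_gt_0|]. intros [x y] _ H; simpl in H. apply W_2.
    intros ->. rewrite Cmod_minus_rev in H. replace (w - 0) with w in H by ring. lra.
  - exists (Cmod z). split; [now apply Cmod_gt_0|]. intros [x y] H _; simpl in H. apply W_1.
    intros ->. rewrite Cmod_minus_rev in H. replace (z - 0) with z in H by ring. lra.
Qed.

Lemma holomorphic_locally (G : C2 -> C2) (p : C2) (V : C2 -> Prop) :
  holomorphic_at G p -> open V -> V (G p) -> locally p (fun q => V (G q)).
Proof.
  intros H HV Hp.
  apply (filterdiff_continuous (K := C_AbsRing) (U := C2_NormedModule) (V := C2_NormedModule)) in H.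
  apply H. now apply HV.
Qed.

Lemma iter_holomorphic (f : C2 -> C2) (n : nat) (p : C2) :
  (forall q, holomorphic_at f q) -> holomorphic_at (Nat.iter n f) p.
Proof.
  intros H. induction n as [|n IH].
  - apply (ex_filterdiff_id (K := C_AbsRing) (V := C2_NormedModule)).
  - apply (holomorphic_comp (Nat.iter n f) f); auto.
Qed.

(** Near each point, an expression of [h] in slices is [G] followed by one fixed power of [f], and
    inherits its holomorphy. Continuity is that of [G], read through the projection. *)
Lemma lift_holomorphic (f fi : C2 -> C2) (h : quotient f -> quotient f) (G : C2 -> C2) :
  biholomorphic_inverse f fi -> is_lift h G ->
  (forall p, W p -> holomorphic_at G p) -> holomorphic h.
Proof.
  intros (Hf & HW & Hh) HL HG.
  assert (Hfi : forall p, fi (f p) = p) by apply Hf. split.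
  - intros O HO p (A & OA & Hp).
    assert (Wp := over_W A p Hp).
    assert (L := holomorphic_locally G p _ (HG p Wp) HO
      (ex_intro _ (h A) (conj OA (HL A p Hp)))).
    assert (LW := locally_W p Wp).
    apply (filter_imp (fun q => W q /\ exists A0 : quotient f, O A0 /\ over A0 (G q))).
    2: now apply filter_and.
    intros q [Wq (B & OB & HB)]. destruct (over_exists f q Wq) as [A' HA'].
    exists A'. split; auto. now rewrite (over_unique fi (h A') B (G q) Hfi (HL A' q HA') HB).
  - intros U V F (HU & HUW & HUs) (HV & HVW & HVs) HF A p q Up Ap Vq Aq.
    assert (Wp := HUW p Up). assert (WG : W (G p)) by (eapply over_W, HL; eauto).
    assert (O := HL A p Ap). apply (over_orbit fi (h A) (G p) q Hfi O) in Aq.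
    (* [E] is the deck transformation taking [G p] to [q]. For [x] near [p] the point [E (G x)]
       remains in [V] and lies over the image of the class of [x], so [chart_expression] forces
       [F x = E (G x)]. *)
    assert (K : exists E : C2 -> C2, (forall x, holomorphic_at E x) /\ q = E (G p) /\
       forall x, W x -> orbit f x (E x)).
    { destruct Aq as [Wq [n [Hn|Hn]]].
      - exists (Nat.iter n f). split; [intros; apply iter_holomorphic; apply Hh|]. split; auto.
        intros x Wx. split; [apply iter_W; auto; apply HW|eauto].
      - exists (Nat.iter n fi). split; [intros; apply iter_holomorphic; apply Hh|]. split.
        + rewrite Hn. symmetry. now apply iter_inverse.
        + intros x Wx. split; [apply iter_W; auto; apply HW|]. exists n. right.
          symmetry. apply iter_inverse. apply Hf. }
    destruct K as (E & HE & -> & HEo).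
    apply (holomorphic_ext (fun x => E (G x))).
    2: { apply holomorphic_comp; auto. }
    apply (filter_imp (fun x => U x /\ V (E (G x)))).
    2: { apply filter_and; [now apply HU|].
         apply (holomorphic_locally (fun x => E (G x))); auto. apply holomorphic_comp; auto. }
    intros x [Ux Vx]. destruct (over_exists f x (HUW x Ux)) as [B HB].
    symmetry. apply (HF B x (E (G x))); auto.
    apply (over_orbit fi (h B) (G x)); auto. apply HEo. eapply over_W, HL; eauto.
Qed.

(** Reduces the theorem to maps of [W]: an automorphism commuting with [f] and intertwining the two
    lifts descends to the required [g]. *)
Lemma conjugate_by_lift (f fi s F G H : C2 -> C2) (sigma std : quotient f -> quotient f) :
  biholomorphic_inverse f fi -> biholomorphic_inverse G H ->
  is_lift sigma F -> is_lift std s ->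
  (forall p, G (f p) = f (G p)) -> (forall p, W p -> F (G p) = G (s p)) ->
  exists g g' : quotient f -> quotient f,
    biholomorphic_pair g g' /\ forall A, sigma A = g (std (g' A)).
Proof.
  intros Hf (HGH & HW & Hh) HF Hs Hc HFG. assert (Hfi : forall p, fi (f p) = p) by apply Hf.
  assert (Hc' : forall p, H (f p) = f (H p)).
  { intros p. rewrite <- (proj2 (HGH p)) at 1. rewrite <- Hc. apply HGH. }
  assert (LG : is_lift (induced (f := f) G) G) by (apply induced_is_lift; auto; intros; now apply HW).
  assert (LH : is_lift (induced (f := f) H) H) by (apply induced_is_lift; auto; intros; now apply HW).
  exists (induced G), (induced H). split; [split; [|split; [|split]]|].
  - apply (lift_holomorphic f fi _ G); auto. intros; apply Hh.
  - apply (lift_holomorphic f fi _ H); auto. intros; apply Hh.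
  - intros A. destruct (over_point A) as [p Hp]. apply (over_unique fi _ _ p Hfi); auto.
    rewrite <- (proj1 (HGH p)). auto.
  - intros A. destruct (over_point A) as [p Hp]. apply (over_unique fi _ _ p Hfi); auto.
    rewrite <- (proj2 (HGH p)). auto.
  - intros A. destruct (over_point A) as [p Hp]. assert (Wp := over_W A p Hp).
    apply (over_unique fi _ _ (F p) Hfi); auto.
    rewrite <- (proj2 (HGH p)). rewrite HFG by now apply HW. auto.
Qed.

(** * Lifts commute with the contraction *)

Definition cont2 (F : C2 -> C2) (p : C2) : Prop :=
  c2cont (fun q => fst (F q)) p /\ c2cont (fun q => snd (F q)) p.

Lemma c2cont_comp (psi : C2 -> C) (F : C2 -> C2) (p : C2) :
  cont2 F p -> c2cont psi (F p) -> c2cont (fun q => psi (F q)) p.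
Proof.
  intros [H1 H2] H eps He. destruct (H eps He) as (e & He' & K).
  destruct (H1 e He') as (d1 & Hd1 & K1). destruct (H2 e He') as (d2 & Hd2 & K2).
  exists (Rmin d1 d2). split; [now apply Rmin_pos|]. intros q Q1 Q2.
  apply K; [apply K1|apply K2]; eapply Rlt_le_trans; eauto using Rmin_l, Rmin_r.
Qed.

Lemma cont2_comp (F G : C2 -> C2) (p : C2) :
  cont2 F p -> cont2 G (F p) -> cont2 (fun q => G (F q)) p.
Proof.
  intros HF [H1 H2]. split.
  - now apply (c2cont_comp (fun q => fst (G q)) F).
  - now apply (c2cont_comp (fun q => snd (G q)) F).
Qed.

Lemma holomorphic_cont2 (F : C2 -> C2) (p : C2) : holomorphic_at F p -> cont2 F p.
Proof. intros H. split; apply hol_c2cont; [now apply hol_comp_fst|now apply hol_comp_snd]. Qed.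

Lemma antiholomorphic_cont2 (F : C2 -> C2) (p : C2) : antiholomorphic_at F p -> cont2 F p.
Proof.
  intros H. apply holomorphic_cont2 in H. destruct H as [H1 H2].
  split; intros eps He; [destruct (H1 eps He) as (d & Hd & K)|destruct (H2 eps He) as (d & Hd & K)];
    exists d; split; auto; intros q Q1 Q2; specialize (K q Q1 Q2); unfold conj2 in K; simpl in K;
    now rewrite <- Cminus_conj, Cmod_conj in K.
Qed.

(** The complement of the axis is dense in [W]. It is used because the exponent of an orbit map is
    read from the logarithm of the second coordinate. *)
Lemma cont2_agree (F G : C2 -> C2) :
  (forall p, W p -> cont2 F p /\ cont2 G p) ->
  (forall p : C2, snd p <> 0 -> F p = G p) -> forall p, W p -> F p = G p.
Proof.
  intros HC E [z w] Wp.
  destruct (excluded_middle_informative (w = 0)) as [->|Hw]; [|now apply E].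
  destruct (HC _ Wp) as [[F1 F2] [G1 G2]].
  assert (S : forall psi : C2 -> C, c2cont psi (z, RtoC 0) -> ccont (fun t => psi (z, t)) 0).
  { intros psi H eps He. destruct (H eps He) as (d & Hd & K). exists d; split; auto.
    intros t Ht. apply K; simpl; auto. replace (z - z) with (RtoC 0) by ring. now rewrite Cmod_0. }
  apply injective_projections.
  - apply (ccont_agree (fun t => fst (F (z, t))) (fun t => fst (G (z, t)))).
    apply (S (fun q => fst (F q))); auto. apply (S (fun q => fst (G q))); auto.
    intros t Ht. now rewrite E.
  - apply (ccont_agree (fun t => snd (F (z, t))) (fun t => snd (G (z, t)))).
    apply (S (fun q => snd (F q))); auto. apply (S (fun q => snd (G q))); auto.
    intros t Ht. now rewrite E.
Qed.

(** Two distinct integer values would force the half-integer [m + 1/2] as an intermediate value. *)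
Lemma continuous_integer_constant (T : R -> R) :
  continuity T -> (forall t, exists k : Z, T t = IZR k) -> forall a b, T a = T b.
Proof.
  intros HT HZ a b. destruct (HZ a) as [m Hm]. destruct (HZ b) as [n Hn].
  destruct (Z.eq_dec m n) as [->|Hmn]; [congruence|]. exfalso.
  assert (K : forall m n a b, (m < n)%Z -> T a = IZR m -> T b = IZR n -> False).
  { clear - HT HZ. intros m n a b Hlt Hm Hn.
    assert (H1 : (IZR m + 1 <= IZR n)%R) by (rewrite <- plus_IZR; apply IZR_le; lia).
    destruct (IVT_gen T a b (IZR m + / 2)%R HT) as [x [_ Hx]].
    { rewrite Hm, Hn, Rmin_left, Rmax_right by lra. lra. }
    destruct (HZ x) as [j Hj]. rewrite Hj in Hx.
    assert (IZR (2 * j) = IZR (2 * m + 1))%R by (rewrite plus_IZR, !mult_IZR; lra).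
    apply eq_IZR in H. lia. }
  destruct (Z.lt_total m n) as [L|[L|L]]; [eauto|tauto|eauto].
Qed.

Lemma tri_holomorphic (a e d : C) (r : nat) (p : C2) : holomorphic_at (tri a e d r) p.
Proof.
  apply (holomorphic_pair (fun q => a * fst q + e * snd q ^ r) (fun q => d * snd q)).
  - apply hol_plus; [apply hol_scal, hol_fst|]. apply hol_scal.
    apply (hol_cdiff_comp snd (fun w => w ^ r)); [apply hol_snd|apply cdiff_pow].
  - apply hol_scal, hol_snd.
Qed.

Lemma iter_snd_tri (a e d : C) (r n : nat) (p : C2) :
  snd (Nat.iter n (tri a e d r) p) = d ^ n * snd p.
Proof.
  induction n as [|n IH]; simpl Nat.iter; [simpl; ring|].
  unfold tri at 1; simpl snd. rewrite IH, Cpow_S. ring.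
Qed.

(* The exponent [n] in [g q = f^n q] is
   [(ln |snd (g q)| - ln |snd q|) / ln |d|], a continuous integer-valued
   function on the connected set [snd q <> 0]. *)
Lemma orbit_exponent_constant (a e d : C) (r : nat) (g : C2 -> C2) :
  a <> 0 -> in_punctured_disc d ->
  (forall q, W q -> cont2 g q) -> (forall q, W q -> orbit (tri a e d r) q (g q)) ->
  exists n, (forall q : C2, snd q <> 0 -> g q = Nat.iter n (tri a e d r) q) \/
    ((1 <= n)%nat /\ forall q : C2, snd q <> 0 -> q = Nat.iter n (tri a e d r) (g q)).
Proof.
  intros Ha Hd Hg Ho. unfold in_punctured_disc in Hd.
  assert (d0 : d <> 0) by (apply Cmod_gt_0; lra).
  set (f := tri a e d r) in *. set (L := ln (Cmod d)).
  assert (HL : (L < 0)%R) by (unfold L; rewrite <- ln_1; apply ln_increasing; lra).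
  set (T := fun q => ((ln (Cmod (snd (g q))) - ln (Cmod (snd q))) / L)%R).
  assert (LnP : forall n x, x <> RtoC 0 -> ln (Cmod (d ^ n * x)) = (INR n * L + ln (Cmod x))%R).
  { intros n x Hx. rewrite Cmod_mult, Cmod_pow, ln_mult, ln_pow; auto; try lra.
    apply pow_lt; lra. now apply Cmod_gt_0. }
  assert (Val : forall q : C2, snd q <> 0 -> snd (g q) <> 0 /\ exists n,
     (g q = Nat.iter n f q /\ T q = INR n) \/ (q = Nat.iter n f (g q) /\ T q = (- INR n)%R)).
  { intros q Hq. assert (Wq : W q) by (destruct q; now apply W_2).
    destruct (Ho q Wq) as [_ [n [Hn|Hn]]]; assert (S := f_equal snd Hn); unfold f in S;
      rewrite iter_snd_tri in S.
    - split. { rewrite S. apply Cmult_neq_0; auto. now apply Cpow_nz. }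
      exists n. left. split; auto. unfold T. rewrite S, LnP by auto. field. lra.
    - assert (G0 : snd (g q) <> 0) by (apply (Cmult_neq_0_inv_r (d ^ n)); now rewrite <- S).
      split; auto. exists n. right. split; auto. unfold T. rewrite S, LnP by auto. field. lra. }
  assert (Con : forall z w, w <> RtoC 0 -> T (z, w) = T (RtoC 0, polar 0 0)).
  { intros z w Hw. assert (Mw : (0 < Cmod w)%R) by now apply Cmod_gt_0.
    assert (RM : RtoC (Cmod w) <> 0) by (apply Cmod_gt_0; rewrite Cmod_R, Rabs_pos_eq; lra).
    destruct (polar_surjective (w / RtoC (Cmod w))) as (th & _ & Hth).
    { rewrite Cmod_div, Cmod_R, Rabs_pos_eq by (auto; lra). field; lra. }
    (* A path from [(0, 1)] to [(z, w)] whose second coordinate runs along a logarithmic spiral and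
       therefore never vanishes. *)
    set (gam := fun t : R => (RtoC t * z, polar (t * ln (Cmod w)) (t * th)) : C2).
    assert (E0 : gam 0%R = (RtoC 0, polar 0 0)).
    { unfold gam. rewrite !Rmult_0_l. f_equal. ring. }
    assert (E1 : gam 1%R = (z, w)).
    { unfold gam. rewrite !Rmult_1_l. f_equal; [ring|].
      transitivity (w / RtoC (Cmod w) * RtoC (Cmod w)); [|field; auto].
      rewrite Hth. unfold polar. rewrite exp_ln, exp_0 by auto.
      apply injective_projections; simpl; ring. }
    assert (G0 : forall t, snd (gam t) <> 0) by (intros; apply polar_neq_0).
    assert (GC : forall t eps, (0 < eps)%R -> exists dl, (0 < dl)%R /\ forall t', (Rabs (t' - t) < dl)%R ->
       (Cmod (fst (gam t') - fst (gam t)) < eps)%R /\ (Cmod (snd (gam t') - snd (gam t)) < eps)%R).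
    { intros t eps He.
      destruct (polar_continuity_2d (t * ln (Cmod w)) (t * th) _ eps He eq_refl) as [e1 H1].
      set (K := (Cmod z + Rabs (ln (Cmod w)) + Rabs th + 1)%R).
      assert (K1 := Cmod_ge_0 z). assert (K2 := Rabs_pos (ln (Cmod w))). assert (K3 := Rabs_pos th).
      assert (HK : (0 < K)%R) by (unfold K; lra).
      set (m := Rmin e1 eps). assert (Hm : (0 < m)%R) by (apply Rmin_pos; auto; apply cond_pos).
      assert (m1 : (m <= e1)%R) by apply Rmin_l. assert (m2 : (m <= eps)%R) by apply Rmin_r.
      exists (m / K)%R. split; [now apply Rdiv_lt_0_compat|]. intros t' Ht.
      apply Rlt_div_r in Ht; auto. assert (0 <= Rabs (t' - t))%R by apply Rabs_pos.
      unfold K in Ht. unfold gam; simpl fst; simpl snd. split.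
      - replace (RtoC t' * z - RtoC t * z) with (RtoC (t' - t) * z) by (rewrite RtoC_minus; ring).
        rewrite Cmod_mult, Cmod_R. nra.
      - apply H1; rewrite <- Rmult_minus_distr_r, Rabs_mult; nra. }
    assert (Q := continuous_integer_constant (fun t => T (gam t))).
    rewrite <- E0, <- E1. apply Q.
    - intros t. unfold T.
      apply (continuity_pt_ext (fun t => (ln (Cmod (snd (g (gam t)))) - t * ln (Cmod w)) * / L)%R).
      { intros s. unfold gam at 3; simpl snd. rewrite Cmod_polar, ln_exp. reflexivity. }
      apply continuity_pt_mult; [|apply continuity_pt_const; now intros ? ?].
      apply continuity_pt_minus.
      2: { apply continuity_pt_mult; [apply derivable_continuous_pt, derivable_pt_id|apply continuity_pt_const; now intros ? ?]. }
      assert (P : (0 < Cmod (snd (g (gam t))))%R) by (apply Cmod_gt_0, Val, G0).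
      apply (continuity_pt_comp (fun t => Cmod (snd (g (gam t)))) ln).
      2: { apply derivable_continuous_pt. exists (/ Cmod (snd (g (gam t))))%R. now apply derivable_pt_lim_ln. }
      intros eps He.
      assert (Wg : W (gam t)) by (destruct (gam t) eqn:Eg; apply W_2; generalize (G0 t); now rewrite Eg).
      destruct (proj2 (Hg _ Wg) eps He) as (dl & Hdl & K).
      destruct (GC t dl Hdl) as (e1 & He1 & K1). exists e1. split; auto.
      intros t' [_ Ht]. destruct (K1 t' Ht) as [A1 A2]. specialize (K _ A1 A2).
      simpl. unfold Rdist. eapply Rle_lt_trans; [|exact K].
      apply Rabs_le. split.
      + assert (X := Cmod_triangle_minus (snd (g (gam t))) (snd (g (gam t')))).
        rewrite Cmod_minus_rev in X. lra.
      + apply Cmod_triangle_minus.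
    - intros t. destruct (Val (gam t) (G0 t)) as [_ [n [[_ ->]|[_ ->]]]].
      + exists (Z.of_nat n). apply INR_IZR_INZ.
      + exists (- Z.of_nat n)%Z. now rewrite opp_IZR, <- INR_IZR_INZ. }
  assert (N0 : snd (RtoC 0, polar 0 0) <> 0) by apply polar_neq_0.
  destruct (Val _ N0) as [_ [n Hn]]. exists n.
  assert (Pos : forall m, (0 <= INR m)%R) by apply pos_INR.
  destruct Hn as [[_ Hn]|[_ Hn]].
  - left. intros [z w] Hw. destruct (Val (z, w) Hw) as [_ [m [[E Hm]|[E Hm]]]]; rewrite Con, Hn in Hm by auto.
    + apply INR_eq in Hm. now subst m.
    + assert (INR m = 0%R) by (generalize (Pos m) (Pos n); lra).
      assert (INR n = 0%R) by (generalize (Pos m) (Pos n); lra).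
      apply (INR_eq m 0) in H. apply (INR_eq n 0) in H0. subst. simpl in *. congruence.
  (* Exponent [0] fits both alternatives and is filed under the first, so that the second one has
     [1 <= n]. *)
  - destruct n as [|n].
    + left. intros [z w] Hw. destruct (Val (z, w) Hw) as [_ [m [[E Hm]|[E Hm]]]]; rewrite Con, Hn in Hm by auto;
        assert (INR m = 0%R) by (simpl in Hm; lra); apply (INR_eq m 0) in H; subst; simpl in *; congruence.
    + right. split; [lia|]. intros [z w] Hw.
      destruct (Val (z, w) Hw) as [_ [m [[E Hm]|[E Hm]]]]; rewrite Con, Hn in Hm by auto.
      * exfalso. specialize (Pos m). assert (0 < INR (S n))%R by (apply lt_0_INR; lia). lra.
      * assert (Q : INR m = INR (S n)) by lra. apply INR_eq in Q. now subst m.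
Qed.

(* Were [F f = f^-n F] with [n >= 1], [F] would exchange the two ends of [W];
   then [z |-> F (z, 1)] would be bounded on large circles by values tending
   to [0], hence zero. *)
Lemma no_end_exchange (a e d : C) (r n : nat) (F : C2 -> C2) :
  in_punctured_disc a -> in_punctured_disc d -> e = 0 \/ a = d ^ r -> (1 <= r)%nat -> (1 <= n)%nat ->
  (forall p, W p -> W (F p) /\ antiholomorphic_at F p) ->
  (forall p, W p -> F p = Nat.iter n (tri a e d r) (F (tri a e d r p))) -> False.
Proof.
  intros Ha Hd He Hr Hn HF Eq. set (f := tri a e d r) in *.
  assert (a0 : a <> 0) by (unfold in_punctured_disc in Ha; apply Cmod_gt_0; lra).
  assert (d0 : d <> 0) by (unfold in_punctured_disc in Hd; apply Cmod_gt_0; lra).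
  assert (It : forall j p, W p -> F p = Nat.iter (n * j) f (F (Nat.iter j f p))).
  { induction j as [|j IH]; intros p Wp.
    - now rewrite Nat.mul_0_r.
    - rewrite Nat.mul_succ_r, Nat.iter_add. simpl. rewrite <- Eq. now apply IH.
      apply iter_W; auto. intros; now apply tri_W. }
  assert (O1 : RtoC 1 <> 0) by (apply Cmod_gt_0; rewrite Cmod_1; lra).
  assert (Tube : forall u, Cmod u = 1%R -> cont2 F (u, RtoC 0)).
  { intros u Hu. apply antiholomorphic_cont2, HF, W_1. apply Cmod_gt_0; lra. }
  destruct (circle_tube (fun p => fst (F p))) as (d1 & M1 & Hd1 & B1); [intros; now apply Tube|].
  destruct (circle_tube (fun p => snd (F p))) as (d2 & M2 & Hd2 & B2); [intros; now apply Tube|].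
  set (M := (Rabs M1 + Rabs M2)%R).
  assert (Q1 := Rabs_pos M1). assert (Q2 := Rabs_pos M2).
  assert (HM : (0 <= M)%R) by (unfold M; lra).
  set (K := (Cmod (e / a) * M ^ r)%R).
  assert (HK : (0 <= K)%R) by (apply Rmult_le_pos; [apply Cmod_ge_0|now apply pow_le]).
  assert (Large : forall eps, (0 < eps)%R -> exists R0, (0 < R0)%R /\ forall z, Cmod z = R0 ->
    (Cmod (fst (F (z, RtoC 1))) <= eps)%R /\ (Cmod (snd (F (z, RtoC 1))) <= eps)%R).
  { intros eps Heps.
    assert (Hd12 : (0 < Rmin d1 d2)%R) by now apply Rmin_pos.
    destruct (tri_reaches_tube a e d r 1 _ Ha Hd He Hd12) as [n1 H1].
    unfold in_punctured_disc in *.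
    destruct (geometric_beats_linear (Cmod a) M K eps) as [n2 H2]; try lra.
    destruct (geometric_beats_linear (Cmod d) M 0 eps) as [n3 H3]; try lra.
    set (j := (n1 + n2 + n3)%nat).
    specialize (H1 j ltac:(unfold j; lia)).
    specialize (H2 (n * j)%nat ltac:(unfold j; nia)). specialize (H3 (n * j)%nat ltac:(unfold j; nia)).
    assert (Pj : (0 < Cmod a ^ j)%R) by (apply pow_lt; lra).
    exists (/ Cmod a ^ j)%R. split; [now apply Rinv_0_lt_compat|]. intros z Hz.
    assert (Hu : Cmod (a ^ j * z) = 1%R) by (rewrite Cmod_mult, Cmod_pow, Hz; field; lra).
    destruct (H1 z) as [T1 T2]. fold f in T1, T2.
    set (p := Nat.iter j f (z, RtoC 1)) in *.
    assert (X1 := B1 _ p Hu (Rlt_le_trans _ _ _ T1 (Rmin_l _ _)) (Rlt_le_trans _ _ _ T2 (Rmin_l _ _))).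
    assert (X2 := B2 _ p Hu (Rlt_le_trans _ _ _ T1 (Rmin_r _ _)) (Rlt_le_trans _ _ _ T2 (Rmin_r _ _))).
    simpl in X1, X2.
    rewrite (It j (z, RtoC 1)) by now apply W_2. fold p.
    destruct (F p) as [x y]. simpl in X1, X2.
    assert (Y1 : (Cmod x <= M)%R) by (generalize (Rle_abs M1); unfold M; lra).
    assert (Y2 : (Cmod y <= M)%R) by (generalize (Rle_abs M2); unfold M; lra).
    unfold f. rewrite tri_iter by auto. simpl fst; simpl snd. split; left.
    - eapply Rle_lt_trans; [|exact H2]. rewrite Cmod_mult, Cmod_pow.
      apply Rmult_le_compat_l; [apply pow_le; lra|].
      eapply Rle_trans; [apply Cmod_triangle|]. apply Rplus_le_compat; auto.
      rewrite !Cmod_mult, Cmod_pow, Cmod_R, Rabs_pos_eq by apply pos_INR.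
      rewrite Rmult_assoc. apply Rmult_le_compat_l; [apply pos_INR|].
      apply Rmult_le_compat_l; [apply Cmod_ge_0|]. apply pow_incr. split; auto. apply Cmod_ge_0.
    - eapply Rle_lt_trans; [|exact H3]. rewrite Cmod_mult, Cmod_pow.
      apply Rmult_le_compat_l; [apply pow_le; lra|]. lra. }
  (* Liouville in the form needed: small circles give the mean [psi (0, 1)], large ones give means
     tending to [0]. *)
  assert (Van : forall psi : C2 -> C, (forall p, W p -> hol psi p) ->
    (forall eps, (0 < eps)%R -> exists R0, (0 < R0)%R /\ forall z, Cmod z = R0 -> (Cmod (psi (z, RtoC 1)) <= eps)%R) ->
    psi (RtoC 0, RtoC 1) = 0).
  { intros psi Hpsi HL.
    assert (D : forall z, cdiff (fun z => psi (z, RtoC 1)) z) by (intros; apply hol_slice_1, Hpsi, W_2; auto).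
    apply (small_circle_limit_zero (fun z => psi (z, RtoC 1)) nil); auto.
    - intros z _. apply cdiff_ccont, D.
    - intros eps Heps. destruct (cdiff_ccont _ _ (D 0) eps Heps) as (s & Hs & H).
      exists (s / 2)%R. split; [lra|]. intros z Hz. left. apply H.
      replace (z - 0) with z by ring. lra. }
  destruct (HF (RtoC 0, RtoC 1)) as [W0 _]; [now apply W_2|]. apply W0.
  assert (C0 : forall c : C, Cconj c = 0 -> c = 0).
  { intros c Hc. apply Cmod_eq_0. rewrite <- Cmod_conj, Hc. apply Cmod_0. }
  apply injective_projections; simpl; apply C0.
  - apply (Van (fun q => fst (conj2 (F q)))).
    + intros p Wp. apply hol_comp_fst. now apply HF.
    + intros eps Heps. destruct (Large eps Heps) as (R0 & HR & H). exists R0; split; auto.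
      intros z Hz. unfold conj2; simpl. rewrite Cmod_conj. now apply H.
  - apply (Van (fun q => snd (conj2 (F q)))).
    + intros p Wp. apply hol_comp_snd. now apply HF.
    + intros eps Heps. destruct (Large eps Heps) as (R0 & HR & H). exists R0; split; auto.
      intros z Hz. unfold conj2; simpl. rewrite Cmod_conj. now apply H.
Qed.

Lemma Cinv_neq_0 (z : C) : z <> 0 -> / z <> 0.
Proof. intros H. apply Cmod_gt_0. rewrite Cmod_inv by auto. now apply Rinv_0_lt_compat, Cmod_gt_0. Qed.

Lemma tri_inverse (a e d : C) (r : nat) :
  a <> 0 -> d <> 0 -> (1 <= r)%nat ->
  biholomorphic_inverse (tri a e d r) (tri (/ a) (- (e / (a * d ^ r))) (/ d) r).
Proof.
  intros Ha Hd Hr. assert (Pd : d ^ r <> 0) by now apply Cpow_nz.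
  split; [|split].
  - intros [z w]. unfold tri; simpl. split; f_equal.
    + rewrite Cpow_mult_l. field; auto.
    + field; auto.
    + rewrite Cpow_mult_l, Cpow_inv by auto. field; auto.
    + field; auto.
  - intros p Wp. split; apply tri_W; auto; auto using Cinv_neq_0.
  - intros p. split; apply tri_holomorphic.
Qed.

Lemma punctured_neq_0 (a : C) : in_punctured_disc a -> a <> 0.
Proof. intros H. apply Cmod_gt_0, H. Qed.

Lemma punctured_pow (d : C) (r : nat) :
  in_punctured_disc d -> (1 <= r)%nat -> in_punctured_disc (d ^ r) /\ (Cmod (d ^ r) <= Cmod d)%R.
Proof.
  intros [H1 H2] Hr. unfold in_punctured_disc. rewrite Cmod_pow. destruct r as [|r]; [lia|]. simpl.
  assert (0 < Cmod d ^ r)%R by now apply pow_lt.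
  assert (Cmod d ^ r <= 1)%R by (rewrite <- (pow1 r); apply pow_incr; lra). repeat split; nra.
Qed.

Lemma punctured_pow_inj (d : C) (m n : nat) : in_punctured_disc d -> d ^ m = d ^ n -> m = n.
Proof.
  intros [H1 H2] E. apply (f_equal Cmod) in E. rewrite !Cmod_pow in E.
  apply (f_equal ln) in E. rewrite !ln_pow in E by auto.
  assert (ln (Cmod d) < 0)%R by (rewrite <- ln_1; apply ln_increasing; lra).
  apply INR_eq. nra.
Qed.

(** [F o f o F] is a fixed power of [f]. A nonnegative exponent satisfies [n * n = 1]; all negative
    exponents are excluded together by [no_end_exchange]. *)
Lemma commutes_with_involution (a e d : C) (r : nat) (F : C2 -> C2) :
  in_punctured_disc a -> in_punctured_disc d -> e = 0 \/ a = d ^ r -> (1 <= r)%nat ->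
  (forall p, W p -> W (F p) /\ antiholomorphic_at F p) -> (forall p, W p -> F (F p) = p) ->
  (forall q, W q -> orbit (tri a e d r) q (F (tri a e d r (F q)))) ->
  forall p, W p -> F (tri a e d r p) = tri a e d r (F p).
Proof.
  intros Ha Hd He Hr HF Inv Ho. set (f := tri a e d r) in *.
  assert (a0 := punctured_neq_0 a Ha). assert (d0 := punctured_neq_0 d Hd).
  assert (fW : forall p, W p -> W (f p)) by (intros; now apply tri_W).
  assert (FW : forall p, W p -> W (F p)) by (intros; now apply HF).
  assert (Cf : forall n p, cont2 (Nat.iter n f) p).
  { intros. apply holomorphic_cont2, iter_holomorphic. intros; apply tri_holomorphic. }
  assert (CF : forall p, W p -> cont2 F p) by (intros; apply antiholomorphic_cont2; now apply HF).
  set (g := fun q => F (f (F q))).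
  assert (Cg : forall q, W q -> cont2 g q).
  { intros q Wq. apply (cont2_comp (fun q => f (F q)) F); auto.
    apply (cont2_comp F f); auto. apply (Cf 1%nat). }
  destruct (orbit_exponent_constant a e d r g a0 Hd Cg Ho) as [n [H|[Hn H]]]; fold f in H.
  - assert (H' : forall q, W q -> g q = Nat.iter n f q) by (apply cont2_agree; auto).
    assert (It : forall k q, W q -> F (Nat.iter k f (F q)) = Nat.iter (n * k) f q).
    { induction k as [|k IH]; intros q Wq.
      - rewrite Nat.mul_0_r. simpl. now apply Inv.
      - rewrite Nat.mul_succ_r, Nat.add_comm, Nat.iter_add, <- IH by auto.
        assert (W1 : W (F (Nat.iter k f (F q)))) by (apply FW, iter_W; auto).
        rewrite <- H' by auto. unfold g. rewrite Inv by (apply iter_W; auto). reflexivity. }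
    assert (W1 : W (RtoC 0, RtoC 1)) by (apply W_2, Cmod_gt_0; rewrite Cmod_1; lra).
    (* For [k = n] the iterate [f^n] is itself [F o f o F], so the two involutions cancel and leave
       [f = f^(n n)]; second coordinates at [(0, 1)] then give [d = d ^ (n * n)]. *)
    assert (E := It n _ W1). rewrite <- H' in E by auto. unfold g in E.
    rewrite !Inv in E by auto.
    assert (S := f_equal snd E). unfold f in S. rewrite iter_snd_tri in S. simpl in S.
    assert (Q : (1 = n * n)%nat).
    { apply (punctured_pow_inj d); auto. rewrite Cpow_1_r.
      replace d with (d * 1) at 1 by ring. rewrite S. ring. }
    assert (n = 1%nat) by nia. subst n. intros p Wp.
    assert (K := H' (F p) (FW p Wp)). unfold g in K. rewrite Inv in K by auto. exact K.
  - exfalso. apply (no_end_exchange a e d r n F); auto. fold f. intros p Wp.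
    assert (K : forall q, W q -> q = Nat.iter n f (g q)).
    { apply cont2_agree; auto. intros q Wq. split.
      - apply (holomorphic_cont2 (fun q => q)). apply (ex_filterdiff_id (K := C_AbsRing) (V := C2_NormedModule)).
      - apply (cont2_comp g (Nat.iter n f)); auto. }
    rewrite (K (F p)) at 1 by auto. unfold g. now rewrite Inv.
Qed.

Lemma lift_orbit (f fi F : C2 -> C2) (sigma : quotient f -> quotient f) :
  biholomorphic_inverse f fi -> is_lift sigma F ->
  (forall p, W p -> W (F p)) -> (forall p, W p -> F (F p) = p) ->
  forall q, W q -> orbit f q (F (f (F q))).
Proof.
  intros (Hf & HW & _) HL FW Inv q Wq.
  assert (Hfi : forall p, fi (f p) = p) by apply Hf.
  destruct (over_exists f (F q) (FW q Wq)) as [A HA].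
  assert (HA' : over A (f (F q))).
  { apply (over_orbit fi A (F q)); auto. split; [apply HW; auto|]. exists 1%nat. now left. }
  apply HL in HA, HA'. rewrite Inv in HA by auto. now apply (over_orbit fi (sigma A) q).
Qed.

(** * Explicit instances of Hilbert's theorem 90 *)

(** The averaged element [1 + Cconj D] is a solution unless it vanishes, that is unless [D = -1],
    where [Ci] is one. *)
Lemma hilbert_90_unit (D : C) :
  D * Cconj D = 1 -> exists D', D' <> RtoC 0 /\ D * D' = Cconj D'.
Proof.
  intros H. destruct (excluded_middle_informative (D = - (1))) as [->|N].
  - exists Ci. split.
    + apply Cmod_gt_0. rewrite Cmod_Ci. lra.
    + apply injective_projections; simpl; ring.
  - exists (1 + Cconj D). split.
    + intros E. apply N. rewrite <- (Cconj_conj D).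
      replace (Cconj D) with (1 + Cconj D - 1) by ring. rewrite E.
      apply injective_projections; simpl; ring.
    + rewrite Cplus_conj, Cconj_conj.
      replace (D * (1 + Cconj D)) with (D + D * Cconj D) by ring. rewrite H.
      apply injective_projections; simpl; ring.
Qed.

Lemma Cconj_R (x : R) : Cconj (RtoC x) = RtoC x.
Proof. apply injective_projections; simpl; ring. Qed.

Lemma RtoC_neq_0 (x : R) : x <> 0%R -> RtoC x <> 0.
Proof. intros H E. apply H. now injection E. Qed.

(** The involution identity at [(1, 0)] and [(0, 1)] yields the cocycle relations: [A] and [D] have
    modulus one and [A * Cconj B + B * Cconj D ^ m = 0]. The two implications in the conclusion
    ensure that the conjugating map commutes with the contraction whenever [F] does. *)
Lemma triangular_descent (F : C2 -> C2) (A B D : C) (m : nat) :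
  (1 <= m)%nat -> (forall p, W p -> W (F p)) -> (forall p, W p -> F (F p) = p) ->
  (forall p, W p -> F p = conj2 (tri A B D m p)) ->
  exists A' B' D' : C, A' <> 0 /\ D' <> 0 /\ (A = D ^ m -> A' = D' ^ m) /\ (B = 0 -> B' = 0) /\
    forall p, W p -> F (tri A' B' D' m p) = tri A' B' D' m (conj2 p).
Proof.
  intros Hm FW Inv HF.
  assert (P0 : RtoC 0 ^ m = 0) by (destruct m; [lia|]; rewrite Cpow_S; ring).
  assert (O1 : RtoC 1 <> 0) by (apply RtoC_neq_0; lra).
  assert (E1 := Inv (RtoC 1, RtoC 0) (W_1 _ _ O1)).
  assert (E2 := Inv (RtoC 0, RtoC 1) (W_2 _ _ O1)).
  rewrite (HF (F (RtoC 1, RtoC 0))) in E1 by apply FW, W_1, O1. rewrite HF in E1 by apply W_1, O1.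
  rewrite (HF (F (RtoC 0, RtoC 1))) in E2 by apply FW, W_2, O1. rewrite HF in E2 by apply W_2, O1.
  unfold conj2, tri in E1, E2; simpl in E1, E2.
  assert (X1 := f_equal (fun p => Cconj (fst p)) E1). simpl in X1.
  assert (X2 := f_equal (fun p => Cconj (fst p)) E2). simpl in X2.
  assert (X3 := f_equal (fun p => Cconj (snd p)) E2). simpl in X3.
  rewrite P0 in X1. rewrite Cpow_1_l in X2. rewrite !Cconj_conj in X1, X2, X3.
  replace (D * 0) with (RtoC 0) in X1 by ring.
  replace (A * 1 + B * 0) with A in X1 by ring. rewrite Cconj_R in X1. rewrite P0 in X1.
  replace (A * 0 + B * 1) with B in X2 by ring.
  replace (D * 1) with D in X2, X3 by ring. rewrite !Cconj_R in *.
  replace (A * Cconj A + B * 0) with (A * Cconj A) in X1 by ring.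
  destruct (hilbert_90_unit D X3) as (D' & D'0 & HD').
  (* If [A = D ^ m], the solution must be [D' ^ m] rather than an independent choice, in order to
     respect the coupling [e] of the contraction. *)
  assert (HA : exists A' : C, A' <> 0 /\ A * A' = Cconj A' /\ (A = D ^ m -> A' = D' ^ m)).
  { destruct (excluded_middle_informative (A = D ^ m)) as [E|E].
    - exists (D' ^ m). split; [now apply Cpow_nz|]. split; auto.
      rewrite E, <- Cpow_mult_l, HD', <- Cpow_conj. reflexivity.
    - destruct (hilbert_90_unit A X1) as (A' & A'0 & HA'). exists A'. repeat split; tauto. }
  destruct HA as (A' & A'0 & HA' & HAm).
  (* A fixed point is sought for the affine antilinear map sending [x] to the conjugate of
     [A * x + B * D' ^ m]. It is an involution by the cocycle relations, and [B'] is the midpoint of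
     [0] and its image. *)
  set (B' := - (Cconj A * B * D' ^ m) / 2).
  assert (T2 : RtoC 2 <> 0) by (apply RtoC_neq_0; lra).
  assert (HB' : A * B' + B * D' ^ m = Cconj B').
  { assert (Y : Cconj B' = - (A * Cconj B * (D * D') ^ m) / 2).
    { unfold B', Cdiv. rewrite Cmult_conj, Copp_conj, !Cmult_conj, Cpow_conj, Cconj_conj, HD', Cinv_conj, Cconj_R by auto.
      reflexivity. }
    rewrite Y, Cpow_mult_l.
    assert (Z : A * Cconj B * D ^ m = - B).
    { assert (P : Cconj D ^ m * D ^ m = 1).
      { rewrite <- Cpow_mult_l. rewrite (Cmult_comm (Cconj D)), X3. apply Cpow_1_l. }
      replace (A * Cconj B) with (- (B * Cconj D ^ m)).
      2: { replace (A * Cconj B) with (A * Cconj B + B * Cconj D ^ m - B * Cconj D ^ m) by ring. rewrite X2; ring. }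
      replace (- (B * Cconj D ^ m) * D ^ m) with (- B * (Cconj D ^ m * D ^ m)) by ring. rewrite P; ring. }
    replace (- (A * Cconj B * (D ^ m * D' ^ m)) / 2) with (- (A * Cconj B * D ^ m) * D' ^ m / 2) by (field; auto).
    rewrite Z. unfold B'.
    replace (A * (- (Cconj A * B * D' ^ m) / 2) + B * D' ^ m) with
      (- (A * Cconj A) * B * D' ^ m / 2 + B * D' ^ m) by (field; auto). rewrite X1. field; auto. }
  exists A', B', D'. split; auto. split; auto. split; auto. split.
  { intros ->. unfold B'. field; auto. }
  intros [z w] Wp. rewrite HF by now apply tri_W.
  unfold tri, conj2; simpl.
  replace (A * (A' * z + B' * w ^ m) + B * (D' * w) ^ m) with
    ((A * A') * z + (A * B' + B * D' ^ m) * w ^ m) by (rewrite Cpow_mult_l; ring).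
  replace (D * (D' * w)) with ((D * D') * w) by ring. rewrite HA', HB', HD'.
  now rewrite Cplus_conj, !Cmult_conj, !Cconj_conj, Cpow_conj.
Qed.

Lemma tri_commute (a e d A B D : C) (r m : nat) (p : C2) :
  e = 0 \/ A = D ^ r -> B = 0 \/ a = d ^ m ->
  tri A B D m (tri a e d r p) = tri a e d r (tri A B D m p).
Proof.
  intros He HB. unfold tri; simpl. rewrite !Cpow_mult_l. f_equal; [|ring].
  replace (A * (a * fst p + e * snd p ^ r) + B * (d ^ m * snd p ^ m)) with
    (A * a * fst p + e * A * snd p ^ r + B * d ^ m * snd p ^ m) by ring.
  replace (a * (A * fst p + B * snd p ^ m) + e * (D ^ r * snd p ^ r)) with
    (A * a * fst p + e * D ^ r * snd p ^ r + B * a * snd p ^ m) by ring.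
  destruct He as [->| ->], HB as [->| ->]; ring.
Qed.

Lemma conjugate_triangular (f F s : C2 -> C2) (a e d A B D : C) (r m : nat)
  (sigma std : quotient f -> quotient f) :
  f = tri a e d r -> a <> 0 -> d <> 0 -> (1 <= r)%nat -> (1 <= m)%nat ->
  is_lift sigma F -> is_lift std conj2 ->
  (forall p, W p -> W (F p)) -> (forall p, W p -> F (F p) = p) ->
  (forall p, W p -> F p = conj2 (tri A B D m p)) ->
  e = 0 \/ (A = D ^ m /\ m = r) -> B = 0 \/ a = d ^ m ->
  exists g g' : quotient f -> quotient f,
    biholomorphic_pair g g' /\ forall A, sigma A = g (std (g' A)).
Proof.
  intros -> a0 d0 Hr Hm HL HS FW Inv HF He HB.
  destruct (triangular_descent F A B D m) as (A' & B' & D' & A'0 & D'0 & HA & HB' & HG); auto.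
  apply (conjugate_by_lift _ _ conj2 F _ _ sigma std (tri_inverse a e d r a0 d0 Hr)
    (tri_inverse A' B' D' m A'0 D'0 Hm)); auto.
  intros p. apply tri_commute.
  - destruct He as [|[H <-]]; auto.
  - destruct HB as [HB|HB]; auto.
Qed.

Definition swap (p : C2) : C2 := (snd p, fst p).

Lemma swap_W (p : C2) : W p -> W (swap p).
Proof. intros Wp E. apply Wp. destruct p; unfold swap in E; simpl in E. now injection E as -> ->. Qed.

Lemma swap_holomorphic (p : C2) : holomorphic_at swap p.
Proof. apply (holomorphic_pair snd fst); [apply hol_snd|apply hol_fst]. Qed.

Lemma swap_swap (p : C2) : swap (swap p) = p.
Proof. now destruct p. Qed.

Lemma swap_conj2 (p : C2) : swap (conj2 p) = conj2 (swap p).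
Proof. now destruct p. Qed.

Lemma conjugate_swap_inverse (G H : C2 -> C2) :
  biholomorphic_inverse G H ->
  biholomorphic_inverse (fun p => swap (G (swap p))) (fun p => swap (H (swap p))).
Proof.
  intros (E & HW & Hh). split; [|split].
  - intros p. rewrite !swap_swap. destruct (E (swap p)) as [-> ->]. now rewrite swap_swap.
  - intros p Wp. split; apply swap_W, HW, swap_W, Wp.
  - assert (K : forall X : C2 -> C2, (forall p, holomorphic_at X p) ->
       forall p, holomorphic_at (fun p => swap (X (swap p))) p).
    { intros X HX p. apply (holomorphic_comp (fun p => X (swap p)) swap); [|apply swap_holomorphic].
      apply (holomorphic_comp swap X); auto. apply swap_holomorphic. }
    intros p. split; apply K; apply Hh.
Qed.

(** Covers the resonance [d = a ^ m], in which the second coordinate of the lift may contain a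
    multiple of the conjugate of [z ^ m]. *)
Lemma conjugate_triangular_swapped (f F : C2 -> C2) (a d A B D : C) (m : nat)
  (sigma std : quotient f -> quotient f) :
  f = tri a 0 d 1 -> a <> 0 -> d <> 0 -> (1 <= m)%nat ->
  is_lift sigma F -> is_lift std conj2 ->
  (forall p, W p -> W (F p)) -> (forall p, W p -> F (F p) = p) ->
  (forall p, W p -> F p = conj2 (swap (tri D B A m (swap p)))) ->
  B = 0 \/ d = a ^ m ->
  exists g g' : quotient f -> quotient f,
    biholomorphic_pair g g' /\ forall A, sigma A = g (std (g' A)).
Proof.
  intros -> a0 d0 Hm HL HS FW Inv HF HB.
  destruct (triangular_descent (fun p => swap (F (swap p))) D B A m) as (D' & B' & A' & D'0 & A'0 & _ & HB' & HG); auto.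
  - intros p Wp. apply swap_W, FW, swap_W, Wp.
  - intros p Wp. rewrite swap_swap, Inv by now apply swap_W. apply swap_swap.
  - intros p Wp. rewrite HF by now apply swap_W. now rewrite swap_conj2, !swap_swap.
  - apply (conjugate_by_lift _ _ conj2 F _ _ sigma std (tri_inverse a 0 d 1 a0 d0 (le_n 1))
      (conjugate_swap_inverse _ _ (tri_inverse D' B' A' m D'0 A'0 Hm))); auto.
    + intros p.
      assert (Es : forall q, tri a 0 d 1 q = swap (tri d 0 a 1 (swap q))).
      { intros [z w]. unfold tri, swap; simpl. f_equal; ring. }
      rewrite !Es, !swap_swap. f_equal. apply tri_commute; auto.
      destruct HB; auto.
    + intros p Wp. assert (K := HG (swap p) (swap_W p Wp)).
      rewrite <- (swap_swap (F _)), K. now rewrite swap_conj2.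
Qed.

Definition lin (a b c d : C) (p : C2) : C2 := (a * fst p + b * snd p, c * fst p + d * snd p).

Lemma lin_inverse (a b c d : C) :
  let det := a * d - b * c in det <> 0 ->
  biholomorphic_inverse (lin a b c d) (lin (d / det) (- b / det) (- c / det) (a / det)).
Proof.
  intros det Hdet.
  assert (E : forall p, lin (d / det) (- b / det) (- c / det) (a / det) (lin a b c d p) = p /\
     lin a b c d (lin (d / det) (- b / det) (- c / det) (a / det) p) = p).
  { intros [z w]. unfold lin; simpl. split; f_equal; unfold det; field; exact Hdet. }
  assert (Z : forall a b c d, lin a b c d (RtoC 0, RtoC 0) = (RtoC 0, RtoC 0)).
  { intros. unfold lin; simpl. f_equal; ring. }
  assert (Hh : forall a b c d p, holomorphic_at (lin a b c d) p).
  { intros. apply (holomorphic_pair (fun q => _ * fst q + _ * snd q) (fun q => _ * fst q + _ * snd q));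
      apply hol_plus; apply hol_scal; [apply hol_fst|apply hol_snd|apply hol_fst|apply hol_snd]. }
  split; [exact E|]. split; [|intros; auto].
  intros p Wp. split; intros Q; apply Wp; destruct (E p) as [E1 E2].
  - rewrite <- E1, Q. apply Z.
  - rewrite <- E2, Q. apply Z.
Qed.

(* [t Id + conj t * conj M] conjugates [M o conj] to [conj] whenever it is
   invertible; its determinant is a nonzero quadratic form in [t, conj t]
   and cannot vanish for all of [t = 1, i, 1 + i]. *)
Lemma conjugate_linear (f F : C2 -> C2) (a A B C0 D : C)
  (sigma std : quotient f -> quotient f) :
  f = tri a 0 a 1 -> a <> 0 ->
  is_lift sigma F -> is_lift std conj2 ->
  (forall p, W p -> W (F p)) -> (forall p, W p -> F (F p) = p) ->
  (forall p, W p -> F p = conj2 (lin A B C0 D p)) ->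
  exists g g' : quotient f -> quotient f,
    biholomorphic_pair g g' /\ forall A, sigma A = g (std (g' A)).
Proof.
  intros -> a0 HL HS FW Inv HF.
  assert (O1 : RtoC 1 <> 0) by (apply RtoC_neq_0; lra).
  assert (E1 := Inv (RtoC 1, RtoC 0) (W_1 _ _ O1)).
  assert (E2 := Inv (RtoC 0, RtoC 1) (W_2 _ _ O1)).
  rewrite (HF (F (RtoC 1, RtoC 0))) in E1 by apply FW, W_1, O1. rewrite HF in E1 by apply W_1, O1.
  rewrite (HF (F (RtoC 0, RtoC 1))) in E2 by apply FW, W_2, O1. rewrite HF in E2 by apply W_2, O1.
  unfold conj2, lin in E1, E2; simpl in E1, E2.
  replace (A * 1 + B * 0) with A in E1 by ring. replace (C0 * 1 + D * 0) with C0 in E1 by ring.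
  replace (A * 0 + B * 1) with B in E2 by ring. replace (C0 * 0 + D * 1) with D in E2 by ring.
  assert (X1 := f_equal (fun p => Cconj (fst p)) E1). assert (X2 := f_equal (fun p => Cconj (snd p)) E1).
  assert (X3 := f_equal (fun p => Cconj (fst p)) E2). assert (X4 := f_equal (fun p => Cconj (snd p)) E2).
  simpl in X1, X2, X3, X4. rewrite !Cconj_conj, !Cconj_R in X1, X2, X3, X4.
  set (det := fun t => (t + Cconj t * Cconj A) * (t + Cconj t * Cconj D) - (Cconj t * Cconj B) * (Cconj t * Cconj C0)).
  assert (Ht : exists t, det t <> 0).
  { destruct (excluded_middle_informative (det (RtoC 1) = 0)) as [T1|]; [|eauto].
    destruct (excluded_middle_informative (det Ci = 0)) as [T2|]; [|eauto].
    exists (1 + Ci). intros T3. unfold det in *.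
    assert (CI : Cconj Ci = - Ci) by (apply injective_projections; simpl; ring).
    assert (CI2 : Ci * Ci = - (1)) by (apply injective_projections; simpl; ring).
    rewrite Cplus_conj in T3. rewrite !Cconj_R in *. rewrite !CI in *.
    (* Trace and determinant of the conjugate matrix: [det t] is
       [t^2 + t * Cconj t * T + (Cconj t)^2 * Q]. Zeros at [1] and [Ci] give [T = 0] and [Q = -1],
       and the third value is then [4 * Ci]. *)
    set (T := Cconj A + Cconj D) in *. set (Q := Cconj A * Cconj D - Cconj B * Cconj C0) in *.
    assert (U1 : 1 + T + Q = 0) by (rewrite <- T1; unfold T, Q; ring).
    assert (U2 : (Ci * Ci) * (1 - T + Q) = 0) by (rewrite <- T2; unfold T, Q; ring).
    assert (U3 : (1 + 2 * Ci + Ci * Ci) + (1 - Ci * Ci) * T + (1 - 2 * Ci + Ci * Ci) * Q = 0)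
      by (rewrite <- T3; unfold T, Q; ring).
    rewrite CI2 in U2, U3.
    assert (T0 : T = 0).
    { replace T with (((1 + T + Q) + - (1) * (1 - T + Q)) / 2) by (field; apply RtoC_neq_0; lra).
      rewrite U1, U2. unfold Cdiv. ring. }
    rewrite T0 in U1, U3.
    assert (Q1 : Q = - (1)) by (replace Q with (1 + 0 + Q - 1) by ring; rewrite U1; ring).
    rewrite Q1 in U3. assert (V := f_equal Im U3). simpl in V. lra. }
  destruct Ht as [t Ht].
  apply (conjugate_by_lift _ _ conj2 F _ _ sigma std (tri_inverse a 0 a 1 a0 a0 (le_n 1))
    (lin_inverse (t + Cconj t * Cconj A) (Cconj t * Cconj B) (Cconj t * Cconj C0) (t + Cconj t * Cconj D) Ht)); auto.
  - intros [z w]. unfold lin, tri; simpl. f_equal; ring.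
  - intros [z w] Wp. rewrite HF by now apply lin_inverse.
    unfold lin, conj2; simpl.
    assert (K : forall u v, Cconj u = v -> u = Cconj v) by (intros u v <-; now rewrite Cconj_conj).
    f_equal; symmetry; apply K;
      rewrite ?Cplus_conj, ?Cmult_conj, ?Cplus_conj, ?Cmult_conj, ?Cconj_conj.
    + replace (A * ((t + Cconj t * Cconj A) * z + Cconj t * Cconj B * w) + B * (Cconj t * Cconj C0 * z + (t + Cconj t * Cconj D) * w))
      with (A * t * z + B * t * w + Cconj t * ((A * Cconj A + B * Cconj C0) * z + (A * Cconj B + B * Cconj D) * w)) by ring.
      rewrite X1, X3. ring.
    + replace (C0 * ((t + Cconj t * Cconj A) * z + Cconj t * Cconj B * w) + D * (Cconj t * Cconj C0 * z + (t + Cconj t * Cconj D) * w))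
      with (C0 * t * z + D * t * w + Cconj t * ((C0 * Cconj A + D * Cconj C0) * z + (C0 * Cconj B + D * Cconj D) * w)) by ring.
      rewrite X2, X4. ring.
Qed.

(** * Normal forms and conclusion *)

Definition antiholomorphic_involution_W (F : C2 -> C2) : Prop :=
  (forall p, W p -> W (F p) /\ antiholomorphic_at F p) /\ (forall p, W p -> F (F p) = p).

Lemma lift_commutes (f F : C2 -> C2) (a e d : C) (r : nat) (sigma : quotient f -> quotient f) :
  f = tri a e d r ->
  in_punctured_disc a -> in_punctured_disc d -> e = 0 \/ a = d ^ r -> (1 <= r)%nat ->
  antiholomorphic_involution_W F -> is_lift sigma F ->
  forall p, W p -> F (f p) = f (F p).
Proof.
  intros -> Ha Hd He Hr [HF Inv] HL. apply commutes_with_involution; auto.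
  apply (lift_orbit _ _ F sigma (tri_inverse a e d r (punctured_neq_0 a Ha) (punctured_neq_0 d Hd) Hr)); auto.
  intros; now apply HF.
Qed.

Lemma conj_component_hol (F : C2 -> C2) (p : C2) : antiholomorphic_at F p ->
  hol (fun q => Cconj (fst (F q))) p /\ hol (fun q => Cconj (snd (F q))) p.
Proof.
  intros H. split; [apply (hol_comp_fst (fun q => conj2 (F q)))|apply (hol_comp_snd (fun q => conj2 (F q)))]; auto.
Qed.

Lemma eq_conj2 (p q : C2) : Cconj (fst q) = fst p -> Cconj (snd q) = snd p -> q = conj2 p.
Proof. unfold conj2. intros <- <-. rewrite !Cconj_conj. apply surjective_pairing. Qed.

Lemma conj_component_equations (F : C2 -> C2) (a e d : C) (r : nat) :
  Cconj a = a -> Cconj e = e -> Cconj d = d ->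
  (forall p, W p -> F (tri a e d r p) = tri a e d r (F p)) ->
  forall p, W p ->
    Cconj (fst (F (tri a e d r p))) = a * Cconj (fst (F p)) + e * Cconj (snd (F p)) ^ r /\
    Cconj (snd (F (tri a e d r p))) = d * Cconj (snd (F p)).
Proof.
  intros Ha He Hd Hc p Wp. rewrite Hc by auto. unfold tri; simpl.
  now rewrite Cplus_conj, !Cmult_conj, Cpow_conj, Ha, He, Hd.
Qed.

(** The term in [z] dies by [b * e = 0] if [e <> 0], and by [d <> d ^ r] if [2 <= r]. In class [IV]
    neither holds, and both variables mix. *)
Lemma semi_invariant_weight_1 (psi : C2 -> C) (e d : C) (r : nat) :
  in_punctured_disc d -> (1 <= r)%nat -> e <> 0 \/ (2 <= r)%nat ->
  (forall p, W p -> hol psi p) ->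
  (forall p, W p -> psi (tri (d ^ r) e d r p) = d * psi p) ->
  exists k, forall p, W p -> psi p = k * snd p.
Proof.
  intros Hd Hr He Hpsi Eq. destruct (punctured_pow d r Hd Hr) as [Ha Hle].
  destruct (semi_invariant psi (d ^ r) e d d r) as (b & k & m & Hm & Hb & Hbe & Hk & E); auto.
  exists k.
  assert (b0 : b = 0).
  { destruct He as [He|He].
    - destruct (excluded_middle_informative (b = 0)) as [|N]; auto.
      exfalso. now apply (Cmult_neq_0 b e N He).
    - destruct Hb as [|Hb]; auto. exfalso. rewrite <- (Cpow_1_r d) in Hb at 1.
      apply punctured_pow_inj in Hb; auto. lia. }
  intros p Wp. rewrite E, b0 by auto. destruct Hk as [->|Hk]; [ring|].
  rewrite <- (Cpow_1_r d) in Hk at 1. apply punctured_pow_inj in Hk; auto. subst m. ring.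
Qed.

Lemma semi_invariant_weight_r (psi : C2 -> C) (e d : C) (r : nat) :
  in_punctured_disc d -> (1 <= r)%nat ->
  (forall p, W p -> hol psi p) ->
  (forall p, W p -> psi (tri (d ^ r) e d r p) = d ^ r * psi p) ->
  exists b k : C, b * e = 0 /\ forall p, W p -> psi p = b * fst p + k * snd p ^ r.
Proof.
  intros Hd Hr Hpsi Eq. destruct (punctured_pow d r Hd Hr) as [Ha _].
  destruct (semi_invariant psi (d ^ r) e d (d ^ r) r) as (b & k & m & Hm & Hb & Hbe & Hk & E); auto.
  { lra. }
  exists b, k. split; auto. intros p Wp. rewrite E by auto. destruct Hk as [->|Hk]; [ring|].
  apply punctured_pow_inj in Hk; auto. now subst m.
Qed.

(** Class [IV]: every linear form is a semi-invariant of weight [a], so the lift involves a full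
    matrix and is left to [conjugate_linear]. *)
Lemma conjugate_scalar (f F : C2 -> C2) (sigma std : quotient f -> quotient f) (a : C) :
  f = tri a 0 a 1 -> in_punctured_disc a -> Cconj a = a ->
  antiholomorphic_involution_W F -> is_lift sigma F -> is_lift std conj2 ->
  exists g g' : quotient f -> quotient f,
    biholomorphic_pair g g' /\ forall A, sigma A = g (std (g' A)).
Proof.
  intros Ef Ha Ra HF HL HS.
  assert (Hc := lift_commutes f F a 0 a 1 sigma Ef Ha Ha (or_introl eq_refl) (le_n 1) HF HL).
  rewrite Ef in Hc. destruct HF as [HF Inv].
  assert (Eq := conj_component_equations F a 0 a 1 Ra (Cconj_R 0) Ra Hc).
  destruct (semi_invariant_weight_r (fun p => Cconj (fst (F p))) 0 a 1 Ha (le_n 1))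
    as (A & B & _ & E1).
  { intros p Wp. apply (conj_component_hol F p (proj2 (HF p Wp))). }
  { intros p Wp. rewrite Cpow_1_r. rewrite (proj1 (Eq p Wp)). ring. }
  destruct (semi_invariant_weight_r (fun p => Cconj (snd (F p))) 0 a 1 Ha (le_n 1))
    as (C0 & D & _ & E2).
  { intros p Wp. apply (conj_component_hol F p (proj2 (HF p Wp))). }
  { intros p Wp. rewrite Cpow_1_r. now rewrite (proj2 (Eq p Wp)). }
  apply (conjugate_linear f F a A B C0 D); auto.
  - now apply punctured_neq_0.
  - intros; now apply HF.
  - intros p Wp. apply eq_conj2; unfold tri, lin, swap; simpl.
    + rewrite E1 by auto. now rewrite Cpow_1_r.
    + rewrite E2 by auto. now rewrite Cpow_1_r.
Qed.

(** Treats [III] ([e = 0], [2 <= r]), [IIa] ([e = 1], [2 <= r]) and [IIb] ([e = 1], [r = 1])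
    together. *)
Lemma conjugate_resonant (f F : C2 -> C2) (sigma std : quotient f -> quotient f) (e d : C) (r : nat) :
  f = tri (d ^ r) e d r -> in_punctured_disc d -> (1 <= r)%nat ->
  e = 1 \/ (e = 0 /\ (2 <= r)%nat) -> Cconj d = d ->
  antiholomorphic_involution_W F -> is_lift sigma F -> is_lift std conj2 ->
  exists g g' : quotient f -> quotient f,
    biholomorphic_pair g g' /\ forall A, sigma A = g (std (g' A)).
Proof.
  intros Ef Hd Hr He Rd HF HL HS.
  destruct (punctured_pow d r Hd Hr) as [Ha _].
  assert (O1 : RtoC 1 <> 0) by (apply RtoC_neq_0; lra).
  assert (Hc := lift_commutes f F _ e d r sigma Ef Ha Hd (or_intror eq_refl) Hr HF HL).
  rewrite Ef in Hc. destruct HF as [HF Inv].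
  assert (Eq := conj_component_equations F (d ^ r) e d r ltac:(now rewrite Cpow_conj, Rd)
    ltac:(destruct He as [->|[-> _]]; apply Cconj_R) Rd Hc).
  assert (Hh : forall p, W p -> hol (fun q => Cconj (fst (F q))) p /\ hol (fun q => Cconj (snd (F q))) p).
  { intros p Wp. apply (conj_component_hol F p (proj2 (HF p Wp))). }
  destruct (semi_invariant_weight_1 (fun p => Cconj (snd (F p))) e d r Hd Hr) as [D E2].
  { destruct He as [->|[_ He]]; auto. }
  { intros p Wp; apply (Hh p Wp). }
  { intros p Wp. now rewrite (proj2 (Eq p Wp)). }
  assert (E1 : exists A B, (e = 0 \/ A = D ^ r) /\ forall p, W p -> Cconj (fst (F p)) = A * fst p + B * snd p ^ r).
  { destruct He as [->|[-> He]].
    (* Under [f] the conjugated first component picks up the extra term [(D * w) ^ r], and so does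
       [D ^ r * z]; their difference is semi-invariant. Then [b * e = 0] with [e = 1] leaves exactly
       [A = D ^ r]. *)
    - destruct (semi_invariant_weight_r (fun p => Cconj (fst (F p)) + - D ^ r * fst p) 1 d r Hd Hr)
        as (b & k & Hb & E).
      + intros p Wp. apply hol_plus; [apply (Hh p Wp)|]. apply hol_scal, hol_fst.
      + intros p Wp. rewrite (proj1 (Eq p Wp)), E2 by auto.
        unfold tri; simpl. rewrite Cpow_mult_l. ring.
      + exists (D ^ r), k. split; auto. intros p Wp.
        replace (Cconj (fst (F p))) with (Cconj (fst (F p)) + - D ^ r * fst p + D ^ r * fst p) by ring.
        rewrite E by auto. rewrite Cmult_1_r in Hb. rewrite Hb. ring.
    - destruct (semi_invariant_weight_r (fun p => Cconj (fst (F p))) 0 d r Hd Hr) as (b & k & _ & E).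
      + intros p Wp; apply (Hh p Wp).
      + intros p Wp. rewrite (proj1 (Eq p Wp)). ring.
      + exists b, k. auto. }
  destruct E1 as (A & B & HA & E1).
  apply (conjugate_triangular f F conj2 (d ^ r) e d A B D r r); auto.
  - now apply punctured_neq_0.
  - now apply punctured_neq_0.
  - intros; now apply HF.
  - intros p Wp. apply eq_conj2; unfold tri; simpl; [now rewrite E1|now rewrite E2].
  - destruct HA; auto.
Qed.

(* [alpha = delta ^ r] is excluded but [delta = alpha ^ m] is not, hence the
   case distinction on which of the two eigenvalues is larger. *)
Lemma conjugate_nonresonant (f F : C2 -> C2) (sigma std : quotient f -> quotient f) (a d : C) :
  f = tri a 0 d 1 -> in_punctured_disc a -> in_punctured_disc d ->
  (forall r : nat, a <> d ^ r) -> Cconj a = a -> Cconj d = d ->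
  antiholomorphic_involution_W F -> is_lift sigma F -> is_lift std conj2 ->
  exists g g' : quotient f -> quotient f,
    biholomorphic_pair g g' /\ forall A, sigma A = g (std (g' A)).
Proof.
  intros Ef Ha Hd Had Ra Rd HF HL HS.
  assert (Hc := lift_commutes f F a 0 d 1 sigma Ef Ha Hd (or_introl eq_refl) (le_n 1) HF HL).
  rewrite Ef in Hc. destruct HF as [HF Inv].
  assert (Eq := conj_component_equations F a 0 d 1 Ra (Cconj_R 0) Rd Hc).
  assert (Hh : forall p, W p -> hol (fun q => Cconj (fst (F q))) p /\ hol (fun q => Cconj (snd (F q))) p).
  { intros p Wp. apply (conj_component_hol F p (proj2 (HF p Wp))). }
  assert (Nad : a <> d) by (rewrite <- (Cpow_1_r d); apply Had).
  assert (Q1 : forall p, W p -> Cconj (fst (F (tri a 0 d 1 p))) = a * Cconj (fst (F p))).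
  { intros p Wp. rewrite (proj1 (Eq p Wp)). ring. }
  assert (Q2 : forall p, W p -> Cconj (snd (F (tri a 0 d 1 p))) = d * Cconj (snd (F p))).
  { intros p Wp. apply (Eq p Wp). }
  destruct (Rle_dec (Cmod a) (Cmod d)) as [L|L].
  - destruct (semi_invariant (fun p => Cconj (fst (F p))) a 0 d a 1)
      as (A & k1 & m1 & Hm1 & _ & _ & Hk1 & E1); auto; [lra|intros p Wp; apply (Hh p Wp)|].
    destruct (semi_invariant (fun p => Cconj (snd (F p))) a 0 d d 1)
      as (b2 & D & m2 & Hm2 & Hb2 & _ & Hk2 & E2); auto; [intros p Wp; apply (Hh p Wp)|].
    assert (k1 = 0) as -> by (destruct Hk1 as [|Hk1]; auto; now apply Had in Hk1).
    assert (b2 = 0) as -> by (destruct Hb2 as [|Hb2]; auto; congruence).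
    apply (conjugate_triangular f F conj2 a 0 d A 0 D 1 1); auto; try now apply punctured_neq_0.
    + intros; now apply HF.
    + intros p Wp. apply eq_conj2; unfold tri, lin, swap; simpl.
      * rewrite E1 by auto. ring.
      * rewrite E2 by auto. destruct Hk2 as [->|Hk2]; [ring|].
        rewrite <- (Cpow_1_r d) in Hk2 at 1. apply punctured_pow_inj in Hk2; auto. subst m2. ring.
  (* Here [|d| < |a|]; after the exchange of coordinates the first eigenvalue is again the smaller
     one. The term in [z ^ m2] of the second component survives when [d = a ^ m2]. *)
  - assert (Sw : forall q, swap (tri d 0 a 1 q) = tri a 0 d 1 (swap q)).
    { intros [z w]. unfold swap, tri; simpl. f_equal; ring. }
    assert (Hs : forall psi : C2 -> C, (forall p, W p -> hol psi p) -> forall p, W p -> hol (fun q => psi (swap q)) p).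
    { intros psi H p Wp.
      apply (ex_filterdiff_comp' (K := C_AbsRing) (U := C2_NormedModule) (V := C2_NormedModule)
        (W := C_NormedModule) swap psi p (swap_holomorphic p)). now apply H, swap_W. }
    destruct (semi_invariant (fun p => Cconj (fst (F (swap p)))) d 0 a a 1)
      as (b1 & A & m1 & Hm1 & Hb1 & _ & Hk1 & E1); auto; [lra| | |].
    { apply (Hs (fun q => Cconj (fst (F q)))). intros p Wp; apply (Hh p Wp). }
    { intros p Wp. rewrite Sw, Q1 by now apply swap_W. reflexivity. }
    destruct (semi_invariant (fun p => Cconj (snd (F (swap p)))) d 0 a d 1)
      as (D & k2 & m2 & Hm2 & Hb2 & _ & Hk2 & E2); auto; [lra| | |].
    { apply (Hs (fun q => Cconj (snd (F q)))). intros p Wp; apply (Hh p Wp). }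
    { intros p Wp. rewrite Sw, Q2 by now apply swap_W. reflexivity. }
    assert (b1 = 0) as -> by (destruct Hb1 as [|Hb1]; auto; congruence).
    apply (conjugate_triangular_swapped f F a d A k2 D m2); auto; try now apply punctured_neq_0.
    + intros; now apply HF.
    + intros p Wp. apply eq_conj2; unfold tri, lin, swap; simpl.
      * rewrite <- (swap_swap p) at 1. rewrite E1 by now apply swap_W. simpl.
        destruct Hk1 as [->|Hk1]; [ring|].
        rewrite <- (Cpow_1_r a) in Hk1 at 1. apply punctured_pow_inj in Hk1; auto. subst m1. simpl. ring.
      * rewrite <- (swap_swap p) at 1. rewrite E2 by now apply swap_W. simpl. reflexivity.
Qed.

(** Conjugation exchanges the eigenvalues [a] and [Cconj a], so [F] exchanges the axes: it sends
    [(z, w)] to the conjugate of [(D * w, A * z)]. The involution identity reads [Cconj D * A = 1],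
    and the diagonal map with entries [Cconj D] and [1] intertwines [F] with [conj_swap], with no
    unit equation to solve. *)
Lemma conjugate_conj_swap (f F : C2 -> C2) (sigma std : quotient f -> quotient f) (a : C) :
  f = tri a 0 (Cconj a) 1 -> in_punctured_disc a -> ~ is_real a ->
  antiholomorphic_involution_W F -> is_lift sigma F -> is_lift std conj_swap ->
  exists g g' : quotient f -> quotient f,
    biholomorphic_pair g g' /\ forall A, sigma A = g (std (g' A)).
Proof.
  intros Ef Ha Na HF HL HS.
  assert (Hd : in_punctured_disc (Cconj a)) by (unfold in_punctured_disc in *; now rewrite Cmod_conj).
  assert (Hc := lift_commutes f F a 0 (Cconj a) 1 sigma Ef Ha Hd (or_introl eq_refl) (le_n 1) HF HL).
  rewrite Ef in Hc. destruct HF as [HF Inv].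
  assert (Hh : forall p, W p -> hol (fun q => Cconj (fst (F q))) p /\ hol (fun q => Cconj (snd (F q))) p).
  { intros p Wp. apply (conj_component_hol F p (proj2 (HF p Wp))). }
  assert (Nad : a <> Cconj a).
  { intros E. apply Na. unfold is_real. apply (f_equal Im) in E. change (Im a = - Im a)%R in E. lra. }
  assert (La : (Cmod a <= Cmod (Cconj a))%R) by (rewrite Cmod_conj; lra).
  destruct (semi_invariant (fun p => Cconj (snd (F p))) a 0 (Cconj a) a 1)
    as (A & k1 & m1 & Hm1 & _ & _ & Hk1 & E1); auto; [lra|intros p Wp; apply (Hh p Wp)| |].
  { intros p Wp. rewrite Hc by auto. unfold tri; simpl. now rewrite Cmult_conj, Cconj_conj. }
  destruct (semi_invariant (fun p => Cconj (fst (F p))) a 0 (Cconj a) (Cconj a) 1)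
    as (b2 & D & m2 & Hm2 & Hb2 & _ & Hk2 & E2); auto; [intros p Wp; apply (Hh p Wp)| |].
  { intros p Wp. rewrite Hc by auto. unfold tri; simpl. rewrite Cplus_conj, !Cmult_conj, Cconj_R. ring. }
  assert (b2 = 0) as -> by (destruct Hb2 as [|Hb2]; auto; congruence).
  (* A nonzero [k1] would give [a = Cconj a ^ m1]; comparing moduli yields [m1 = 1], which makes [a]
     real. *)
  assert (K1 : k1 = 0).
  { destruct Hk1 as [|Hk1]; auto. exfalso.
    assert (M := f_equal Cmod Hk1). rewrite Cmod_pow, Cmod_conj in M.
    assert (Y : RtoC (Cmod a) ^ 1 = RtoC (Cmod a) ^ m1) by (rewrite <- !RtoC_pow, <- M; f_equal; ring).
    apply punctured_pow_inj in Y.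
    - subst m1. rewrite Cpow_1_r in Hk1. contradiction.
    - unfold in_punctured_disc. unfold in_punctured_disc in Ha. rewrite Cmod_R, Rabs_pos_eq; lra. }
  assert (E : forall p, W p -> F p = (Cconj (D * snd p), Cconj (A * fst p))).
  { intros p Wp. apply (eq_conj2 (D * snd p, A * fst p)); simpl.
    - rewrite E2 by auto. destruct Hk2 as [->|Hk2]; [ring|].
      rewrite <- (Cpow_1_r (Cconj a)) in Hk2 at 1. apply punctured_pow_inj in Hk2; auto. subst m2. ring.
    - rewrite E1, K1 by auto. ring. }
  assert (O1 : RtoC 1 <> 0) by (apply RtoC_neq_0; lra).
  assert (U := Inv (RtoC 1, RtoC 0) (W_1 _ _ O1)).
  rewrite (E (F (RtoC 1, RtoC 0))) in U by apply HF, W_1, O1. rewrite E in U by apply W_1, O1.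
  simpl in U. apply (f_equal fst) in U. simpl in U.
  rewrite Cmult_conj, Cconj_conj, Cmult_1_r in U.
  assert (D0 : Cconj D <> 0).
  { intros Z. rewrite Z in U. apply O1. rewrite <- U. ring. }
  subst f.
  apply (conjugate_by_lift _ _ conj_swap F _ _ sigma std
    (tri_inverse a 0 (Cconj a) 1 (punctured_neq_0 a Ha) (punctured_neq_0 _ Hd) (le_n 1))
    (tri_inverse (Cconj D) 0 1 1 D0 O1 (le_n 1))); auto.
  - intros p. apply tri_commute; auto.
  - intros p Wp. rewrite E by now apply tri_W. unfold tri, conj_swap; simpl. f_equal.
    + rewrite !Cmult_conj, !Cconj_R. ring.
    + replace (A * (Cconj D * fst p + 0 * (snd p * 1))) with ((Cconj D * A) * fst p) by ring.
      now rewrite U, !Cmult_1_l.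
Qed.
Lemma real_Cconj (a : C) : is_real a -> Cconj a = a.
Proof.
  intros H. unfold is_real in H. apply injective_projections; simpl; auto.
  change (- Im a = Im a)%R. lra.
Qed.

Theorem theorem3p6 (k : contraction)
  (hk : is_contraction k)
  (hf : real_coefficients k \/ in_IIc' k)
  (sigma : hopf_surface k -> hopf_surface k)
  (hsigma : real_structure sigma)
  (heven : even_structure sigma) :
  exists g g' : hopf_surface k -> hopf_surface k,
    biholomorphic_pair g g' /\
    forall A, sigma A = g (standard_structure k (g' A)).
Proof.
  destruct heven as (F & [HF _] & HL & Inv).
  assert (HI : antiholomorphic_involution_W F) by now split.
  assert (HS := standard_structure_is_lift k hf). unfold standard_lift in HS.
  (* The same test decides [standard_lift], so each branch knows which conjugation induces the
     standard structure. *)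
  destruct (excluded_middle_informative (in_IIc' k)) as [(a & -> & Ha & Na)|N].
  - apply (conjugate_conj_swap _ F _ _ a); auto.
    apply functional_extensionality. intros [z w]. unfold tri; simpl. f_equal. ring.
  - destruct hf as [hf|]; [|contradiction]. unfold real_coefficients in hf.
    assert (hr := proj1 (Forall_forall _ _) hf). clear hf.
    destruct k as [alpha|r delta|r delta|alpha|alpha delta]; simpl in hk, hr.
    + apply (conjugate_scalar _ F _ _ alpha); auto.
      * apply functional_extensionality. intros [z w]. unfold tri; simpl. f_equal. ring.
      * apply real_Cconj, hr; auto.
    + apply (conjugate_resonant _ F _ _ 0 delta r); auto; try tauto; try lia.
      * apply functional_extensionality. intros [z w]. unfold tri; simpl. f_equal. ring.
      * apply real_Cconj, hr; auto.
    + apply (conjugate_resonant _ F _ _ 1 delta r); auto; try tauto; try lia.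
      * apply functional_extensionality. intros [z w]. unfold tri; simpl. f_equal. ring.
      * apply real_Cconj, hr; auto.
    + apply (conjugate_resonant _ F _ _ 1 alpha 1); auto.
      * apply functional_extensionality. intros [z w]. unfold tri; simpl. f_equal. ring.
      * apply real_Cconj, hr; auto.
    + apply (conjugate_nonresonant _ F _ _ alpha delta); auto; try tauto.
      * apply functional_extensionality. intros [z w]. unfold tri; simpl. f_equal. ring.
      * apply real_Cconj, hr; auto.
      * apply real_Cconj, hr; auto.
Qed.
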